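(* Let $X=\mathrm{Spec}(R)$ be a local Noetherian scheme with closed point $x_0$, with irreducible components having generic points $\eta_1,\dots,\eta_r$. Let $\mathcal{M}\subset\mathcal{N}$ be finitely generated $R$-modules such that either (1) for each $i$ the modules $\mathcal{M}_{\eta_i}$ and $\mathcal{N}_{\eta_i}$ are free $\mathcal{O}_{X,\eta_i}$-modules, or (2) $\mathcal{M}$ and $\mathcal{N}$ are contained in a free $R$-module. Suppose $\mathcal{N}$ has deficient analytic spread (at $x_0$) and $x_0\notin\mathrm{Ass}_X(\mathcal{N}^n/\overline{\mathcal{M}^n})$ for each $n$. Then $\mathcal{M}$ has deficient analytic spread (at $x_0$), too.
   Context: Rees algebra: for a finitely generated $R$-module $\mathcal{M}$, $\mathcal{R}(\mathcal{M}):=\mathrm{Sym}(\mathcal{M})/\bigcap_g\mathcal{L}_g$, where $g$ runs over all homomorphisms from $\mathcal{M}$ to a free $R$-module $\mathcal{F}_g$ and $\mathcal{L}_g$ is the kernel of $\mathrm{Sym}(\mathcal{M})\to\mathrm{Sym}(\mathcal{F}_g)$. The inclusion $\mathcal{M}\subset\mathcal{N}$ induces $\mathcal{R}(\mathcal{M})\to\mathcal{R}(\mathcal{N})$. For $n\ge1$, $\mathcal{N}^n$ is the $n$th graded component of $\mathcal{R}(\mathcal{N})$ and $\mathcal{M}^n$ is the image in $\mathcal{R}(\mathcal{N})$ of the $n$th graded component of $\mathcal{R}(\mathcal{M})$. The integral closure $\overline{\mathcal{M}^n}$ of $\mathcal{M}^n$ in $\mathcal{N}^n$ is the submodule of all $g\in\mathcal{N}^n$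 satisfying in $\mathcal{R}(\mathcal{N})$ an equation $g^u+m_1g^{u-1}+\cdots+m_u=0$ with $u\ge1$ and $m_i\in\mathcal{M}^{ni}$. $\mathrm{Ass}_X(L)$ is the set of points of $X$ whose prime ideals are associated primes of the $R$-module $L$. A finitely generated $R$-module $\mathcal{K}$ has deficient analytic spread (at $x_0$) if each irreducible component of the fiber of $\mathrm{Proj}(\mathcal{R}(\mathcal{K}))$ over $x_0$ is of codimension at least $2$ in $\mathrm{Proj}(\mathcal{R}(\mathcal{K}))$, where the codimension of an irreducible closed subset is the Krull dimension of the local ring at its generic point. *)

(* Defs.v *)
From HB Require Import structures.
From mathcomp Require Import all_boot all_algebra generic_quotient ring_quotient.
From mathcomp Require Import ring finmap monalg boolp classical_sets.

Set Implicit Arguments.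
Unset Strict Implicit.
Unset Printing Implicit Defensive.

Import GRing.Theory.

Local Open Scope classical_set_scope.
Local Open Scope ring_scope.
Local Open Scope quotient_scope.

Section Ideals.
Variable A : comPzRingType.
Implicit Types (I P m E : set A) (x y : A).

Definition ideal I : Prop :=
  [/\ I 0, forall x y, I x -> I y -> I (x + y) & forall a x, I x -> I (a * x)].

Definition ideal_gen E : set A :=
  [set x | exists2 s : seq (A * A),
     forall c, c \in s -> E c.2 & x = \sum_(c <- s) c.1 * c.2].

Definition prime_ideal P : Prop :=
  [/\ ideal P, ~ P 1 & forall x y, P (x * y) -> P x \/ P y].

Definition maximal_ideal m : Prop :=
  [/\ ideal m, ~ m 1 & forall I, ideal I -> ~ I 1 -> m `<=` I -> I `<=` m].

Definition noetherian : Prop :=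
  forall I, ideal I -> exists s : seq A, I = ideal_gen [set x | x \in s].

Definition is_local_with m : Prop :=
  maximal_ideal m /\ forall m', maximal_ideal m' -> m' = m.

Definition Spec : set (set A) := [set P | prime_ideal P].

Definition krull_dim_ge (n : nat) : Prop :=
  exists p : nat -> set A,
    (forall i, (i <= n)%N -> prime_ideal (p i)) /\
    (forall i, (i < n)%N -> p i `<` p i.+1).

End Ideals.

Arguments Spec A : clear implicits.

(* X is Spec A, or Proj of a grading of A. In the latter case E need not consist
   of homogeneous elements: a homogeneous prime contains E iff it contains all
   homogeneous components of the elements of E. *)
Section Zariski.
Variables (A : comPzRingType) (X : set (set A)).

Definition zariski_closed (Z : set (set A)) : Prop :=
  exists E : set A, Z = [set P | X P /\ E `<=` P].

Definition irreducible (Z : set (set A)) : Prop :=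
  [/\ Z `<=` X, Z !=set0 &
      forall Z1 Z2, zariski_closed Z1 -> zariski_closed Z2 ->
        Z `<=` Z1 `|` Z2 -> Z `<=` Z1 \/ Z `<=` Z2].

Definition irreducible_component (Y Z : set (set A)) : Prop :=
  [/\ irreducible Z, Z `<=` Y &
      forall Z', irreducible Z' -> Z' `<=` Y -> Z `<=` Z' -> Z' = Z].

Definition zariski_closure (Y : set (set A)) : set (set A) :=
  [set P | X P /\ forall C, zariski_closed C -> Y `<=` C -> C P].

Definition generic_point (Z : set (set A)) (P : set A) : Prop :=
  X P /\ Z = zariski_closure [set P].

End Zariski.

Section Modules.
Variables (A : pzRingType) (V : lmodType A).

Definition fin_gen : Prop :=
  exists (k : nat) (g : 'I_k -> V),
    forall v, exists c : 'I_k -> A, v = \sum_i c i *: g i.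

Definition free_module : Prop :=
  exists B : set V,
    (forall v, exists (s : seq V) (c : V -> A),
        (forall b, b \in s -> B b) /\ v = \sum_(b <- s) c b *: b) /\
    (forall (s : seq V) (c : V -> A), uniq s -> (forall b, b \in s -> B b) ->
        \sum_(b <- s) c b *: b = 0 -> forall b, b \in s -> c b = 0).

End Modules.

(* Associated primes of the quotient L / L' of two submodules of V. The
   annihilator of the class of x in L / L' is [set r | L' (r *: x)]. *)
Definition Ass_quot (A : comPzRingType) (V : lmodType A) (L L' : set V) :
    set (set A) :=
  [set p | prime_ideal p /\ exists2 x, L x & p = [set r | L' (r *: x)]].

(* [locmod V T] is the module of fractions of V whose denominators lie in the
   multiplicative set [mult_closure T] generated by T, and [loc T] is the
   corresponding ring of fractions. *)
Section Denominators.
Variables (A : comPzRingType) (T : set A).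

Definition mult_closure : set A :=
  [set t | exists2 s : seq A, forall x, x \in s -> T x & t = \prod_(x <- s) x].

Lemma mult_closure1 : mult_closure 1.
Proof. by exists [::] => //; rewrite big_nil. Qed.

Lemma mult_closureM x y :
  mult_closure x -> mult_closure y -> mult_closure (x * y).
Proof.
case=> s sT -> [s' s'T ->]; exists (s ++ s'); last by rewrite big_cat.
by move=> z; rewrite mem_cat => /orP[/sT|/s'T].
Qed.

Definition denom := {t : A | `[< mult_closure t >]}.

Definition Denom t (Tt : mult_closure t) : denom := exist _ t (asboolT Tt).

Definition dval (d : denom) : A := sval d.

Lemma denomP (d : denom) : mult_closure (dval d).
Proof. exact/asboolP/(valP d). Qed.

Definition denom1 : denom := Denom mult_closure1.

Definition denomM (d e : denom) : denom :=
  Denom (mult_closureM (denomP d) (denomP e)).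

Lemma dval1 : dval denom1 = 1. Proof. by []. Qed.

Lemma dvalM d e : dval (denomM d e) = dval d * dval e. Proof. by []. Qed.

End Denominators.

Arguments dval {A T} d : simpl never.
Arguments denomM {A T} d e : simpl never.
Arguments denom1 {A T} : simpl never.

Section Fractions.
Variables (A : comPzRingType) (V : lmodType A) (T : set A).
Implicit Types (v w : V) (d e : denom T).

Definition frac := (V * denom T)%type.
HB.instance Definition _ := Choice.on frac.

Definition frac_eq : rel frac := fun x y =>
  `[< exists2 u, mult_closure T u &
        u *: (dval y.2 *: x.1) = u *: (dval x.2 *: y.1) >].

Lemma frac_eq_equiv : equiv_class_of frac_eq.
Proof.
split=> [x|x y|y x z].
- by apply/asboolP; exists 1 => //; exact: mult_closure1.
- by apply/asboolP/asboolP => -[u Tu e]; exists u.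
- move=> /asboolP[u Tu e] /asboolP[v Tv e']; apply/asboolP.
  exists (u * v * dval y.2).
    by do !apply: mult_closureM => //; exact: denomP.
  transitivity ((v * dval z.2) *: (u *: (dval y.2 *: x.1))).
    by rewrite !scalerA; congr (_ *: _); ring.
  rewrite e; transitivity ((u * dval x.2) *: (v *: (dval z.2 *: y.1))).
    by rewrite !scalerA; congr (_ *: _); ring.
  by rewrite e' !scalerA; congr (_ *: _); ring.
Qed.

Canonical frac_equiv := EquivRelPack frac_eq_equiv.
Canonical frac_encModRel := defaultEncModRel frac_eq.

Definition locmod := {eq_quot frac_eq}.
HB.instance Definition _ : EqQuotient frac frac_eq locmod :=
  EqQuotient.on locmod.
HB.instance Definition _ := Choice.on locmod.

Definition fraction v d : locmod := \pi_locmod ((v, d) : frac).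

Lemma fractionP x : exists v d, x = fraction v d.
Proof. by elim/quotP: x => -[v d] _; exists v, d. Qed.

Lemma fraction_eqP v d w e :
  fraction v d = fraction w e <->
  exists2 u, mult_closure T u & u *: (dval e *: v) = u *: (dval d *: w).
Proof.
rewrite /fraction; split=> [/eqP|h]; first by rewrite piE => /asboolP.
by apply/eqP; rewrite piE; apply/asboolP.
Qed.

Lemma fraction_eq v d w e : dval e *: v = dval d *: w ->
  fraction v d = fraction w e.
Proof.
move=> h; apply/fraction_eqP; exists 1; first exact: mult_closure1.
by rewrite h.
Qed.

Definition locmod_zero : locmod := fraction 0 denom1.
Definition locmod_opp (x : locmod) : locmod :=
  fraction (- (repr x).1) (repr x).2.
Definition locmod_add (x y : locmod) : locmod :=
  fraction (dval (repr y).2 *: (repr x).1 + dval (repr x).2 *: (repr y).1)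
           (denomM (repr x).2 (repr y).2).

Lemma repr_fraction v d : exists2 u, mult_closure T u &
  u *: (dval d *: (repr (fraction v d)).1) =
  u *: (dval (repr (fraction v d)).2 *: v).
Proof.
have : fraction (repr (fraction v d)).1 (repr (fraction v d)).2 = fraction v d.
  by rewrite /fraction -surjective_pairing reprK.
by case/fraction_eqP => u Tu e; exists u.
Qed.

Lemma fractionN v d : locmod_opp (fraction v d) = fraction (- v) d.
Proof.
have [u Tu e] := repr_fraction v d; apply/fraction_eqP; exists u => //.
by rewrite !scalerN e.
Qed.

Lemma fractionD v d w e :
  locmod_add (fraction v d) (fraction w e) =
  fraction (dval e *: v + dval d *: w) (denomM d e).
Proof.
have [u Tu h] := repr_fraction v d; have [u' Tu' h'] := repr_fraction w e.
apply/fraction_eqP; exists (u * u'); first exact: mult_closureM.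
rewrite ?dvalM.
move: (repr (fraction v d)) (repr (fraction w e)) h h' => [v' d'] [w' e'] /=.
move=> h h'; rewrite !scalerDr !scalerA; congr (_ + _).
  transitivity ((u' * dval e * dval e') *: (u *: (dval d *: v'))).
    by rewrite !scalerA; congr (_ *: _); ring.
  by rewrite h !scalerA; congr (_ *: _); ring.
transitivity ((u * dval d * dval d') *: (u' *: (dval e *: w'))).
  by rewrite !scalerA; congr (_ *: _); ring.
by rewrite h' !scalerA; congr (_ *: _); ring.
Qed.

Lemma locmod_addA : associative locmod_add.
Proof.
move=> x y z; have [v [d ->]] := fractionP x; have [w [e ->]] := fractionP y.
have [t [f ->]] := fractionP z; rewrite !fractionD; apply: fraction_eq; rewrite ?(dvalM, dval1).
by rewrite !scalerDr !scalerA addrA; congr (_ *: _ + _ *: _ + _ *: _); ring.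
Qed.

Lemma locmod_addC : commutative locmod_add.
Proof.
move=> x y; have [v [d ->]] := fractionP x; have [w [e ->]] := fractionP y.
rewrite !fractionD; apply: fraction_eq; rewrite ?(dvalM, dval1).
by rewrite addrC mulrC.
Qed.

Lemma locmod_add0 : left_id locmod_zero locmod_add.
Proof.
move=> x; have [v [d ->]] := fractionP x.
by rewrite fractionD scaler0 add0r; apply: fraction_eq; rewrite ?(dvalM, dval1) !scalerA; congr (_ *: _); ring.
Qed.

Lemma locmod_addN : left_inverse locmod_zero locmod_opp locmod_add.
Proof.
move=> x; have [v [d ->]] := fractionP x; rewrite fractionN fractionD.
by apply: fraction_eq; rewrite scalerN addNr !scaler0.
Qed.

HB.instance Definition _ := GRing.isZmodule.Build locmod
  locmod_addA locmod_addC locmod_add0 locmod_addN.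

Lemma fractionDE v d w e :
  fraction v d + fraction w e = fraction (dval e *: v + dval d *: w) (denomM d e).
Proof. exact: fractionD. Qed.

Lemma fractionNE v d : - fraction v d = fraction (- v) d.
Proof. exact: fractionN. Qed.

End Fractions.

Arguments fraction {A V T}.

Section LocRing.
Variables (A : comPzRingType) (T : set A).

Definition loc := locmod A^o T.
HB.instance Definition _ := GRing.Zmodule.on loc.

Definition lfrac (a : A) (d : denom T) : loc := fraction (a : A^o) d.

Definition loc_one : loc := lfrac 1 denom1.

End LocRing.

Section LocScale.
Variables (A : comPzRingType) (V : lmodType A) (T : set A).

Definition loc_scale (x : loc T) (y : locmod V T) : locmod V T :=
  fraction (((repr x).1 : A) *: (repr y).1) (denomM (repr x).2 (repr y).2).

Lemma lfracZ (a : A) (d : denom T) (v : V) (e : denom T) :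
  loc_scale (lfrac a d) (fraction v e) = fraction (a *: v) (denomM d e).
Proof.
have [u Tu h] := repr_fraction (a : A^o) d.
have [u' Tu' h'] := repr_fraction v e.
apply/fraction_eqP; exists (u * u'); first exact: mult_closureM.
rewrite ?dvalM.
rewrite /lfrac; move: (repr (fraction (a : A^o) d)) (repr (fraction v e)) h h'.
move=> [a' d'] [v' e'] /= h h'.
transitivity ((u *: (dval d *: a') : A) *: (u' *: (dval e *: v'))).
  by rewrite !scalerA; congr (_ *: _); rewrite /GRing.scale /=; ring.
rewrite h h' !scalerA; congr (_ *: _).
by rewrite /GRing.scale /=; ring.
Qed.

End LocScale.

Section LocStructures.
Variables (A : comPzRingType) (T : set A).

Definition loc_mul : loc T -> loc T -> loc T := @loc_scale A A^o T.

Lemma lfracM (a b : A) (d e : denom T) :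
  loc_mul (lfrac a d) (lfrac b e) = lfrac (a * b) (denomM d e).
Proof. exact: (@lfracZ A A^o T). Qed.

Lemma lfracP (x : loc T) : exists a d, x = lfrac a d.
Proof. by have [a [d ->]] := @fractionP A A^o T x; exists a, d. Qed.

Lemma lfrac_eq (a b : A) (d e : denom T) :
  dval e * a = dval d * b -> lfrac a d = lfrac b e.
Proof. exact: (@fraction_eq A A^o T). Qed.

Lemma lfracD (a b : A) (d e : denom T) :
  lfrac a d + lfrac b e = lfrac (dval e * a + dval d * b) (denomM d e).
Proof. exact: (@fractionD A A^o T). Qed.

Lemma lfracN (a : A) (d : denom T) : - lfrac a d = lfrac (- a) d.
Proof. exact: (@fractionN A A^o T). Qed.

Lemma loc_mulA : associative loc_mul.
Proof.
move=> x y z; have [a [d ->]] := lfracP x; have [b [e ->]] := lfracP y.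
by have [c [f ->]] := lfracP z; rewrite !lfracM; apply: lfrac_eq; rewrite ?(dvalM, dval1); ring.
Qed.

Lemma loc_mulC : commutative loc_mul.
Proof.
move=> x y; have [a [d ->]] := lfracP x; have [b [e ->]] := lfracP y.
by rewrite !lfracM; apply: lfrac_eq; rewrite ?(dvalM, dval1); ring.
Qed.

Lemma loc_mul1 : left_id (loc_one T) loc_mul.
Proof.
move=> x; have [a [d ->]] := lfracP x.
by rewrite lfracM; apply: lfrac_eq; rewrite ?(dvalM, dval1); ring.
Qed.

Lemma loc_mulDl : left_distributive loc_mul +%R.
Proof.
move=> x y z; have [a [d ->]] := lfracP x; have [b [e ->]] := lfracP y.
have [c [f ->]] := lfracP z.
by rewrite !(lfracM, lfracD); apply: lfrac_eq; rewrite ?(dvalM, dval1); ring.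
Qed.

HB.instance Definition _ := GRing.Zmodule_isComPzRing.Build (loc T)
  loc_mulA loc_mulC loc_mul1 loc_mulDl.

Lemma lfracME (a b : A) (d e : denom T) :
  lfrac a d * lfrac b e = lfrac (a * b) (denomM d e).
Proof. exact: lfracM. Qed.

Variable V : lmodType A.
Local Notation scale := (@loc_scale A V T).

Lemma loc_scaleA (x y : loc T) v : scale x (scale y v) = scale (x * y) v.
Proof.
have [a [d ->]] := lfracP x; have [b [e ->]] := lfracP y.
have [w [f ->]] := fractionP v; rewrite lfracME !lfracZ.
by apply: fraction_eq; rewrite ?(dvalM, dval1) !scalerA; congr (_ *: _); ring.
Qed.

Lemma loc_scale1 : left_id 1 scale.
Proof.
move=> x; have [v [d ->]] := fractionP x; rewrite lfracZ scale1r.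
by apply: fraction_eq; rewrite ?(dvalM, dval1) mul1r.
Qed.

Lemma loc_scaleDr : right_distributive scale +%R.
Proof.
move=> x v w; have [a [d ->]] := lfracP x; have [v' [e ->]] := fractionP v.
have [w' [f ->]] := fractionP w; rewrite fractionDE !lfracZ fractionDE.
by apply: fraction_eq; rewrite ?(dvalM, dval1) !scalerDr !scalerA;
   congr (_ *: _ + _ *: _); ring.
Qed.

Lemma loc_scaleDl v : {morph scale^~ v : x y / x + y}.
Proof.
move=> x y; have [a [d ->]] := lfracP x; have [b [e ->]] := lfracP y.
have [w [f ->]] := fractionP v; rewrite lfracD !lfracZ fractionDE.
by apply: fraction_eq; rewrite ?(dvalM, dval1) !scalerA -scalerDl !scalerA;
   congr (_ *: _); ring.
Qed.

HB.instance Definition _ := GRing.Zmodule_isLmodule.Build (loc T) (locmod V T)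
  loc_scaleA loc_scale1 loc_scaleDr loc_scaleDl.

End LocStructures.


Section Gradings.
Variable A : comPzRingType.

Record grading := Grading {
  gcomp :> nat -> set A;
  grading0 : forall n, gcomp n 0;
  gradingB : forall n x y, gcomp n x -> gcomp n y -> gcomp n (x - y);
  grading1 : gcomp 0%N 1;
  gradingM : forall m n x y, gcomp m x -> gcomp n y -> gcomp (m + n)%N (x * y);
  grading_sum : forall x, exists (n : nat) (f : nat -> A),
    (forall i, gcomp i (f i)) /\ x = \sum_(i < n) f i;
  grading_direct : forall (n : nat) (f : nat -> A),
    (forall i, gcomp i (f i)) -> \sum_(i < n) f i = 0 ->
    forall i, (i < n)%N -> f i = 0
}.

Definition homogeneous (S : grading) (P : set A) : Prop :=
  forall (n : nat) (f : nat -> A), (forall i, S i (f i)) ->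
    P (\sum_(i < n) f i) -> forall i, (i < n)%N -> P (f i).

Definition Proj (S : grading) : set (set A) :=
  [set P | [/\ prime_ideal P, homogeneous S P &
               exists n x, [/\ (0 < n)%N, S n x & ~ P x]]].

Variable S : grading.

Lemma gradingN n x : S n x -> S n (- x).
Proof. by move=> Sx; rewrite -sub0r; apply: gradingB => //; apply: grading0. Qed.

Lemma gradingD n x y : S n x -> S n y -> S n (x + y).
Proof. by move=> Sx Sy; rewrite -[y]opprK; apply/gradingB/gradingN. Qed.

Lemma grading_prod (T : Type) (r : seq T) (d : T -> nat) (F : T -> A) :
  (forall t, S (d t) (F t)) ->
  S (\sum_(t <- r) d t)%N (\prod_(t <- r) F t).
Proof.
move=> h; elim: r => [|t r IH]; first by rewrite !big_nil; apply: grading1.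
by rewrite !big_cons; apply: gradingM.
Qed.

Lemma gradingX n x k : S n x -> S (n * k)%N (x ^+ k).
Proof.
move=> Sx; elim: k => [|k IH]; first by rewrite muln0; apply: grading1.
by rewrite mulnS exprS; apply: gradingM.
Qed.

Lemma grading_pad n N (f : nat -> A) : (n <= N)%N ->
  \sum_(i < n) f i = \sum_(i < N) (if (i < n)%N then f i else 0).
Proof.
move=> le; rewrite -big_mkcond /= -(big_mkord xpredT) -(big_mkord (fun i => i < n)%N).
by rewrite (big_nat_widen _ _ _ _ _ le); apply: eq_bigl.
Qed.

Lemma homogeneous_of_sum (P : set A) : ideal P ->
  (forall x, P x -> exists (n : nat) (f : nat -> A),
     (forall i, S i (f i) /\ P (f i)) /\ x = \sum_(i < n) f i) ->
  homogeneous S P.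
Proof.
move=> [P0 _ _] h n f Sf /h[m [g [Sg e]]] i lti.
pose N := maxn n m.
pose f' i := if (i < n)%N then f i else 0.
pose g' i := if (i < m)%N then g i else 0.
have Pg' j : P (g' j) by rewrite /g'; case: ifP => // _; case: (Sg j).
have S' j : S j (f' j - g' j).
  apply: gradingB; rewrite /f' /g'; case: ifP => // _; try exact: grading0.
  by case: (Sg j).
have := grading_direct S' (n := N); rewrite sumrB /f' /g'.
rewrite -!grading_pad ?leq_maxl ?leq_maxr // e subrr => /(_ erefl i).
rewrite (leq_trans lti (leq_maxl _ _)) lti => /(_ isT)/eqP.
by rewrite subr_eq0 => /eqP ->; apply: Pg'.
Qed.

Lemma ideal_gen_ideal (E : set A) : ideal (ideal_gen E).
Proof.
split.
- by exists [::] => //; rewrite big_nil.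
- move=> x y [s sE ->] [t tE ->]; exists (s ++ t); last by rewrite big_cat.
  by move=> c; rewrite mem_cat => /orP[/sE|/tE].
- move=> a x [s sE ->]; exists [seq (a * c.1, c.2) | c <- s].
    by move=> c /mapP[d /sE Ed ->].
  by rewrite big_map big_distrr /=; apply: eq_bigr => c _; rewrite mulrA.
Qed.

Lemma homogeneous_ideal_gen (E : set A) (d : nat) :
  (forall x, E x -> S d x) -> homogeneous S (ideal_gen E).
Proof.
move=> Ed; apply: homogeneous_of_sum; first exact: ideal_gen_ideal.
have [I0 ID IM] := ideal_gen_ideal E.
move=> x [s sE ->]; elim: s sE => [|[a e] s IH] sE.
  by exists 0%N, (fun=> 0); rewrite big_nil big_ord0; split=> // i; split=> //;
     apply: grading0.
rewrite big_cons; have [|m [g [Sg ->]]] := IH; first by move=> c cs; apply: sE; rewrite inE cs orbT.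
have /= Ee : E e by apply: (sE (a, e)); rewrite inE eqxx.
have [n [f [Sf ->]]] := grading_sum S a.
rewrite /=; have He : ideal_gen E e.
  exists [:: (1, e)]; last by rewrite big_seq1 mul1r.
  by move=> c; rewrite inE => /eqP ->.
pose f' i := if (i < n + d)%N then (if (d <= i)%N then f (i - d)%N * e else 0) else 0.
pose g' i := if (i < m)%N then g i else 0.
exists (maxn (n + d) m), (fun i => f' i + g' i); split=> [i|].
  have Hf : S i (f' i) /\ ideal_gen E (f' i).
    rewrite /f'; case: ifP => _; last by split=> //; apply: grading0.
    case: ifP => [le|_]; last by split=> //; apply: grading0.
    split; last exact: IM.
    by rewrite -{1}(subnK le); apply: gradingM => //; apply: Ed.
  have Hg : S i (g' i) /\ ideal_gen E (g' i).
    by rewrite /g'; case: ifP => _ //; split=> //; apply: grading0.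
  by case: Hf Hg => ? ? [? ?]; split; [apply: gradingD | apply: ID].
rewrite big_split /= /f' /g'.
rewrite -(grading_pad g) ?leq_maxr //; congr (_ + _).
rewrite -(grading_pad (fun i => if (d <= i)%N then f (i - d)%N * e else 0))
  ?leq_maxl // addnC big_split_ord /= [X in _ = X + _]big1 ?add0r.
  by rewrite big_distrl; apply: eq_bigr => i _ /=; rewrite leq_addr addKn.
by move=> i _; rewrite leqNgt ltn_ord.
Qed.

End Gradings.

(* The degree 0 part of the ring of fractions whose denominators are products
   of homogeneous elements outside P; for P in Proj S, this is the local ring
   of Proj at P. *)
Section HomLoc.
Variables (A : comPzRingType) (S : grading A) (P : set A).

Definition hom_denoms : set A := [set t | (exists n, S n t) /\ ~ P t].

Definition homloc_pred : {pred loc hom_denoms} := fun x =>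
  `[< exists n a (d : denom hom_denoms),
        [/\ S n a, S n (dval d) & x = lfrac a d] >].

Lemma homloc_subring : subring_closed homloc_pred.
Proof.
split.
- apply/asboolP; exists 0%N, 1, denom1; split=> //; exact: grading1.
- move=> x y /asboolP[n [a [d [Sa Sd ->]]]] /asboolP[m [b [e [Sb Se ->]]]].
  apply/asboolP; exists (n + m)%N, (dval e * a + dval d * - b), (denomM d e).
  rewrite lfracN lfracD dvalM; split=> //; last exact: gradingM.
  apply: gradingD; last by apply: gradingM => //; apply: gradingN.
  by rewrite addnC; apply: gradingM.
- move=> x y /asboolP[n [a [d [Sa Sd ->]]]] /asboolP[m [b [e [Sb Se ->]]]].
  apply/asboolP; exists (n + m)%N, (a * b), (denomM d e).
  by rewrite lfracME dvalM; split=> //; exact: gradingM.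
Qed.

HB.instance Definition _ :=
  GRing.isSubringClosed.Build (loc hom_denoms) homloc_pred homloc_subring.

Definition homloc := {x : loc hom_denoms | x \in homloc_pred}.
HB.instance Definition _ := SubChoice.on homloc.
HB.instance Definition _ :=
  GRing.SubChoice_isSubComPzRing.Build _ _ homloc homloc_subring.

End HomLoc.

Section QuotientGrading.
Variables (A : comNzRingType) (I : idealr A) (S : grading A).
Hypothesis homI : homogeneous S [set x | x \in I].
Local Notation Q := {ideal_quot I}.

Lemma pi_eq0 (x : A) : (\pi_Q x == 0) = (x \in I).
Proof. by rewrite -[0 in LHS](rmorph0 \pi_Q) -Quotient.idealrBE subr0. Qed.

Definition quot_gcomp n : set Q := \pi_Q @` (S n).

Lemma quot_gcomp0 n : quot_gcomp n 0.
Proof. by exists 0; [exact: grading0 | rewrite rmorph0]. Qed.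

Lemma quot_gcompB n x y : quot_gcomp n x -> quot_gcomp n y -> quot_gcomp n (x - y).
Proof.
by move=> [a Sa <-] [b Sb <-]; exists (a - b); [exact: gradingB | rewrite rmorphB].
Qed.

Lemma quot_gcomp1 : quot_gcomp 0%N 1.
Proof. by exists 1; [exact: grading1 | rewrite rmorph1]. Qed.

Lemma quot_gcompM m n x y :
  quot_gcomp m x -> quot_gcomp n y -> quot_gcomp (m + n)%N (x * y).
Proof.
by move=> [a Sa <-] [b Sb <-]; exists (a * b); [exact: gradingM | rewrite rmorphM].
Qed.

Lemma quot_gcomp_sum x : exists (n : nat) (f : nat -> Q),
  (forall i, quot_gcomp i (f i)) /\ x = \sum_(i < n) f i.
Proof.
elim/quotP: x => a _; have [n [f [Sf ->]]] := grading_sum S a.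
exists n, (fun i => \pi_Q (f i)); split; first by move=> i; exists (f i).
by rewrite rmorph_sum.
Qed.

Lemma quot_gcomp_direct (n : nat) (f : nat -> Q) :
  (forall i, quot_gcomp i (f i)) -> \sum_(i < n) f i = 0 ->
  forall i, (i < n)%N -> f i = 0.
Proof.
move=> Sf e i lti.
have /choice[g /all_and2[Sg gf]] j : exists a, S j a /\ \pi_Q a = f j.
  by have [a Sa <-] := Sf j; exists a.
rewrite -gf; apply/eqP; rewrite pi_eq0.
apply: (homI Sg) lti; rewrite /= -pi_eq0 rmorph_sum; apply/eqP; rewrite -[RHS]e.
by apply: eq_bigr => j _; exact: gf.
Qed.

Definition quot_grading : grading Q :=
  Grading quot_gcomp0 quot_gcompB quot_gcomp1 quot_gcompM quot_gcomp_sum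
    quot_gcomp_direct.

End QuotientGrading.

(* The variable attached to x : M in the polynomial ring over R with one
   variable for each element of M. *)
HB.lock Definition var (R : comNzRingType) (M : lmodType R) (x : M) :
  {malg R[{cmonom M}]} := << ucm x >>.

Section Polynomials.
Variables (R : comNzRingType) (M : lmodType R).

Local Notation P := {malg R[{cmonom M}]}.

Definition malg_gcomp n : set P := [set p | forall k, p@_k != 0 -> mdeg k = n].

Lemma malg_gcomp0 n : malg_gcomp n 0.
Proof. by move=> k; rewrite mcoeff0 eqxx. Qed.

Lemma malg_gcompB n p q :
  malg_gcomp n p -> malg_gcomp n q -> malg_gcomp n (p - q).
Proof.
move=> hp hq k; rewrite mcoeffB => pq; have [p0|/hp//] := eqVneq p@_k 0.
by apply: hq; move: pq; rewrite p0 sub0r oppr_eq0.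
Qed.

Lemma malg_gcompU n (c : R) (k : {cmonom M}) :
  mdeg k = n -> malg_gcomp n << c *g k >>.
Proof.
move=> kn k'; rewrite mcoeffU; case: (eqVneq k k') => [<-//|_].
by rewrite mulr0n eqxx.
Qed.

Lemma malg_gcomp1 : malg_gcomp 0%N 1.
Proof. exact/malg_gcompU/mdeg1. Qed.

Lemma malg_gcompD n p q :
  malg_gcomp n p -> malg_gcomp n q -> malg_gcomp n (p + q).
Proof.
move=> hp hq; rewrite -[q]opprK; apply: malg_gcompB => //.
by rewrite -sub0r; apply: malg_gcompB => //; apply: malg_gcomp0.
Qed.

Lemma malg_gcomp_bigsum n (I : Type) (r : seq I) (C : pred I) (F : I -> P) :
  (forall i, C i -> malg_gcomp n (F i)) ->
  malg_gcomp n (\sum_(i <- r | C i) F i).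
Proof.
by move=> h; apply: big_ind => //; [exact: malg_gcomp0 | exact: malg_gcompD].
Qed.

Lemma malg_gcompM m n p q :
  malg_gcomp m p -> malg_gcomp n q -> malg_gcomp (m + n)%N (p * q).
Proof.
move=> hp hq; rewrite malgME big_seq; apply: malg_gcomp_bigsum => k kp.
rewrite big_seq; apply: malg_gcomp_bigsum => k' kq; apply: malg_gcompU.
by rewrite mdegM (hp k) ?mcoeff_neq0 // (hq k') ?mcoeff_neq0.
Qed.

Lemma malg_gcomp_sum (p : P) : exists (n : nat) (f : nat -> P),
  (forall i, malg_gcomp i (f i)) /\ p = \sum_(i < n) f i.
Proof.
exists (msize p), (fun i => \sum_(k <- msupp p | mdeg k == i) << p@_k *g k >>).
split=> [i|].
  by apply: malg_gcomp_bigsum => k /eqP; apply: malg_gcompU.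
rewrite (exchange_big_dep xpredT) //= [LHS]monalgE big_seq [RHS]big_seq.
apply: eq_bigr => k kp; have lt := msize_mdeg_lt kp.
rewrite (bigD1 (Ordinal lt)) /= ?eqxx // big1 ?addr0 // => i /andP[/eqP e].
by move/eqP => []; apply: val_inj.
Qed.

Lemma malg_gcomp_direct (n : nat) (f : nat -> P) :
  (forall i, malg_gcomp i (f i)) -> \sum_(i < n) f i = 0 ->
  forall i, (i < n)%N -> f i = 0.
Proof.
move=> hf e i lti; apply/malgP => k; rewrite mcoeff0; apply/eqP/negP => /negP nz.
have := congr1 (mcoeff k) e; rewrite raddf_sum mcoeff0 (bigD1 (Ordinal lti)) //=.
rewrite big1 ?addr0 => [|j ji]; first by move/eqP; rewrite (negPf nz).
apply/eqP/negP => /negP /hf dj; case/eqP: ji; apply: val_inj => /=.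
by rewrite -dj (hf i).
Qed.

Definition malg_grading : grading P :=
  Grading malg_gcomp0 malg_gcompB malg_gcomp1 malg_gcompM malg_gcomp_sum
    malg_gcomp_direct.


Lemma varE x : var x = << ucm x >> :> P.
Proof. by rewrite var.unlock. Qed.

Lemma var_gcomp x : malg_grading 1%N (var x).
Proof. by rewrite var.unlock; exact/malg_gcompU/mdegU. Qed.

Definition sym_rel : set P :=
  [set p | (exists x y, p = var (x + y) - var x - var y) \/
           (exists a x, p = var (a *: x) - a%:MP * var x)].

Lemma sym_rel_gcomp p : sym_rel p -> malg_grading 1%N p.
Proof.
case=> [[x [y ->]]|[a [x ->]]]; do !apply: gradingB; try exact: var_gcomp.
by rewrite -[1%N]add0n; apply: gradingM; [exact/malg_gcompU/mdeg1 | exact: var_gcomp].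
Qed.

Definition sym_ideal : {pred P} := fun p => `[< ideal_gen sym_rel p >].

Lemma sym_idealP p : reflect (ideal_gen sym_rel p) (p \in sym_ideal).
Proof. exact: asboolP. Qed.

Lemma sym_ideal_closed : idealr_closed sym_ideal.
Proof.
have [I0 ID IM] := ideal_gen_ideal sym_rel; split.
- exact/sym_idealP.
- apply/sym_idealP => -[s sE e].
  have := congr1 (mcoeff (mone : {cmonom M})) e; rewrite rmorph1 rmorph_sum.
  rewrite big_seq big1 => [/eqP|[a p] /sE/sym_rel_gcomp Sp /=]; first by rewrite oner_eq0.
  rewrite rmorphM /=; suff -> : p@_mone = 0 by rewrite mulr0.
  by apply/eqP/negP => /negP /Sp; rewrite mdeg1.
- by move=> a p q /sym_idealP Ip /sym_idealP Iq; apply/sym_idealP/ID => //; apply: IM.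
Qed.

HB.instance Definition _ := isIdealr.Build P sym_ideal sym_ideal_closed.

Definition Sym := {ideal_quot sym_ideal}.
HB.instance Definition _ := GRing.ComNzRing.on Sym.

Definition sym_pi : P -> Sym := \pi_{ideal_quot sym_ideal}.
HB.instance Definition _ := GRing.RMorphism.on sym_pi.

Lemma sym_homogeneous : homogeneous malg_grading [set p | p \in sym_ideal].
Proof.
suff -> : [set p | p \in sym_ideal] = ideal_gen sym_rel.
  exact: (homogeneous_ideal_gen (d := 1%N) sym_rel_gcomp).
by apply/predeqP => p; split => /sym_idealP.
Qed.

Definition sym_grading : grading Sym := quot_grading sym_homogeneous.

End Polynomials.


Arguments sym_ideal {R} M.
Arguments malg_gcomp {R} M n.

Section Functoriality.
Variables (R : comNzRingType) (M N : lmodType R).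
Local Notation P := {malg R[{cmonom M}]}.
Local Notation Q := {malg R[{cmonom N}]}.

Definition mon_map (g : M -> N) (k : {cmonom M}) : Q :=
  \prod_(x <- finsupp k) var (g x) ^+ k x.

Lemma mon_mapEw g (k : {cmonom M}) (d : {fset M}) : (finsupp k `<=` d)%fset ->
  mon_map g k = \prod_(x <- d) var (g x) ^+ k x.
Proof.
move=> le; rewrite /mon_map [LHS](big_fset_incl _ le) //= => x _.
by rewrite -cmE_eq0 => /eqP ->.
Qed.

Lemma mon_map_multiplicative g : mmorphism (mon_map g).
Proof.
split; last by rewrite /mon_map mdom1 big_seq_fset0.
move=> k k'; have le : (finsupp k `<=` finsupp (mmul k k'))%fset.
  by rewrite mdomD fsubsetUl.
have le' : (finsupp k' `<=` finsupp (mmul k k'))%fset.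
  by rewrite mdomD fsubsetUr.
rewrite (mon_mapEw g le) (mon_mapEw g le') -big_split /=.
by apply: eq_bigr => x _; rewrite cmM exprD.
Qed.

HB.instance Definition _ g :=
  isMultiplicative.Build {cmonom M} Q (mon_map g) (mon_map_multiplicative g).

(* The R-algebra morphism sending var x to var (g x). *)
Definition malg_map (g : M -> N) : P -> Q := mmap (@malgC _ _) (mon_map g).
HB.instance Definition _ g := GRing.RMorphism.on (malg_map g).

Lemma malg_mapC g (c : R) : malg_map g (malgC c) = malgC c.
Proof. exact: mmapC. Qed.

Lemma malg_map_var g x : malg_map g (var x) = var (g x).
Proof.
rewrite [var x]varE.
by rewrite /malg_map mmapU /= mpolyC1E mul1r /mon_map mdomU big_seq_fset1 cmUU expr1.
Qed.

Lemma malg_mapB g p q : malg_map g (p - q) = malg_map g p - malg_map g q.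
Proof. exact: (rmorphB (malg_map g)). Qed.

Lemma malg_mapM g p q : malg_map g (p * q) = malg_map g p * malg_map g q.
Proof. exact: (rmorphM (malg_map g)). Qed.

Lemma malg_mapE g p :
  malg_map g p = \sum_(k <- msupp p) malgC p@_k * mon_map g k.
Proof. by []. Qed.

Lemma mon_map_gcomp g (k : {cmonom M}) : malg_grading N (mdeg k) (mon_map g k).
Proof.
rewrite mdegE; apply: grading_prod => x.
by have := gradingX (k x) (@var_gcomp _ _ (g x)); rewrite mul1n.
Qed.

Lemma malg_map_gcomp g n p :
  malg_grading M n p -> malg_grading N n (malg_map g p).
Proof.
move=> Sp; rewrite malg_mapE big_seq; apply: malg_gcomp_bigsum => k kp.
rewrite -[n]add0n; apply: malg_gcompM; first exact/malg_gcompU/mdeg1.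
by rewrite -(Sp k) ?mcoeff_neq0 //; apply: mon_map_gcomp.
Qed.

Lemma malg_map_sym_ideal (g : {linear M -> N}) p :
  p \in sym_ideal M -> malg_map g p \in sym_ideal N.
Proof.
case/sym_idealP => s sE ->; apply/sym_idealP.
exists [seq (malg_map g c.1, malg_map g c.2) | c <- s]; last first.
  by rewrite rmorph_sum big_map; apply: eq_bigr => c _; rewrite rmorphM.
move=> c /mapP[[a p'] /sE/= Ep ->] /=; case: Ep => [[x [y ->]]|[b [x ->]]].
  left; exists (g x), (g y); rewrite malg_mapB malg_mapB -raddfD.
  by congr (_ - _ - _); apply: malg_map_var.
right; exists b, (g x); rewrite malg_mapB malg_mapM -linearZ.
by congr (_ - _ * _); [apply: malg_map_var | apply: malg_mapC | apply: malg_map_var].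
Qed.

Definition sym_map (g : {linear M -> N}) (x : Sym M) : Sym N :=
  sym_pi (malg_map g (repr x)).

Lemma sym_piP (x : Sym M) : exists p, x = sym_pi p.
Proof. by exists (repr x); rewrite /sym_pi reprK. Qed.

Lemma sym_map_pi (g : {linear M -> N}) p :
  sym_map g (sym_pi p) = sym_pi (malg_map g p).
Proof.
apply/eqP; rewrite -subr_eq0 -rmorphB -rmorphB /= pi_eq0.
by apply: malg_map_sym_ideal; rewrite Quotient.idealrBE reprK.
Qed.

Lemma sym_map_zmod_morphism g : zmod_morphism (sym_map g).
Proof.
move=> x y; have [p ->] := sym_piP x; have [q ->] := sym_piP y.
by rewrite -rmorphB !sym_map_pi !rmorphB.
Qed.

Lemma sym_map_monoid_morphism g : monoid_morphism (sym_map g).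
Proof.
split=> [|x y]; first by rewrite -(rmorph1 (@sym_pi R M)) sym_map_pi !rmorph1.
have [p ->] := sym_piP x; have [q ->] := sym_piP y.
by rewrite -rmorphM !sym_map_pi !rmorphM.
Qed.

HB.instance Definition _ g := GRing.isZmodMorphism.Build (Sym M) (Sym N)
  (sym_map g) (sym_map_zmod_morphism g).
HB.instance Definition _ g := GRing.isMonoidMorphism.Build (Sym M) (Sym N)
  (sym_map g) (sym_map_monoid_morphism g).

Lemma sym_map_gcomp g n x :
  sym_grading M n x -> sym_grading N n (sym_map g x).
Proof.
case=> p Sp <-; exists (malg_map g p); first exact: malg_map_gcomp.
exact: (esym (sym_map_pi g p)).
Qed.

End Functoriality.

Lemma malg_map_comp (R : comNzRingType) (L M N : lmodType R)
  (h : M -> N) (g : L -> M) p :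
  malg_map h (malg_map g p) = malg_map (h \o g) p.
Proof.
rewrite (malg_mapE g) rmorph_sum (malg_mapE (h \o g)); apply: eq_bigr => k _.
rewrite rmorphM /= malg_mapC /mon_map rmorph_prod; congr (_ * _).
by apply: eq_bigr => x _; rewrite rmorphXn /= malg_map_var.
Qed.

Lemma sym_map_comp (R : comNzRingType) (L M N : lmodType R)
  (h : {linear M -> N}) (g : {linear L -> M}) x :
  sym_map h (sym_map g x) = sym_map (h \o g) x.
Proof. by have [p ->] := sym_piP x; rewrite !sym_map_pi malg_map_comp. Qed.

Section Rees.
Variables (R : comNzRingType) (M : lmodType R).

(* The intersection of the kernels L_g. *)
Definition rees_ideal : {pred Sym M} := fun x =>
  `[< forall (F : lmodType R) (g : {linear M -> F}),
        free_module F -> sym_map g x = 0 >].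

Lemma rees_ideal_closed : idealr_closed rees_ideal.
Proof.
split.
- by apply/asboolP => F g _; rewrite rmorph0.
- apply/asboolP => h; have : sym_map (\0 : {linear M -> 'rV[R]_0}) 1 = 0.
    apply: h; exists set0; split=> [v|s c _ s0 _ b /s0 //].
    by exists [::], (fun=> 0); rewrite big_nil [v]thinmx0.
  by rewrite rmorph1 => /eqP; rewrite oner_eq0.
- move=> a x y /asboolP hx /asboolP hy; apply/asboolP => F g Ff.
  by rewrite rmorphD rmorphM /= hx // hy // mulr0 addr0.
Qed.

HB.instance Definition _ := isIdealr.Build (Sym M) rees_ideal rees_ideal_closed.

Definition Rees := {ideal_quot rees_ideal}.
HB.instance Definition _ := GRing.ComNzRing.on Rees.

Definition rees_pi : Sym M -> Rees := \pi_{ideal_quot rees_ideal}.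
HB.instance Definition _ := GRing.RMorphism.on rees_pi.

Lemma rees_piP (x : Rees) : exists p, x = rees_pi p.
Proof. by exists (repr x); rewrite /rees_pi reprK. Qed.

Lemma rees_homogeneous : homogeneous (sym_grading M) [set x | x \in rees_ideal].
Proof.
move=> n f Sf /asboolP h i lti; apply/asboolP => F g Ff.
have Sg j : sym_grading F j (sym_map g (f j)) by apply: sym_map_gcomp.
by apply: (grading_direct Sg _ lti); rewrite -rmorph_sum; apply: h.
Qed.

Definition rees_grading : grading Rees := quot_grading rees_homogeneous.

Definition rees_C : R -> Rees :=
  @rees_pi \o @sym_pi R M \o @malgC {cmonom M} R.
HB.instance Definition _ := GRing.RMorphism.on rees_C.

Definition rees_scale (a : R) (x : Rees) : Rees := rees_C a * x.

Lemma rees_scaleA a b x : rees_scale a (rees_scale b x) = rees_scale (a * b) x.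
Proof. by rewrite /rees_scale rmorphM mulrA. Qed.

Lemma rees_scale1 : left_id 1 rees_scale.
Proof. by move=> x; rewrite /rees_scale rmorph1 mul1r. Qed.

Lemma rees_scaleDr : right_distributive rees_scale +%R.
Proof. by move=> a x y; rewrite /rees_scale mulrDr. Qed.

Lemma rees_scaleDl x : {morph rees_scale^~ x : a b / a + b}.
Proof. by move=> a b; rewrite /rees_scale rmorphD mulrDl. Qed.

HB.instance Definition _ := GRing.Zmodule_isLmodule.Build R Rees
  rees_scaleA rees_scale1 rees_scaleDr rees_scaleDl.

End Rees.

Arguments rees_ideal {R} M.
Arguments rees_C {R} M.

Section ReesMap.
Variables (R : comNzRingType) (M N : lmodType R) (g : {linear M -> N}).

Definition rees_map (x : Rees M) : Rees N := rees_pi (sym_map g (repr x)).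

Lemma rees_map_pi x : rees_map (rees_pi x) = rees_pi (sym_map g x).
Proof.
apply/eqP; rewrite -subr_eq0 -rmorphB -rmorphB /= pi_eq0.
apply/asboolP => F h Ff; rewrite sym_map_comp.
suff /asboolP : repr (rees_pi x) - x \in rees_ideal M by apply.
by rewrite Quotient.idealrBE reprK.
Qed.

End ReesMap.

Section IntegralClosure.
Variables (R : comNzRingType) (M N : lmodType R) (g : {linear M -> N}).

(* When g is the inclusion of M in N, [rees_image n] is the module written M^n,
   and [integral_closure n] is its closure in N^n = rees_grading N n. *)
Definition rees_image (n : nat) : set (Rees N) :=
  rees_map g @` rees_grading M n.

Definition integral_closure (n : nat) : set (Rees N) :=
  [set y | rees_grading N n y /\
     exists (u : nat) (c : nat -> Rees N),
       [/\ (0 < u)%N,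
           forall i, (1 <= i <= u)%N -> rees_image (n * i) (c i) &
           y ^+ u + \sum_(1 <= i < u.+1) c i * y ^+ (u - i) = 0]].

End IntegralClosure.

Section AnalyticSpread.
Variables (R : comNzRingType) (m : set R) (K : lmodType R).

Definition Proj_rees : set (set (Rees K)) := Proj (rees_grading K).

(* The fiber of Proj (Rees K) -> Spec R over the point m. *)
Definition Proj_fiber : set (set (Rees K)) :=
  [set P | Proj_rees P /\ [set r | P (rees_C K r)] = m].

Definition codim_ge (Z : set (set (Rees K))) (n : nat) : Prop :=
  exists2 P, generic_point Proj_rees Z P &
             krull_dim_ge (homloc (rees_grading K) P) n.

Definition deficient_analytic_spread : Prop :=
  forall Z, irreducible_component Proj_rees Proj_fiber Z -> codim_ge Z 2.

End AnalyticSpread.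

(* Main.v *)
From HB Require Import structures.
Require Import Defs.
From mathcomp Require Import all_boot all_algebra finmap monalg boolp classical_sets ring.

(** Write A and B for the Rees algebras of M and N, phi : A -> B for the map induced by
    iota, and m for x0.  By [deficient_analytic_spreadP], deficiency says that every
    point P of Proj that is minimal in the fiber over m lies above a chain
    P0 < P1 < P2 <= P of homogeneous primes.

    Suppose that such a P in Proj A admits no homogeneous P0 < P1 < P, and let T be the
    set of homogeneous elements of A outside P.  Minimal primes of B that miss phi(T) do
    not contain m: one that did would be a point of the fiber of Proj B of codimension 0.
    So prime avoidance yields r in m outside all of them ([avoiding_element]).

    If some prime of B contains r and misses phi(T), let Q be minimal over r below it.
    Its trace on A lies in P and strictly contains the trace of a minimal prime, which
    avoids r; since there is no chain below P, the trace of Q is P.  Hence Q lies in the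
    fiber over m and is minimal there, but Krull's principal ideal theorem
    ([krull_principal_ideal]) forbids a chain of length two below Q, against the
    deficiency of N ([no_avoiding_prime]).

    Otherwise phi t = r e for some t in T and some homogeneous e.  For the same reason as
    before, P is the only homogeneous prime between r A + ker phi and P, so some power of
    each element of m is, after multiplication by one t' in T, a multiple of r modulo ker phi
    ([uniform_multiplier]).  Hence a power of every element of m sends g = phi t' * e
    into the image of A.  The hypothesis on associated primes then forces g to be
    integral over that image ([torsion_integral]).  Multiplying the integral equation by
    a power of r gives (t' t)^u + r (...) in ker phi.  As ker phi and r lie in P, so does
    t' t, which is absurd.

    The inclusion of ker phi in P is where the freeness hypotheses enter: homogeneous
    elements of ker phi are nilpotent ([rees_map_kernel_nilpotent]).  Indeed, for a
    minimal prime eta of R, a linear form on M that does not vanish modulo eta at x can be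
    traded for one on N with the same property ([separation_free],
    [separation_generically_free]).  By elimination, every linear form on M then agrees
    modulo eta, up to a factor outside eta, with the restriction of a form on N
    ([approximate_form]).  So an element killed by all maps from N to free modules has, under
    any map from M to a free module, an image whose coefficients lie in every eta. *)

Set Implicit Arguments.
Unset Strict Implicit.
Unset Printing Implicit Defensive.

Import GRing.Theory.
Local Open Scope classical_set_scope.
Local Open Scope ring_scope.

(** * Ideals and primes *)

Section IdealBasics.
Variable A : comPzRingType.
Implicit Types (I J P Q E W : set A) (x y : A).

Lemma ideal0 I : ideal I -> I 0. Proof. by case. Qed.

Lemma idealD I x y : ideal I -> I x -> I y -> I (x + y).
Proof. by case=> _ + _; apply. Qed.

Lemma ideal_mull I a x : ideal I -> I x -> I (a * x).
Proof. by case=> _ _; apply. Qed.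

Lemma ideal_mulr I a x : ideal I -> I x -> I (x * a).
Proof. by rewrite mulrC; apply: ideal_mull. Qed.

Lemma idealN I x : ideal I -> I x -> I (- x).
Proof. by move=> hI Ix; rewrite -mulN1r; apply: ideal_mull. Qed.

Lemma idealB I x y : ideal I -> I x -> I y -> I (x - y).
Proof. by move=> hI Ix Iy; apply: idealD => //; apply: idealN. Qed.

Lemma ideal_sum I (T : Type) (r : seq T) (C : pred T) (F : T -> A) :
  ideal I -> (forall i, C i -> I (F i)) -> I (\sum_(i <- r | C i) F i).
Proof.
by move=> hI h; apply: big_ind => //; [exact: ideal0 | move=> *; exact: idealD].
Qed.

Lemma ideal_subr I x y : ideal I -> I (x - y) -> I y -> I x.
Proof. by move=> hI h Iy; rewrite -(subrK y x); apply: idealD. Qed.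

Lemma ideal_genP E x : E x -> ideal_gen E x.
Proof.
move=> Ex; exists [:: (1, x)]; last by rewrite big_seq1 mul1r.
by move=> c; rewrite inE => /eqP ->.
Qed.

Lemma ideal_gen_sub E I : ideal I -> E `<=` I -> ideal_gen E `<=` I.
Proof.
move=> hI EI _ [s sE ->]; rewrite big_seq; apply: ideal_sum => // c cs.
by apply: ideal_mull => //; apply/EI/sE.
Qed.

Lemma prime_ideal_ideal P : prime_ideal P -> ideal P. Proof. by case. Qed.

Lemma primeM P x y : prime_ideal P -> P (x * y) -> P x \/ P y.
Proof. by case=> _ _; apply. Qed.

Lemma prime1 P : prime_ideal P -> ~ P 1. Proof. by case. Qed.

Lemma primeMn P x y : prime_ideal P -> ~ P x -> ~ P y -> ~ P (x * y).
Proof. by move=> hP Px Py /(primeM hP)[]. Qed.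

Lemma primeX P x n : prime_ideal P -> P (x ^+ n) -> P x.
Proof.
move=> hP; elim: n => [|n IH]; first by rewrite expr0 => /(prime1 hP).
by rewrite exprS => /(primeM hP)[].
Qed.

Lemma prime_prod P (T : Type) (r : seq T) (F : T -> A) :
  prime_ideal P -> (forall i, ~ P (F i)) -> ~ P (\prod_(i <- r) F i).
Proof.
move=> hP h; apply: (big_ind (fun x => ~ P x)) => //; first exact: prime1.
by move=> x y; apply: primeMn.
Qed.

Definition adjoin I x : set A := [set z | exists p a, I p /\ z = p + a * x].

Lemma adjoin_ideal I x : ideal I -> ideal (adjoin I x).
Proof.
move=> hI; split.
- by exists 0, 0; split; [exact: ideal0 | rewrite mul0r addr0].
- move=> _ _ [p [a [Ip ->]]] [q [b [Iq ->]]]; exists (p + q), (a + b).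
  by split; [exact: idealD | ring].
- move=> c _ [p [a [Ip ->]]]; exists (c * p), (c * a).
  by split; [exact: ideal_mull | ring].
Qed.

Lemma sub_adjoin I x : I `<=` adjoin I x.
Proof. by move=> y Iy; exists y, 0; split=> //; rewrite mul0r addr0. Qed.

Lemma mem_adjoin I x : ideal I -> adjoin I x x.
Proof.
by move=> hI; exists 0, 1; split; [exact: ideal0 | rewrite mul1r add0r].
Qed.

Definition principal x : set A := [set z | exists a, z = a * x].

Lemma principal_ideal x : ideal (principal x).
Proof.
split; first by exists 0; rewrite mul0r.
  by move=> _ _ [a ->] [b ->]; exists (a + b); rewrite mulrDl.
by move=> c _ [a ->]; exists (c * a); rewrite mulrA.
Qed.

Definition mult_set W : Prop := W 1 /\ forall x y, W x -> W y -> W (x * y).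

Lemma prime_mult_set P : prime_ideal P -> mult_set (~` P).
Proof. by move=> hP; split; [exact: prime1 | move=> x y; exact: primeMn]. Qed.

Definition minimal_prime_over I P : Prop :=
  [/\ prime_ideal P, I `<=` P &
      forall Q, prime_ideal Q -> I `<=` Q -> Q `<=` P -> P `<=` Q].

Definition minimal_prime P : Prop := minimal_prime_over [set 0] P.

Lemma zero_sub I : ideal I -> [set 0] `<=` I.
Proof. by move=> hI _ ->; exact: ideal0. Qed.

Lemma zero_ideal : ideal [set (0 : A)].
Proof.
split=> // [x y /= -> -> | a x /= ->]; by rewrite ?addr0 ?mulr0.
Qed.

Lemma ideal_preim (B : comPzRingType) (f : {rmorphism B -> A}) I :
  ideal I -> ideal (f @^-1` I).
Proof.
move=> hI; split => /=; first by rewrite rmorph0; exact: ideal0.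
  by move=> x y Ix Iy /=; rewrite rmorphD; exact: idealD.
by move=> a x Ix /=; rewrite rmorphM; exact: ideal_mull.
Qed.

Lemma prime_preim (B : comPzRingType) (f : {rmorphism B -> A}) P :
  prime_ideal P -> prime_ideal (f @^-1` P).
Proof.
move=> hP; split; first by apply: ideal_preim; case: hP.
  by rewrite /= rmorph1; exact: prime1.
by move=> x y /=; rewrite rmorphM; exact: primeM.
Qed.

End IdealBasics.

(** * Primes of a Noetherian ring *)

Section Noetherian.
Variable A : comPzRingType.
Hypothesis nA : noetherian A.
Implicit Types (I J P Q E W : set A) (x y : A).

(** The union of a strictly increasing sequence of members is a finitely generated ideal, so
    its generators, hence the whole union, already lie in one member. *)
Lemma noetherian_max (F : set (set A)) : F !=set0 -> (forall I, F I -> ideal I) ->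
  exists2 I, F I & forall J, F J -> I `<=` J -> J `<=` I.
Proof.
move=> [I0 FI0] Fid; apply: contrapT => noMax.
have /choice[f hf] I : exists J, F I -> [/\ F J, I `<=` J & ~ J `<=` I].
  have [FI|nFI] := pselect (F I); last by exists I.
  apply: contrapT => h; apply: noMax; exists I => // J FJ IJ.
  by apply: contrapT => JI; apply: h; exists J.
pose C n := iter n f I0.
have FC n : F (C n) by elim: n => //= n /hf[].
have Cid n : ideal (C n) by apply: Fid; apply: FC.
have CS n : C n `<=` C n.+1 by have [] := hf _ (FC n).
have Cmono n k : C n `<=` C (n + k)%N.
  by elim: k => [|k IH]; rewrite ?addn0 ?addnS // => x /IH /CS.
have Cle n k : (n <= k)%N -> C n `<=` C k by move/subnKC <-; apply: Cmono.
have UI : ideal [set x | exists n, C n x].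
  split; first by exists 0%N; exact: (ideal0 (Cid 0%N)).
    move=> x y [n Cx] [k Cy]; exists (maxn n k).
    apply: idealD; first exact: Cid.
      by apply: Cle Cx; apply: leq_maxl.
    by apply: Cle Cy; apply: leq_maxr.
  by move=> a x [n Cx]; exists n; apply: ideal_mull => //; exact: Cid.
have [s es] := nA UI.
have [n sn] : exists n, forall x, x \in s -> C n x.
  have : forall x, x \in s -> exists n, C n x.
    move=> x xs; have : ideal_gen [set x | x \in s] x by apply: ideal_genP.
    by rewrite -es.
  elim: s {es} => [|a s IH] hs; first by exists 0%N.
  have [|n hn] := IH; first by move=> x xs; apply: hs; rewrite inE xs orbT.
  have [|k hk] := hs a; first by rewrite inE eqxx.
  exists (maxn n k) => x; rewrite inE => /orP[/eqP ->|/hn].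
    by apply: Cle hk; apply: leq_maxr.
  by apply: Cle; apply: leq_maxl.
have [_ _] := hf _ (FC n); apply; rewrite -/(C n.+1) => x Cx.
have : [set x | exists n, C n x] x by exists n.+1.
by rewrite es; apply: ideal_gen_sub => //; exact: Cid.
Qed.

(** An ideal maximal among those that contain I and miss W is prime: if it contained neither
    x nor y, adjoining either would produce an element of W, and when x y is in the ideal so
    is the product of these two elements of W. *)
Lemma prime_avoiding I W : ideal I -> mult_set W -> (forall x, I x -> ~ W x) ->
  exists P, [/\ prime_ideal P, I `<=` P & forall x, P x -> ~ W x].
Proof.
move=> hI [W1 WM] IW.
pose F := [set J | [/\ ideal J, I `<=` J & forall x, J x -> ~ W x]].
have [||P [hP IP PW] maxP] := @noetherian_max F; [by exists I; split | by move=> J [] |].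
exists P; split=> //; split=> // [/PW//|x y Pxy].
apply: contrapT => /not_orP[Px Py].
have meet z : ~ P z -> exists p a, P p /\ W (p + a * z).
  move=> Pz; apply: contrapT => h; apply/Pz/(maxP (adjoin P z)).
  - split; [exact: adjoin_ideal | by move=> w /IP; apply: sub_adjoin |].
    by move=> _ [p [a [Pp ->]]] Ww; apply: h; exists p, a.
  - exact: sub_adjoin.
  - exact: mem_adjoin.
have [p [a [Pp Wp]]] := meet x Px; have [q [b [Pq Wq]]] := meet y Py.
apply: (PW _ _ (WM _ _ Wp Wq)).
rewrite (_ : _ * _ = p * (q + b * y) + a * x * q + a * b * (x * y)); last by ring.
by do !apply: idealD => //; [apply: ideal_mulr | apply: ideal_mull | apply: ideal_mull].
Qed.

(** Noetherian induction: if x y lies in I but x and y do not, families for I + (x) and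
    I + (y) can be concatenated. *)
Lemma prime_family I : ideal I -> exists (n : nat) (q : 'I_n -> set A),
  (forall i, prime_ideal (q i) /\ I `<=` q i) /\
  (forall x : 'I_n -> A, (forall i, q i (x i)) -> I (\prod_i x i)).
Proof.
move=> hI; apply: contrapT => bad.
pose F := [set J | ideal J /\ ~ exists (n : nat) (q : 'I_n -> set A),
  (forall i, prime_ideal (q i) /\ J `<=` q i) /\
  (forall x : 'I_n -> A, (forall i, q i (x i)) -> J (\prod_i x i))].
have [||P [hP badP] maxP] := @noetherian_max F; [by exists I; split | by move=> J [] |].
have fam z : ~ P z -> exists (n : nat) (q : 'I_n -> set A),
  (forall i, prime_ideal (q i) /\ P `<=` q i) /\
  (forall x : 'I_n -> A, (forall i, q i (x i)) -> adjoin P z (\prod_i x i)).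
  move=> Pz; apply: contrapT => h.
  apply/Pz/(maxP (adjoin P z)); [split | exact: sub_adjoin | exact: mem_adjoin].
    exact: adjoin_ideal.
  move=> [n [q [qP qI]]]; apply: h; exists n, q; split=> // i.
  by have [? sub] := qP i; split=> // x /(sub_adjoin z)/sub.
have [P1|P1] := pselect (P 1).
  apply: badP; exists 0%N, (fun=> setT); split=> [[]//|x _].
  by rewrite big_ord0.
have [prP|] := pselect (prime_ideal P).
  (* A prime ideal is its own family. *)
  apply: badP; exists 1%N, (fun=> P); split=> [_|x Px]; first by split.
  by rewrite big_ord1.
apply; split=> // x y Pxy.
apply: contrapT => /not_orP[Px Py].
have [n [q [qP qI]]] := fam x Px; have [k [q' [qP' qI']]] := fam y Py.
apply: badP; exists (n + k)%N, (fun i => match split i with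
  | inl j => q j | inr j => q' j end); split=> [i|z zq].
  by case: (split i).
rewrite big_split_ord /=.
have [|p [a [Pp ->]]] := qI (fun i => z (lshift k i)).
  by move=> i; have := zq (lshift k i); rewrite -[lshift k i]/(unsplit (inl i)) unsplitK.
have [|p' [a' [Pp' ->]]] := qI' (fun i => z (rshift n i)).
  by move=> i; have := zq (rshift n i); rewrite -[rshift n i]/(unsplit (inr i)) unsplitK.
rewrite (_ : _ * _ = p * (p' + a' * y) + a * x * p' + a * a' * (x * y)); last by ring.
by do !apply: idealD => //; [apply: ideal_mulr | apply: ideal_mull | apply: ideal_mull].
Qed.

(** A prime containing I contains the product of the primes of [prime_family], hence one of
    them; among those below P, one that contains the fewest members of the family is
    minimal over I. *)
Lemma minimal_primes_finite I : ideal I -> exists (n : nat) (q : 'I_n -> set A),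
  forall P, prime_ideal P -> I `<=` P ->
  exists i, minimal_prime_over I (q i) /\ q i `<=` P.
Proof.
move=> hI; have [n [q [qP qI]]] := prime_family hI; exists n, q.
have below P : prime_ideal P -> I `<=` P -> exists i, q i `<=` P.
  move=> hP IP; apply: contrapT => h.
  have /choice[x hx] i : exists x, q i x /\ ~ P x.
    apply: contrapT => hh; apply: h; exists i => x qx; apply: contrapT => Px.
    by apply: hh; exists x.
  apply: (@prime_prod _ P _ (index_enum 'I_n) x hP); first by move=> i; have [] := hx i.
  by apply/IP/qI => i; have [] := hx i.
move=> P hP IP; have [i0 i0P] := below P hP IP.
(* The number of members below q i: it drops strictly when q i is replaced by a smaller one. *)
pose c i := #|[pred j | `[< q j `<=` q i >]]|.
case: (@arg_minnP _ i0 (fun i => `[< q i `<=` P >]) c) => [|i /asboolP iP imin].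
  exact/asboolP.
have [hq Iq] := qP i.
exists i; split=> //; split=> // Q hQ IQ Qi; have [j jQ] := below Q hQ IQ.
suff ij : q i `<=` q j by move=> x /ij /jQ.
apply: contrapT => ij.
have /imin : `[< q j `<=` P >] by apply/asboolP => x /jQ /Qi /iP.
apply/negP; rewrite -ltnNge; apply: proper_card; apply/properP; split.
  apply/fintype.subsetP => k; rewrite !inE => kj.
  by move=> x /kj /jQ /Qi.
by exists i => /=; [apply/asboolP | apply/negP => /asboolP].
Qed.

Lemma minimal_prime_over_exists I P : ideal I -> prime_ideal P -> I `<=` P ->
  exists2 Q, minimal_prime_over I Q & Q `<=` P.
Proof.
move=> /minimal_primes_finite[n [q h]] hP IP.
by have [i []] := h P hP IP; exists (q i).
Qed.

(** Otherwise the elements t x^k with t outside P would form a multiplicative set without 0,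
    and a prime missing it would lie in P without containing x. *)
Lemma minimal_prime_nilpotent P x : minimal_prime P -> P x ->
  exists2 t, ~ P t & exists k, t * x ^+ k = 0.
Proof.
move=> [hP _ Pmin] Px; apply: contrapT => h.
pose W := [set w | exists2 t, ~ P t & exists k, w = t * x ^+ k].
have WM : mult_set W.
  split; first by exists 1; [exact: prime1 | exists 0%N; rewrite expr0 mulr1].
  move=> _ _ [t Pt [k ->]] [u Pu [l ->]]; exists (t * u); first exact: primeMn.
  by exists (k + l)%N; rewrite exprD; ring.
have W0 z : [set 0] z -> ~ W z.
  by move=> -> [t Pt [k e]]; apply: h; exists t => //; exists k.
have [Q [hQ _ QW]] := prime_avoiding (@zero_ideal A) WM W0.
apply: (QW x); last first.
  by exists 1; [exact: prime1 | exists 1%N; rewrite expr1 mul1r].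
apply: (Pmin Q) Px => //; first by apply: zero_sub; case: hQ.
move=> z Qz; apply: contrapT => Pz; apply: (QW z) => //.
by exists z => //; exists 0%N; rewrite expr0 mulr1.
Qed.

(** Nilpotency of the nilradical, stated with products so that distinct elements are allowed;
    the bound does not depend on them. *)
Lemma nil_nilpotent : exists n, forall s : seq A, size s = n ->
  (forall x, x \in s -> forall P, minimal_prime P -> P x) -> \prod_(x <- s) x = 0.
Proof.
have [n [q [qP qI]]] := prime_family (@zero_ideal A); exists n => s ss sP.
rewrite (big_nth 0) big_mkord ss; apply: qI => i; have [hq _] := qP i.
have [|Q Qm] := minimal_prime_over_exists (@zero_ideal A) hq.
  by apply: zero_sub; case: hq.
by apply; apply: sP => //; apply: mem_nth; rewrite ss.
Qed.

End Noetherian.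

(** If one prime of the family lies in another, it can be dropped.  Otherwise correct an x that
    avoids all primes but the first by a multiple of a product that lies in all the other
    primes and not in the first. *)
Lemma prime_avoidance (A : comPzRingType) (n : nat) (q : 'I_n -> set A) (I : set A) :
  ideal I -> (forall i, prime_ideal (q i)) -> (forall i, ~ I `<=` q i) ->
  exists2 x, I x & forall i, ~ q i x.
Proof.
move=> hI; elim: n q => [|n IH] q hq Iq; first by exists 0; [exact: ideal0 | case].
have [[i [j [ij qji]]]|incomp] :=
    pselect (exists i j, i != j /\ q j `<=` q i).
  have [//|//|x Ix hx] := IH (fun k => q (lift j k)).
  exists x => // k qk; have : exists2 l, l != j & q l x.
    by have [e|kj] := eqVneq k j; [exists i => //; apply: qji; rewrite -e | exists k].
  by case=> l; rewrite eq_sym => /unlift_some[k' -> _] /(hx k').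
have [//|//|x Ix hx] := IH (fun k => q (lift ord0 k)).
have [q0x|q0x] := pselect (q ord0 x); last first.
  exists x => // k; have [->//|] := eqVneq k ord0.
  by rewrite eq_sym => /unlift_some[k' -> _] /(hx k').
have /existsNP[z /not_implyP[Iz q0z]] := Iq ord0.
have /choice[y hy] k : exists y, q (lift ord0 k) y /\ ~ q ord0 y.
  apply: contrapT => h; apply: incomp; exists ord0, (lift ord0 k).
  split=> // w qw; apply: contrapT => q0w; apply: h; by exists w.
exists (x + z * \prod_k y k); first by apply: idealD => //; apply: ideal_mulr.
move=> k; have [->|] := eqVneq k ord0.
  move=> h; have : q ord0 (z * \prod_k y k).
    by rewrite -[_ * _](addKr x) addrC; apply: idealB => //; case: (hq ord0).
  apply: primeMn => //; apply: prime_prod => // i.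
  by have [] := hy i.
rewrite eq_sym => /unlift_some[k' -> _] h; apply: (hx k').
have hqk : ideal (q (lift ord0 k')) by case: (hq (lift ord0 k')).
rewrite -[x](addrK (z * \prod_k y k)); apply: idealB => //; apply: ideal_mull => //.
by rewrite (bigD1 k') //=; apply: ideal_mulr => //; have [] := hy k'.
Qed.

(** * Krull's principal ideal theorem *)

Section Saturation.
Variable A : comPzRingType.
Implicit Types (I J P Q S U V : set A) (x y t : A).

(** The contraction to A of the extension of I to the localization at Q; working with these
    ideals avoids passing to the localization. *)
Definition sat Q I : set A := [set x | exists2 t, ~ Q t & I (t * x)].

Definition saturated Q I : Prop :=
  ideal I /\ forall t x, ~ Q t -> I (t * x) -> I x.

Definition ideal_mul I J : set A :=
  ideal_gen [set z | exists x y, [/\ I x, J y & z = x * y]].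

Lemma sub_sat Q I : prime_ideal Q -> I `<=` sat Q I.
Proof. by move=> hQ x Ix; exists 1; rewrite ?mul1r //; exact: prime1. Qed.

Lemma sat_saturated Q I : prime_ideal Q -> ideal I -> saturated Q (sat Q I).
Proof.
move=> hQ hI; split; last first.
  move=> t x Qt [u Qu Iu]; exists (u * t); first exact: primeMn.
  by rewrite -mulrA.
split; first by apply: sub_sat => //; exact: ideal0.
  move=> x y [t Qt Ix] [u Qu Iy]; exists (t * u); first exact: primeMn.
  rewrite (_ : _ * _ = u * (t * x) + t * (u * y)); last by ring.
  by apply: idealD => //; apply: ideal_mull.
by move=> a x [t Qt Ix]; exists t => //; rewrite mulrCA; apply: ideal_mull.
Qed.

Lemma satS Q I J : I `<=` J -> sat Q I `<=` sat Q J.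
Proof. by move=> IJ x [t Qt /IJ]; exists t. Qed.

Lemma adjoinS I J x : I `<=` J -> adjoin I x `<=` adjoin J x.
Proof. by move=> IJ _ [p [a [/IJ Jp ->]]]; exists p, a. Qed.

Lemma saturatedS Q Q' I : Q `<=` Q' -> saturated Q I -> saturated Q' I.
Proof.
by move=> QQ [hI h]; split=> // t x Qt; apply: h => /QQ.
Qed.

Lemma ideal_mul_ideal I J : ideal (ideal_mul I J).
Proof. exact: ideal_gen_ideal. Qed.

Lemma mem_ideal_mul I J x y : I x -> J y -> ideal_mul I J (x * y).
Proof. by move=> Ix Jy; apply: ideal_genP; exists x, y. Qed.

Hypothesis nA : noetherian A.

(** Nakayama's lemma in the localization at Q.  Take U saturated, containing V and maximal
    subject to not containing S, and x in S outside U.  Then S lies in the saturation of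
    U + (x), so the hypothesis on x reads t x = b x modulo U with t outside Q and b in Q,
    and t - b can be cancelled. *)
Lemma nakayama Q S V : prime_ideal Q -> saturated Q V ->
  (forall x, S x -> exists t v w,
     [/\ ~ Q t, V v, ideal_mul Q S w & t * x = v + w]) ->
  S `<=` V.
Proof.
move=> hQ satV h; apply: contrapT => SV.
pose F := [set U | [/\ saturated Q U, V `<=` U & ~ S `<=` U]].
have [||U [satU VU SU] maxU] := @noetherian_max A nA F.
- by exists V; split.
- by move=> I [[]].
case: (satU) => hU sU.
have /existsNP[x /not_implyP[Sx Ux]] := SU.
have hUx := adjoin_ideal x hU.
have SU' : S `<=` sat Q (adjoin U x).
  apply: contrapT => nS; apply/Ux/(maxU (sat Q (adjoin U x))).
  - split=> //; first exact: sat_saturated.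
    by move=> y /VU Uy; apply: sub_sat => //; apply: sub_adjoin.
  - by move=> y Uy; apply: sub_sat => //; apply: sub_adjoin.
  - by apply: sub_sat => //; apply: mem_adjoin.
(* L collects the w that are congruent modulo U, after localization, to an element of Q x. *)
pose L := [set w | exists t u b, [/\ ~ Q t, U u, Q b & t * w = u + b * x]].
have hL : ideal L.
  have hQi : ideal Q by case: hQ.
  split.
  - exists 1, 0, 0; split; [exact: prime1 | exact: ideal0 | exact: ideal0 |].
    by rewrite mulr0 mul0r addr0.
  - move=> w w' [t [u [b [Qt Uu Qb e]]]] [t' [u' [b' [Qt' Uu' Qb' e']]]].
    exists (t * t'), (t' * u + t * u'), (t' * b + t * b'); split.
    + exact: primeMn.
    + by apply: idealD => //; apply: ideal_mull.
    + by apply: idealD => //; apply: ideal_mull.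
    + transitivity (t' * (t * w) + t * (t' * w')); first by ring.
      by rewrite e e'; ring.
  - move=> a w [t [u [b [Qt Uu Qb e]]]]; exists t, (a * u), (a * b); split=> //.
    + exact: ideal_mull.
    + exact: ideal_mull.
    + by rewrite mulrCA e; ring.
have QSL : ideal_mul Q S `<=` L.
  apply: ideal_gen_sub => // _ [q [y [Qq /SU' [t Qt [u [b [Uu e]]]] ->]]].
  exists t, (q * u), (q * b); split=> //; [exact: ideal_mull | exact: (ideal_mulr _ (prime_ideal_ideal hQ) Qq) |].
  by rewrite mulrCA e; ring.
have [t [v [w [Qt Vv /QSL[t' [u [b [Qt' Uu Qb e']]]] e]]]] := h x Sx.
apply/Ux/(sU (t' * t - b)).
  move=> Qtb; apply: (primeMn hQ Qt' Qt).
  by apply: ideal_subr Qtb Qb; case: hQ.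
rewrite (_ : _ * x = t' * v + u); first by apply: idealD => //; apply: ideal_mull => //; exact: VU.
rewrite mulrBl -mulrA e mulrDr e'; ring.
Qed.

(** An ideal maximal among the proper colon ideals (I : x) is prime. *)
Lemma colon_prime I : ideal I -> ~ I 1 ->
  exists2 x, ~ I x & prime_ideal [set a | I (a * x)].
Proof.
move=> hI I1.
have hcol x : ideal [set a | I (a * x)].
  split => /=; first by rewrite mul0r; exact: ideal0.
    by move=> a b Ia Ib; rewrite mulrDl; exact: idealD.
  by move=> a b Ib; rewrite -mulrA; exact: ideal_mull.
have [||_ [x Ix ->] maxx] := @noetherian_max A nA
    [set J | exists2 x, ~ I x & J = [set a | I (a * x)]].
- by exists [set a | I (a * 1)]; exists 1.
- by move=> _ [x _ ->].
exists x => //; split=> //= [|a b Iab]; first by rewrite mul1r.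
have [?|Ibx] := pselect (I (b * x)); [by right | left].
apply: (maxx [set a | I (a * (b * x))]); last by rewrite /= mulrA.
  by exists (b * x).
by move=> c /= Ic; rewrite mulrCA; apply: ideal_mull.
Qed.

(** The localization of A / I at Q is Artinian when Q is minimal over I.  By Noetherian
    induction on I: there is x outside I with (I : x) = Q, so that I + (x) is a simple
    extension of I after localization, and the chain becomes stationary both modulo
    I + (x), by induction, and in its intersection with I + (x). *)
Lemma dcc_above Q I (J : nat -> set A) : prime_ideal Q -> saturated Q I ->
  (forall Q', prime_ideal Q' -> I `<=` Q' -> Q' `<=` Q -> Q `<=` Q') ->
  (forall n, [/\ saturated Q (J n), I `<=` J n & J n.+1 `<=` J n]) ->
  exists n, forall k, (n <= k)%N -> J n `<=` J k.
Proof.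
move=> hQ satI minI hJ; apply: contrapT => bad.
pose F := [set I | [/\ saturated Q I,
  forall Q', prime_ideal Q' -> I `<=` Q' -> Q' `<=` Q -> Q `<=` Q' &
  ~ forall J : nat -> set A,
  (forall n, [/\ saturated Q (J n), I `<=` J n & J n.+1 `<=` J n]) ->
  exists n, forall k, (n <= k)%N -> J n `<=` J k]].
have [||I1 [satI1 minI1 bad1] maxI] := @noetherian_max A nA F.
- by exists I; split=> // /(_ J hJ).
- by move=> ? [[]].
clear I J satI minI hJ bad; rename I1 into I, satI1 into satI, minI1 into minI.
apply: bad1 => J hJ; case: (satI) => hI sI.
have [I1|I1] := pselect (I 1).
  exists 0%N => k _ x _; have [[hk _] Ik _] := hJ k.
  by rewrite -[x]mulr1; apply: ideal_mull => //; apply: Ik.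
have [x Ix hx] := colon_prime hI I1.
have Qx : Q `<=` [set a | I (a * x)].
  apply: minI => //; first by move=> a Ia /=; apply: ideal_mulr.
  by move=> t Itx; apply: contrapT => /sI/(_ Itx).
have Jmono n k : (n <= k)%N -> J k `<=` J n.
  move/subnKC <-; elim: (k - n)%N => [|d IH]; rewrite ?addn0 ?addnS //.
  by have [_ _ s] := hJ (n + d)%N => y /s /IH.
have hIx := adjoin_ideal x hI.
have [n1 hn1] : exists n, forall k, (n <= k)%N ->
    sat Q (adjoin (J n) x) `<=` sat Q (adjoin (J k) x).
  apply: contrapT => bad; apply/Ix/(maxI (sat Q (adjoin I x))); last first.
  - by apply: sub_sat => //; apply: mem_adjoin.
  - by move=> y Iy; apply: sub_sat => //; apply: sub_adjoin.
  split; first exact: sat_saturated.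
    move=> Q' hQ' sub; apply: minI => // y Iy; apply: sub.
    by apply: sub_sat => //; apply: sub_adjoin.
  move=> /(_ (fun n => sat Q (adjoin (J n) x))) h; apply/bad/h => n.
  have [[hn _] In Jn] := hJ n; split.
  - by apply: sat_saturated => //; apply: adjoin_ideal.
  - exact/satS/adjoinS.
  - exact/satS/adjoinS.
have step n k : (n1 <= n)%N -> (n <= k)%N -> (J k x \/ ~ J n x) -> J n `<=` J k.
  move=> n1n nk hor y Jny; have [[hJk sJk] IJk _] := hJ k.
  have [[hJn sJn] _ _] := hJ n.
  have : sat Q (adjoin (J n1) x) y.
    by apply: sub_sat => //; apply/sub_adjoin/(Jmono _ _ n1n).
  case/(hn1 k (leq_trans n1n nk)) => t Qt [j [b [Jj e]]].
  apply: (sJk t) => //; rewrite e; apply: idealD => //.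
  case: hor => [Jkx|Jnx]; first exact: ideal_mull.
  apply/IJk/Qx; apply: contrapT => Qb; apply/Jnx/(sJn b) => //.
  have -> : b * x = t * y - j by rewrite e [j + _]addrC addrK.
  by apply: idealB => //; [apply: ideal_mull | apply: (Jmono _ _ nk)].
have [[n2 Jx]|allx] := pselect (exists n, ~ J n x).
  exists (maxn n1 n2) => k nk; apply: step => //; first exact: leq_maxl.
  by right=> /(Jmono _ _ (leq_maxr n1 n2)).
exists n1 => k nk; apply: step => //; left; apply: contrapT => h.
by apply: allx; exists k.
Qed.

(** In the localization at P this is the n-th power of P. *)
Fixpoint symbolic_power P n : set A :=
  if n is n'.+1 then sat P (ideal_mul P (symbolic_power P n')) else setT.

Lemma symbolic_power_sat P n : prime_ideal P -> saturated P (symbolic_power P n).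
Proof.
move=> hP; case: n => [|n] /=; first by split.
by apply: sat_saturated => //; apply: ideal_mul_ideal.
Qed.

Lemma symbolic_powerS P n : prime_ideal P ->
  symbolic_power P n.+1 `<=` symbolic_power P n.
Proof.
move=> hP x [t Pt]; have [hS sS] := symbolic_power_sat n hP.
move=> h; apply: (sS t) => //; move: h; apply: ideal_gen_sub => //.
by move=> _ [q [y [_ Sy ->]]]; apply: ideal_mull.
Qed.

Lemma symbolic_powerX P n x : prime_ideal P -> P x -> symbolic_power P n (x ^+ n).
Proof.
move=> hP Px; elim: n => [//|n IH]; apply: sub_sat => //.
by rewrite exprS; apply: mem_ideal_mul.
Qed.

(** A prime minimal over a principal ideal has height at most one.  Modulo r the symbolic
    powers of Q1 become stationary in the localization at Q, by [dcc_above].  As r is not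
    in Q1, Nakayama's lemma at Q makes them stationary outright, and Nakayama's lemma at
    Q1 makes them vanish in the localization at Q1, so each element of Q1 has a power
    killed by an element outside Q1. *)
Theorem krull_principal_ideal r Q Q1 Q0 :
  minimal_prime_over (principal r) Q -> prime_ideal Q1 -> prime_ideal Q0 ->
  Q1 `<=` Q -> ~ Q `<=` Q1 -> Q0 `<=` Q1 -> Q1 `<=` Q0.
Proof.
move=> [hQ rQ minQ] hQ1 hQ0 Q1Q QQ1 Q01.
have Q1r : ~ Q1 r.
  move=> Q1r; apply: QQ1; apply: minQ => // _ [a ->].
  by apply: ideal_mull => //; case: hQ1.
have Qr : Q r by apply: rQ; exists 1; rewrite mul1r.
pose S := symbolic_power Q1.
have sS n : saturated Q1 (S n) by apply: symbolic_power_sat.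
have sSQ n : saturated Q (S n) by apply: saturatedS (sS n).
(* The chain of the S n read modulo r. *)
pose J n := sat Q (adjoin (S n) r).
have [n /(_ n.+1 (leqnSn n)) JS] : exists n, forall k, (n <= k)%N -> J n `<=` J k.
  apply: (@dcc_above Q (sat Q (principal r))) => //.
  - by apply: sat_saturated => //; exact: principal_ideal.
  - move=> Q' hQ' sub Q'Q; apply: minQ => // x rx; apply: sub; exact: sub_sat.
  - move=> n; split.
    + by apply: sat_saturated => //; apply: adjoin_ideal; case: (sS n).
    + apply: satS => _ [a ->]; exists 0, a; rewrite add0r; split=> //.
      by apply: ideal0; case: (sS n).
    + exact/satS/adjoinS/symbolic_powerS.
have SnS : S n `<=` S n.+1.
  apply: (@nakayama Q) => // x Sx; case: (sS n) => hSn sSn.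
  have : J n x by apply: sub_sat => //; apply: sub_adjoin.
  case/JS=> t Qt [y [b [Sy e]]]; exists t, y, (r * b); split=> //; last first.
    by rewrite e [r * b]mulrC.
  apply: mem_ideal_mul => //; apply: (sSn r) => //.
  have -> : r * b = t * x - y by rewrite e [y + _]addrC addrK mulrC.
  by apply: idealB => //; [apply: ideal_mull | apply: symbolic_powerS].
have Sn0 : S n `<=` sat Q1 [set 0].
  apply: (@nakayama Q1) => //; first by apply: sat_saturated => //; exact: zero_ideal.
  move=> x /SnS [t Qt h]; exists t, 0, (t * x); split=> //; last by rewrite add0r.
  apply: sub_sat => //.
move=> y Qy; have [t Qt /= e] := Sn0 _ (symbolic_powerX n hQ1 Qy).
apply: (@primeX _ Q0 y n) => //.
have : Q0 (t * y ^+ n) by rewrite e; apply: ideal0; case: hQ0.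
by case/(primeM hQ0) => // /Q01.
Qed.

End Saturation.

(** * Hilbert's basis theorem *)

Section HilbertBasis.

Lemma noetherian_surj (R B : comNzRingType) (f : {rmorphism R -> B}) :
  (forall y, exists x, f x = y) -> noetherian R -> noetherian B.
Proof.
move=> surj nR I hI; have [s es] := nR _ (ideal_preim f hI).
exists (map f s); apply/seteqP; split=> y.
  have [x <-] := surj y => Ifx; have : (f @^-1` I) x by [].
  rewrite es => -[c hc ->].
  exists [seq (f z.1, f z.2) | z <- c].
    move=> w /mapP[z /hc/= zs ->] /=; exact: map_f.
  by rewrite big_map rmorph_sum; apply: eq_bigr => z _; rewrite rmorphM.
apply: ideal_gen_sub => // _ /mapP[x xs ->].
have : (f @^-1` I) x by rewrite es; apply: ideal_genP.
by [].
Qed.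

Variable R : comNzRingType.

(** The ideals L n of n-th coefficients of members of I of degree at most n increase with n,
    so they are constant from some d on.  Polynomials whose coefficients generate
    L 0, ..., L d generate I, by induction on the degree. *)
Theorem hilbert_basis : noetherian R -> noetherian {poly R}.
Proof.
move=> nR I hI.
pose L n := [set c | exists2 f : {poly R}, I f & (size f <= n.+1)%N /\ f`_n = c].
have Lid n : ideal (L n).
  split.
  - by exists 0; [exact: ideal0 | rewrite size_poly0 coef0].
  - move=> _ _ [f If [sf <-]] [g Ig [sg <-]]; exists (f + g); first exact: idealD.
    by rewrite coefD (leq_trans (size_polyD _ _)) // geq_max sf.
  - move=> a _ [f If [sf <-]]; exists (a%:P * f); first exact: ideal_mull.
    by rewrite coefCM mul_polyC (leq_trans (size_scale_leq _ _)).
have LX n k c f : I f -> (size f <= n.+1)%N -> f`_n = c ->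
    [/\ I ('X^k * f), (size ('X^k * f)%R <= (n + k).+1)%N & ('X^k * f)`_(n + k) = c].
  move=> If sf <-; rewrite coefXnM ltnNge leq_addl addnK; split=> //.
    exact: ideal_mull.
  by rewrite (leq_trans (size_polyMleq _ _)) // size_polyXn addSn /= addnC -addSn leq_add2r.
have Lmono n k : (n <= k)%N -> L n `<=` L k.
  move/subnKC <- => c [f If [sf e]].
  by have [? ? ?] := LX n (k - n)%N c f If sf e; exists ('X^(k - n) * f).
have [||_ [d ->] maxd] := @noetherian_max R nR [set J | exists n, J = L n].
- by exists (L 0%N), 0%N.
- by move=> _ [n ->].
have Ldmax k : L k `<=` L (minn k d).
  have [_|dk] := leqP k d; first by [].  
  by apply: maxd; [exists k | apply/Lmono/ltnW].
have lift n : exists2 G : seq {poly R}, forall g, g \in G -> I g &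
    forall c, L n c -> exists2 g, ideal_gen [set x | x \in G] g &
      (size g <= n.+1)%N /\ g`_n = c.
  have [s es] := nR _ (Lid n).
  have /choice[g hg] c : exists g : {poly R}, c \in s ->
      [/\ I g, (size g <= n.+1)%N & g`_n = c].
    have [cs|] := boolP (c \in s); last by exists 0.
    have : L n c by rewrite es; apply: ideal_genP.
    by case=> f If [sf e]; exists f.
  exists (map g s) => [_ /mapP[c /hg[Ig _ _] ->] //|c].
  have hG := @ideal_gen_ideal {poly R} [set x | x \in map g s].
  rewrite es => -[a ha ->].
  exists (\sum_(c <- a) c.1%:P * g c.2).
    rewrite big_seq; apply: ideal_sum => // z za; apply: ideal_mull => //.
    by apply: ideal_genP; apply: map_f; apply: ha.
  have sg z : z \in a -> (size (g z.2) <= n.+1)%N /\ (g z.2)`_n = z.2.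
    by move=> /ha /= /hg[].
  split.
    elim: (a) sg => [|z b IH] sg; first by rewrite big_nil size_poly0.
    rewrite big_cons (leq_trans (size_polyD _ _)) // geq_max IH ?andbT.
      rewrite mul_polyC (leq_trans (size_scale_leq _ _)) //.
      by have [] := sg z (mem_head _ _).
    by move=> w wb; apply: sg; rewrite inE wb orbT.
  rewrite coef_sum big_seq [RHS]big_seq; apply: eq_bigr => z /sg[_ e].
  by rewrite coefCM e.
have [G GI hG] : exists2 G : seq {poly R}, forall g, g \in G -> I g &
    forall n c, (n <= d)%N -> L n c -> exists2 g, ideal_gen [set x | x \in G] g &
      (size g <= n.+1)%N /\ g`_n = c.
  elim: (d) => [|k [G GI hG]].
    by have [G GI hG] := lift 0%N; exists G => // n c; rewrite leqn0 => /eqP ->; exact: hG.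
  have [G' GI' hG'] := lift k.+1; exists (G ++ G').
    by move=> g; rewrite mem_cat => /orP[/GI|/GI'].
  have mono (H : seq {poly R}) : {subset H <= G ++ G'} ->
      ideal_gen [set x | x \in H] `<=` ideal_gen [set x | x \in G ++ G'].
    move=> sub; apply: ideal_gen_sub; first exact: ideal_gen_ideal.
    by move=> x /= /sub xH; apply: ideal_genP.
  move=> n c; rewrite leq_eqVlt => /orP[/eqP -> /hG'|/hG{}hG /hG].
    by move=> [g Gg h]; exists g => //; apply: mono Gg => x; rewrite mem_cat orbC => ->.
  by move=> [g Gg h]; exists g => //; apply: mono Gg => x; rewrite mem_cat => ->.
have hGi := @ideal_gen_ideal {poly R} [set x | x \in G].
have genI : ideal_gen [set x | x \in G] `<=` I by apply: ideal_gen_sub => // g /GI.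
exists G; apply/seteqP; split=> // f.
elim: (size f) {-2}f (leqnn (size f)) => {f} [|n IH] f sf If.
  by move: sf; rewrite leqn0 size_poly_eq0 => /eqP ->; apply: ideal0.
have : L n f`_n by exists f.
case/Ldmax/hG => [|g Gg [sg e]]; first exact: geq_minr.
have [_ sg' e'] := LX _ (n - minn n d)%N _ _ (genI _ Gg) sg e.
rewrite subnKC ?geq_minl // in sg' e'.
apply: (ideal_subr hGi (y := 'X^(n - minn n d) * g)); last exact: ideal_mull.
apply: IH; last by apply: idealB => //; apply: ideal_mull => //; apply: genI.
apply/leq_sizeP => j; rewrite leq_eqVlt => /orP[/eqP <-|nj].
  by rewrite coefB e' subrr.
rewrite coefB !nth_default ?subrr //; first exact: leq_trans nj.
exact: leq_trans nj.
Qed.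

End HilbertBasis.

(** Adjoining one generator of B after another: each step replaces the source by its
    polynomial ring, which stays Noetherian. *)
Lemma noetherian_generated (R B : comNzRingType) (f : {rmorphism R -> B}) (s : seq B) :
  noetherian R ->
  (forall C : set B, (forall r, C (f r)) -> (forall b, b \in s -> C b) ->
     (forall x y, C x -> C y -> C (x + y)) ->
     (forall x y, C x -> C y -> C (x * y)) -> forall x, C x) ->
  noetherian B.
Proof.
elim: s R f => [|b s IH] R f nR gen.
  apply: (@noetherian_surj R B f) => // y.
  apply: (gen [set y | exists x, f x = y]) => //.
  - by move=> r; exists r.
  - by move=> _ _ [x <-] [y' <-]; exists (x + y'); rewrite rmorphD.
  - by move=> _ _ [x <-] [y' <-]; exists (x * y'); rewrite rmorphM.
have cfb : commr_rmorph f b by move=> x; exact: mulrC.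
apply: (IH {poly R} (horner_morph cfb)); first exact: hilbert_basis.
move=> C Cf Cs CD CM; apply: gen => // [r|x].
  by rewrite -(horner_morphC cfb); apply: Cf.
rewrite inE => /orP[/eqP ->|]; last exact: Cs.
by rewrite -(horner_morphX cfb); apply: Cf.
Qed.

(** * Homogeneous components and homogeneous primes *)

Section Components.
Variables (A : comPzRingType) (S : grading A).
Implicit Types (I P Q : set A) (x y a : A).

Let decomposition x (f : nat -> A) : Prop :=
  (forall i, S i (f i)) /\
  exists n, forall k, (n <= k)%N -> x = \sum_(i < k) f i.

Let decomposition_exists x : exists f, decomposition x f.
Proof.
have [n [f [Sf ->]]] := grading_sum S x.
exists (fun i => if (i < n)%N then f i else 0); split=> [i|].
  by case: ifP => _ //; exact: grading0.
by exists n => k nk; exact: grading_pad.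
Qed.

Definition component x : nat -> A := sval (cid (decomposition_exists x)).

Let componentP x : decomposition x (component x).
Proof. exact: svalP. Qed.

Lemma component_gcomp x n : S n (component x n).
Proof. by case: (componentP x). Qed.

Let component_unique x f n : decomposition x f -> component x n = f n.
Proof.
move=> [Sf [k hk]]; have [Sg [l hl]] := componentP x.
have Sd i : S i (component x i - f i) by apply: gradingB.
apply/eqP; rewrite -subr_eq0; apply/eqP.
apply: (grading_direct Sd (n := maxn n.+1 (maxn k l))); last exact: leq_maxl.
rewrite sumrB -hk -?hl ?subrr // !leq_max leqnn ?orbT //.
Qed.

Lemma component_sum x m : exists2 n, (m <= n)%N & x = \sum_(i < n) component x i.
Proof.
have [_ [l hl]] := componentP x; exists (maxn m l); first exact: leq_maxl.
exact/hl/leq_maxr.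
Qed.

Lemma component_of_sum n (f : nat -> A) i : (forall j, S j (f j)) -> (i < n)%N ->
  component (\sum_(j < n) f j) i = f i.
Proof.
move=> Sf lti.
rewrite (@component_unique _ (fun i => if (i < n)%N then f i else 0)) ?lti //.
split=> [j|]; first by case: ifP => _ //; exact: grading0.
by exists n => k nk; exact: grading_pad.
Qed.

Lemma componentE n m x : S n x -> component x m = if m == n then x else 0.
Proof.
move=> Sx.
rewrite (@component_unique _ (fun m => if m == n then x else 0)) //; split.
  by move=> i; case: eqP => [->//|_]; exact: grading0.
exists n.+1 => k nk; rewrite (bigD1 (Ordinal nk)) //= eqxx big1 ?addr0 //.
by move=> i /negPf; rewrite -val_eqE /= => ->.
Qed.

Lemma component_id n x : S n x -> component x n = x.
Proof. by move=> Sx; rewrite (componentE _ Sx) eqxx. Qed.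

Lemma componentD x y n : component (x + y) n = component x n + component y n.
Proof.
apply: (@component_unique _ (fun n => component x n + component y n)); split.
  by move=> i; apply: gradingD; exact: component_gcomp.
have [_ [k hk]] := componentP x; have [_ [l hl]] := componentP y.
exists (maxn k l) => j; rewrite geq_max => /andP[kj lj].
by rewrite big_split /= -hk -?hl.
Qed.

Lemma component0 n : component 0 n = 0.
Proof. by rewrite (componentE n (grading0 S 0)); case: eqP. Qed.

Lemma component_bigsum (T : Type) (r : seq T) (F : T -> A) n :
  component (\sum_(i <- r) F i) n = \sum_(i <- r) component (F i) n.
Proof.
elim: r => [|i r IH]; first by rewrite !big_nil component0.
by rewrite !big_cons componentD IH.
Qed.

Lemma component_mull m a x n : S m a ->
  component (a * x) n = if (m <= n)%N then a * component x (n - m) else 0.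
Proof.
move=> Sa; rewrite (@component_unique _
  (fun n => if (m <= n)%N then a * component x (n - m) else 0)) //; split.
  move=> i; case: leqP => [mi|_]; last exact: grading0.
  by rewrite -{1}(subnKC mi); apply: gradingM => //; exact: component_gcomp.
have [_ [l hl]] := componentP x; exists (m + l)%N => k lk.
have mk : (m <= k)%N by rewrite (leq_trans _ lk) // leq_addr.
rewrite [in LHS](hl (k - m)%N) ?leq_subRL // mulr_sumr -[in RHS](subnKC mk) big_split_ord /=.
rewrite [X in _ = X + _]big1 ?add0r => [|i _]; last by rewrite leqNgt ltn_ord.
by apply: eq_bigr => i _; rewrite leq_addr addKn.
Qed.

Lemma componentM x y n :
  component (x * y) n = \sum_(i < n.+1) component x i * component y (n - i).
Proof.
have [l nl {1}->] := component_sum x n.+1.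
rewrite mulr_suml component_bigsum.
rewrite (@grading_pad A n.+1 l (fun i => component x i * component y (n - i))) //.
by apply: eq_bigr => i _; rewrite (component_mull _ _ (component_gcomp x i)) ltnS.
Qed.

Lemma homogeneousP P x n : ideal P -> homogeneous S P -> P x -> P (component x n).
Proof.
move=> hP hom; have [l nl {1}->] := component_sum x n.+1.
by move/(hom l _ (component_gcomp x)); apply.
Qed.

Lemma homogeneous_of_components P :
  (forall x n, P x -> P (component x n)) -> homogeneous S P.
Proof. by move=> h n f Sf Pf i lti; rewrite -(component_of_sum Sf lti); apply: h. Qed.

Lemma mem_of_components P x : ideal P -> (forall n, P (component x n)) -> P x.
Proof.
by move=> hP h; have [l _ ->] := component_sum x 0; apply: ideal_sum.
Qed.

Lemma homogeneous_witness P Q : ideal P -> homogeneous S Q -> ideal Q ->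
  ~ Q `<=` P -> exists n x, [/\ S n x, Q x & ~ P x].
Proof.
move=> hP homQ hQ QP; apply: contrapT => h; apply: QP => x Qx.
apply: mem_of_components => // n; apply: contrapT => Pn; apply: h.
exists n, (component x n); split=> //; first exact: component_gcomp.
exact: homogeneousP.
Qed.

(** The family h prescribes which homogeneous elements of each degree belong.  Both the
    homogeneous core of a prime and the trace on A of a prime of a homogeneous localization
    have this form. *)
Definition hull (h : nat -> set A) : set A :=
  [set x | forall n, h n (component x n)].

Lemma mem_hull (h : nat -> set A) n x :
  (forall n, h n 0) -> S n x -> hull h x <-> h n x.
Proof.
move=> h0 Sx; split=> [/(_ n)|hx m]; first by rewrite (component_id Sx).
by rewrite (componentE m Sx); case: eqP => [->|].
Qed.

(** A homogeneous ideal is prime as soon as it is so on homogeneous elements.  If the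
    components of x and y outside h of least degree have degrees i and j, then in degree
    i + j all terms of x y but one lie in h. *)
Lemma hull_prime (h : nat -> set A) :
  (forall n, h n 0) ->
  (forall n x y, S n x -> S n y -> h n x -> h n y -> h n (x + y)) ->
  (forall m n a x, S m a -> S n x -> h n x -> h (m + n)%N (a * x)) ->
  ~ h 0%N 1 ->
  (forall m n x y, S m x -> S n y -> h (m + n)%N (x * y) -> h m x \/ h n y) ->
  prime_ideal (hull h) /\ homogeneous S (hull h).
Proof.
move=> h0 hD hM h1 hp.
have hsum n (T : finType) (C : pred T) (F : T -> A) :
    (forall i, C i -> S n (F i) /\ h n (F i)) -> h n (\sum_(i | C i) F i).
  move=> hF; suff [] : S n (\sum_(i | C i) F i) /\ h n (\sum_(i | C i) F i) by [].
  apply: (big_ind (fun x => S n x /\ h n x)) => //.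
    by split; [exact: grading0 | exact: h0].
  by move=> x y [Sx hx] [Sy hy]; split; [exact: gradingD | exact: hD].
have hid : ideal (hull h).
  split=> [n|x y hx hy n|a x hx n]; first by rewrite component0.
    by rewrite componentD; apply: hD => //; exact: component_gcomp.
  rewrite componentM; apply: hsum => i _.
  have e : (i + (n - i))%N = n by rewrite subnKC // -ltnS.
  split; first by rewrite -[X in S X]e; apply: gradingM; exact: component_gcomp.
  by rewrite -[X in h X]e; apply: hM => //; exact: component_gcomp.
split; last first.
  apply: homogeneous_of_components => x n hx k.
  by rewrite (componentE k (component_gcomp x n)); case: eqP => [->|].
split=> //.
  by move/(mem_hull h0 (grading1 S)).
move=> x y hxy; apply: contrapT => /not_orP[/existsNP ex /existsNP ey].
have ex' : exists n, ~~ `[< h n (component x n) >].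
  by case: ex => n; exists n; apply/negP => /asboolP.
have ey' : exists n, ~~ `[< h n (component y n) >].
  by case: ey => n; exists n; apply/negP => /asboolP.
case: (ex_minnP ex') => i /asboolPn hi mini.
case: (ex_minnP ey') => j /asboolPn hj minj.
have lei k : (k < i)%N -> h k (component x k).
  move=> ki; apply: contrapT => nh.
  have /mini : ~~ `[< h k (component x k) >] by apply/negP => /asboolP.
  by rewrite leqNgt ki.
have lej k : (k < j)%N -> h k (component y k).
  move=> kj; apply: contrapT => nh.
  have /minj : ~~ `[< h k (component y k) >] by apply/negP => /asboolP.
  by rewrite leqNgt kj.
have Sc := component_gcomp.
suff hij : h (i + j)%N (component x i * component y j).
  by case: (hp _ _ _ _ (Sc x i) (Sc y j) hij).
have := hxy (i + j)%N; rewrite componentM.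
have lti : (i < (i + j).+1)%N by rewrite ltnS leq_addr.
rewrite (bigD1 (Ordinal lti)) //= addKn; set z := component x i * _.
set w := \sum_(_ < _ | _) _ => hzw.
have Sz : S (i + j)%N z by apply: gradingM.
have Swh : S (i + j)%N w /\ h (i + j)%N w.
  have all (k : 'I_(i + j).+1) : k != Ordinal lti ->
      S (i + j)%N (component x k * component y (i + j - k)) /\
      h (i + j)%N (component x k * component y (i + j - k)).
    rewrite -val_eqE /= => ki.
    have e : (k + (i + j - k))%N = (i + j)%N by rewrite subnKC // -ltnS.
    split; first by rewrite -[X in S X]e; apply: gradingM.
    rewrite -[X in h X]e; case: (ltngtP k i) ki => // [lt|gt] _.
      by rewrite mulrC addnC; apply: hM => //; apply: lei.
    apply: hM => //; apply: lej.
    have kij : (k <= i + j)%N by rewrite -ltnS.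
    by rewrite (ltn_subLR _ kij) ltn_add2r.
  split; last by apply: hsum => k /all.
  by rewrite /w; apply: big_ind => [|u v|k /all[]//]; [exact: grading0 | exact: gradingD].
case: Swh => Sw hw.
rewrite -[z](addrK w); apply: hD => //; first exact: gradingD.
- exact: gradingN.
- rewrite -mulN1r -[(i + j)%N]add0n; apply: hM => //.
  by apply: gradingN; exact: grading1.
Qed.

(** The largest homogeneous ideal contained in the ideal P. *)
Definition hcore P : set A := hull (fun=> P).

Lemma hcore_prime P : prime_ideal P ->
  prime_ideal (hcore P) /\ homogeneous S (hcore P).
Proof.
move=> hP; have hPi := prime_ideal_ideal hP; apply: hull_prime => //.
- by move=> _; exact: ideal0.
- by move=> _ x y _ _; exact: idealD.
- by move=> _ _ a x _ _; exact: ideal_mull.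
- exact: prime1.
- by move=> _ _ x y _ _; exact: primeM.
Qed.

Lemma hcore_sub P : ideal P -> hcore P `<=` P.
Proof. by move=> hP x; exact: mem_of_components. Qed.

Lemma mem_hcore P n x : ideal P -> S n x -> P x -> hcore P x.
Proof. by move=> hP Sx Px; apply/(mem_hull _ Sx) => // _; exact: ideal0. Qed.

Lemma sub_hcore I P : ideal I -> homogeneous S I -> I `<=` P -> I `<=` hcore P.
Proof. by move=> hI homI IP x Ix n; apply: IP; exact: homogeneousP. Qed.

(** The homogeneous core of P is a prime that still contains I. *)
Lemma minimal_prime_homogeneous I P : ideal I -> homogeneous S I ->
  minimal_prime_over I P -> homogeneous S P.
Proof.
move=> hI homI [hP IP minP]; have [hC homC] := hcore_prime hP.
have hPi := prime_ideal_ideal hP.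
suff -> : P = hcore P by [].
apply/seteqP; split; last exact: hcore_sub.
by apply: minP => //; [exact: sub_hcore | exact: hcore_sub].
Qed.

Lemma homogeneous0 : homogeneous S [set (0 : A)].
Proof. by apply: homogeneous_of_components => x n ->; rewrite component0. Qed.

Lemma homogeneous_principal m a : S m a -> homogeneous S (principal a).
Proof.
move=> Sa; apply: homogeneous_of_components => x n [b ->].
rewrite mulrC (component_mull _ _ Sa); case: leqP => _; last by exists 0; rewrite mul0r.
by exists (component b (n - m)); rewrite mulrC.
Qed.

Lemma homogeneous_sub P Q : ideal P -> ideal Q -> homogeneous S P ->
  (forall n x, S n x -> P x -> Q x) -> P `<=` Q.
Proof.
move=> hP hQ homP h x Px; apply: mem_of_components => // n.
by apply: (h n); [exact: component_gcomp | exact: homogeneousP].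
Qed.

End Components.

(** * Primes of the local rings of Proj *)

Section HomogeneousLocalization.
Variables (A : comPzRingType) (S : grading A) (P : set A).
Hypotheses (hP : prime_ideal P).
Local Notation T := (hom_denoms S P).
Local Notation L := (homloc S P).
Implicit Types (a b x y z : A) (d e : denom T) (w : L) (p : set L).

Lemma hom_denoms_closure t : mult_closure T t -> T t.
Proof.
case=> s sT ->; rewrite big_seq; apply: big_ind; last exact: sT.
  by split; [exists 0%N; exact: grading1 | exact: prime1].
move=> x y [[m Sx] Px] [[n Sy] Py]; split; last exact: primeMn.
by exists (m + n)%N; exact: gradingM.
Qed.

Lemma dval_notin d : ~ P (dval d).
Proof. by have [] := hom_denoms_closure (denomP d). Qed.

Lemma denom_exists n t : S n t -> ~ P t -> exists d : denom T, dval d = t.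
Proof.
move=> St Pt; have h : mult_closure T t.
  exists [:: t]; last by rewrite big_seq1.
  by move=> x; rewrite inE => /eqP ->; split=> //; exists n.
by exists (Denom h).
Qed.

Lemma lfrac_inj a b d e : lfrac a d = lfrac b e ->
  exists2 u, ~ P u & u * (dval e * a) = u * (dval d * b).
Proof.
case/(@fraction_eqP A A^o T) => u /hom_denoms_closure[_ Pu] eq.
by exists u.
Qed.

Lemma homlocP w : exists n a d, [/\ S n a, S n (dval d) & val w = lfrac a d].
Proof. by case: w => x /= /asboolP. Qed.

Lemma homloc_exists n a d : S n a -> S n (dval d) ->
  exists w, val w = lfrac a d.
Proof.
move=> Sa Sd; have h : lfrac a d \in homloc_pred (S := S) (P := P).
  by apply/asboolP; exists n, a, d.
by exists (exist (fun u : loc T => u \in homloc_pred (S := S) (P := P)) _ h : L).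
Qed.

Lemma val_homlocM w w' : val (w * w') = val w * val w'.
Proof. by []. Qed.

Lemma val_homlocD w w' : val (w + w') = val w + val w'.
Proof. by []. Qed.

Definition fraction_prime (Q : set A) : set L :=
  [set w | exists n a d, [/\ S n a, S n (dval d), val w = lfrac a d & Q a]].

(** Membership does not depend on the representation of w as a fraction, since denominators
    avoid Q. *)
Lemma fraction_primeP (Q : set A) w a d : prime_ideal Q -> Q `<=` P ->
  fraction_prime Q w -> val w = lfrac a d -> Q a.
Proof.
move=> hQ QP [n [b [e [Sb Se -> Qb]]]] /lfrac_inj[u Pu eq].
have : Q (u * (dval d * b)).
  by do 2 (apply: ideal_mull => //; first exact: prime_ideal_ideal).
rewrite eq => /(primeM hQ)[/QP//|/(primeM hQ)[/QP|//]].
by move/dval_notin.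
Qed.

Lemma fraction_prime_prime (Q : set A) : prime_ideal Q -> Q `<=` P ->
  prime_ideal (fraction_prime Q).
Proof.
move=> hQ QP; have hQi := prime_ideal_ideal hQ; split; first split.
- exists 0%N, 0, denom1; split; [exact: grading0 | exact: grading1 | | exact: ideal0].
  rewrite /= /lfrac; apply: fraction_eq; rewrite ?dval1 //.
- move=> w w' [n [a [d [Sa Sd e Qa]]]] [m [b [d' [Sb Sd' e' Qb]]]].
  exists (n + m)%N, (dval d' * a + dval d * b), (denomM d d'); split.
  + by apply: gradingD; [rewrite addnC |]; apply: gradingM.
  + by rewrite dvalM; apply: gradingM.
  + by rewrite val_homlocD e e' lfracD.
  + by apply: idealD => //; apply: ideal_mull.
- move=> w w' [m [b [d' [Sb Sd' e' Qb]]]].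
  have [n [a [d [Sa Sd e]]]] := homlocP w.
  exists (n + m)%N, (a * b), (denomM d d'); split.
  + exact: gradingM.
  + by rewrite dvalM; apply: gradingM.
  + by rewrite val_homlocM e e' lfracME.
  + exact: ideal_mull.
- by move=> h; apply: (prime1 hQ); apply: (fraction_primeP hQ QP h (d := denom1)).
- move=> w w' hw; have [n [a [d [Sa Sd e]]]] := homlocP w.
  have [m [b [d' [Sb Sd' e']]]] := homlocP w'.
  have : Q (a * b).
    by apply: (fraction_primeP hQ QP hw (d := denomM d d')); rewrite val_homlocM e e' lfracME.
  case/(primeM hQ) => ?; [left; exists n, a, d | right; exists m, b, d']; split=> //.
Qed.

(** A witness of strictness is homogeneous of some degree n; to make it a fraction of degree
    0, raise it to the power k and divide by f^n, where f has positive degree k. *)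
Lemma fraction_prime_strict (Q Q' : set A) :
  (exists n x, [/\ (0 < n)%N, S n x & ~ P x]) ->
  prime_ideal Q -> prime_ideal Q' -> homogeneous S Q' ->
  Q `<=` P -> Q `<=` Q' -> ~ Q' `<=` Q ->
  fraction_prime Q `<` fraction_prime Q'.
Proof.
move=> [k [f [k0 Sf Pf]]] hQ hQ' homQ' QP QQ' Q'Q; split.
  move=> w [n [a [d [Sa Sd e Qa]]]]; exists n, a, d; split=> //; exact: QQ'.
have [n [x [Sx Q'x Qx]]] := homogeneous_witness (prime_ideal_ideal hQ) homQ' (prime_ideal_ideal hQ') Q'Q.
have Pfn : ~ P (f ^+ n) by move/(primeX hP).
have [d hd] := denom_exists (gradingX n Sf) Pfn.
have Sd : S (n * k)%N (dval d) by rewrite hd mulnC; exact: gradingX.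
have [w hw] := homloc_exists (gradingX k Sx) Sd.
move=> sub; have : fraction_prime Q w.
  apply: sub; exists (n * k)%N, (x ^+ k), d; split=> //; first exact: gradingX.
  case: k k0 {Sf Sd w hw} => // k _; rewrite exprS.
  by apply: ideal_mulr => //; exact: prime_ideal_ideal.
by move=> h; apply/Qx/(primeX hQ)/(fraction_primeP hQ QP h hw).
Qed.

(** The quantification over multiples z makes sense of x / d lying in p even when no
    homogeneous element outside P has the degree of x. *)
Definition trace_prime p : set A :=
  hull S (fun n x => forall k z d, S k z -> S (n + k)%N (dval d) ->
    forall w, val w = lfrac (x * z) d -> p w).

Lemma homloc0 w d : val w = lfrac 0 d -> w = 0.
Proof.
move=> e; apply: val_inj; rewrite e /= /lfrac.
by apply: (@fraction_eq A A^o T); rewrite dval1 !scaler0.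
Qed.

Let trace0 p : prime_ideal p -> forall n k z d, S k z -> S (n + k)%N (dval d) ->
    forall w, val w = lfrac (0 * z) d -> p w.
Proof.
by move=> hp n k z d _ _ w; rewrite mul0r => /homloc0 ->; exact: (ideal0 (prime_ideal_ideal hp)).
Qed.

Lemma trace_prime_prime p : prime_ideal p ->
  prime_ideal (trace_prime p) /\ homogeneous S (trace_prime p).
Proof.
move=> hp; have hpi := prime_ideal_ideal hp; apply: hull_prime.
- exact: trace0.
- move=> n x y Sx Sy hx hy k z d Sz Sd w e.
  have [w1 e1] := homloc_exists (gradingM Sx Sz) Sd.
  have [w2 e2] := homloc_exists (gradingM Sy Sz) Sd.
  have -> : w = w1 + w2.
    apply: val_inj; rewrite val_homlocD e e1 e2 lfracD; apply: lfrac_eq.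
    by rewrite dvalM; ring.
  by apply: idealD => //; [exact: (hx _ _ _ Sz Sd _ e1) | exact: (hy _ _ _ Sz Sd _ e2)].
- move=> m n a x Sa Sx hx k z d Sz Sd w e.
  apply: (hx (m + k)%N (a * z) d); first exact: gradingM.
    by rewrite addnCA addnA.
  by rewrite e; congr lfrac; ring.
- move=> h; apply: (prime1 hp); apply: (h 0%N 1 denom1) => //; try exact: grading1.
  by rewrite mul1r.
- move=> m n x y Sx Sy hxy; apply: contrapT => /not_orP[hx hy].
  have [k [z [d [Sz Sd [w pw e]]]]] : exists k z d, [/\ S k z, S (m + k)%N (dval d) &
      exists2 w, ~ p w & val w = lfrac (x * z) d].
    apply: contrapT => h; apply: hx => k z d Sz Sd w e.
    by apply: contrapT => pw; apply: h; exists k, z, d; split=> //; exists w.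
  have [k' [z' [d' [Sz' Sd' [w' pw' e']]]]] : exists k z d, [/\ S k z, S (n + k)%N (dval d) &
      exists2 w, ~ p w & val w = lfrac (y * z) d].
    apply: contrapT => h; apply: hy => l u v Su Sv t e'.
    by apply: contrapT => pt; apply: h; exists l, u, v; split=> //; exists t.
  apply: (primeMn hp pw pw').
  apply: (hxy (k + k')%N (z * z') (denomM d d')); first exact: gradingM.
    by rewrite dvalM addnACA; apply: gradingM.
  by rewrite val_homlocM e e' lfracME; congr lfrac; ring.
Qed.

Lemma trace_prime_sub p : homogeneous S P -> prime_ideal p -> trace_prime p `<=` P.
Proof.
move=> homP hp; have [hQ homQ] := trace_prime_prime hp.
apply: (homogeneous_sub (prime_ideal_ideal hQ) (prime_ideal_ideal hP) homQ).
move=> n x Sx /(mem_hull (trace0 hp) Sx) h; apply: contrapT => Px.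
have [d hd] := denom_exists Sx Px.
apply: (prime1 hp); apply: (h 0%N 1 d); first exact: grading1.
  by rewrite addn0 hd.
by rewrite mulr1; apply: lfrac_eq; rewrite dval1 hd; ring.
Qed.

Lemma trace_prime_strict p p' : prime_ideal p -> prime_ideal p' -> p `<` p' ->
  trace_prime p `<` trace_prime p'.
Proof.
move=> hp hp' [pp' p'p]; split.
  by move=> x hx n k z d Sz Sd w e; apply: pp'; exact: (hx _ _ _ _ Sz Sd _ e).
have /existsNP[w /not_implyP[p'w pw]] := p'p.
have [n [a [d [Sa Sd e]]]] := homlocP w.
move=> sub; have : trace_prime p' a.
  apply/(mem_hull (trace0 hp') Sa) => k z d' Sz Sd' w' e'.
  have Sdz : S (n + k)%N (dval d * z) by apply: gradingM.
  have [w'' e''] := homloc_exists Sdz Sd'.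
  have -> : w' = w'' * w.
    apply: val_inj; rewrite val_homlocM e e' e'' lfracME; apply: lfrac_eq.
    by rewrite dvalM; ring.
  by apply: ideal_mull => //; exact: prime_ideal_ideal.
move/sub/(mem_hull (trace0 hp) Sa)/(_ 0%N 1 d) => h; apply/pw/h.
- exact: grading1.
- by rewrite addn0.
- by rewrite mulr1.
Qed.

(** Primes of the homogeneous localization correspond to homogeneous primes contained in P,
    strictly in both directions. *)
Theorem homloc_dim_ge n : homogeneous S P ->
  (exists n x, [/\ (0 < n)%N, S n x & ~ P x]) ->
  krull_dim_ge L n <->
  exists Q : nat -> set A,
    (forall i, (i <= n)%N ->
       [/\ prime_ideal (Q i), homogeneous S (Q i) & Q i `<=` P]) /\
    (forall i, (i < n)%N -> Q i `<` Q i.+1).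
Proof.
move=> homP relP; split=> [[p [hp sp]]|[Q [hQ sQ]]].
  exists (fun i => trace_prime (p i)); split=> i lei.
    have [? ?] := trace_prime_prime (hp i lei).
    by split=> //; apply: trace_prime_sub => //; apply: hp.
  by apply: trace_prime_strict; [exact/hp/ltnW | exact: hp | exact: sp].
exists (fun i => fraction_prime (Q i)); split=> i lei.
  by have [? _ ?] := hQ i lei; apply: fraction_prime_prime.
have [? _ ?] := hQ i (ltnW lei); have [? ? ?] := hQ i.+1 lei.
by have [? ?] := sQ i lei; apply: fraction_prime_strict.
Qed.

End HomogeneousLocalization.

(** * Components of the fiber and deficient analytic spread *)

Section PrimesTopology.
Variables (A : comPzRingType) (X : set (set A)).
Hypothesis X_prime : forall P, X P -> prime_ideal P.
Implicit Types (P Q : set A) (Z : set (set A)).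

Definition vanishing (E : set A) : set (set A) := [set Q | X Q /\ E `<=` Q].

Lemma zariski_closure1 P : X P -> zariski_closure X [set P] = vanishing P.
Proof.
move=> XP; apply/seteqP; split=> Q [XQ hQ]; split=> //.
  by have [] : vanishing P Q by apply: hQ => [|_ ->]; [exists P | split].
by move=> _ [E ->] sub; split=> // x Ex; apply: hQ; case: (sub P) => // _; apply.
Qed.

Lemma vanishing_irreducible P : X P -> irreducible X (vanishing P).
Proof.
move=> XP; split; [by move=> Q [] | by exists P; split |].
move=> _ _ [E1 ->] [E2 ->] sub.
have vP : vanishing P P by split.
by case: (sub P vP) => -[_ EP]; [left|right] => Q [XQ PQ]; split=> // x /EP /PQ.
Qed.

(** The closed sets x = 0 and y = 0 cover Z when x y vanishes on Z, so one of them contains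
    Z. *)
Lemma irreducible_prime Z : irreducible X Z -> prime_ideal (\bigcap_(Q in Z) Q).
Proof.
move=> [ZX [Q0 ZQ0] irrZ].
have Zid Q : Z Q -> ideal Q by move/ZX/X_prime/prime_ideal_ideal.
split; first split.
- by move=> Q /Zid; exact: ideal0.
- by move=> x y hx hy Q ZQ; apply: idealD; [exact: Zid | exact: hx | exact: hy].
- by move=> a x hx Q ZQ; apply: ideal_mull; [exact: Zid | exact: hx].
- by move/(_ Q0 ZQ0); apply/prime1/X_prime/ZX.
move=> x y hxy.
have [||Q ZQ|sub|sub] := irrZ (vanishing [set x]) (vanishing [set y]).
- by exists [set x].
- by exists [set y].
- have XQ := ZX _ ZQ.
  by case: (primeM (X_prime XQ) (hxy Q ZQ)) => ?; [left|right]; split=> // _ ->.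
- by left => Q /sub[_]; apply.
- by right => Q /sub[_]; apply.
Qed.

End PrimesTopology.

Section FiberPoints.
Variables (R A : comPzRingType) (S : grading A) (c : R -> A) (m : set R).

Definition fiber_points : set (set A) :=
  [set P | Proj S P /\ forall r, m r -> P (c r)].

Definition minimal_fiber_point (P : set A) : Prop :=
  fiber_points P /\ forall Q, fiber_points Q -> Q `<=` P -> P `<=` Q.

Definition two_step_chain (P : set A) : Prop :=
  exists Q0 Q1 Q2 : set A,
    [/\ [/\ prime_ideal Q0, prime_ideal Q1 & prime_ideal Q2],
        [/\ homogeneous S Q0, homogeneous S Q1 & homogeneous S Q2],
        Q0 `<` Q1, Q1 `<` Q2 & Q2 `<=` P].

Lemma Proj_prime P : Proj S P -> prime_ideal P. Proof. by case. Qed.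

Lemma fiber_irreducible Z : irreducible (Proj S) Z -> Z `<=` fiber_points ->
  fiber_points (\bigcap_(Q in Z) Q).
Proof.
move=> irrZ Zfib; have hP := irreducible_prime Proj_prime irrZ.
have [ZX [Q0 ZQ0] _] := irrZ.
split; last first.
  by move=> r mr Q /Zfib[_]; apply.
split=> //.
  move=> n f Sf hf i lti Q ZQ; have [_ homQ _] := ZX _ ZQ.
  by apply: (homQ n f) => //; exact: hf.
have [_ _ [n [x [n0 Sx Q0x]]]] := ZX _ ZQ0.
by exists n, x; split=> //; move/(_ _ ZQ0).
Qed.

Lemma fiber_up P Q : fiber_points P -> Proj S Q -> P `<=` Q -> fiber_points Q.
Proof. by move=> [XP mP] XQ PQ; split=> // r /mP /PQ. Qed.

(** The components are the closures of the minimal points: the intersection of all members of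
    a component is itself a point of the fiber, which generates the component. *)
Lemma fiber_componentP Z :
  irreducible_component (Proj S) fiber_points Z <->
  exists2 P, minimal_fiber_point P & Z = vanishing (Proj S) P.
Proof.
split=> [[irrZ Zfib maxZ]|[P [fP minP] ->]].
  set P := \bigcap_(Q in Z) Q; have fP : fiber_points P by apply: fiber_irreducible.
  have eqZ Q : fiber_points Q -> Q `<=` P -> vanishing (Proj S) Q = Z.
    move=> fQ QP; have [XQ _] := fQ.
    apply: maxZ; first exact: (vanishing_irreducible XQ).
      by move=> Q' [XQ' /(fiber_up fQ)]; apply.
    move=> Q' ZQ'; have [ZX _ _] := irrZ; split; first exact: ZX.
    by move=> x /QP; apply.
  exists P; last by rewrite eqZ.
  split=> // Q fQ QP; have := eqZ P fP (@subset_refl _ P).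
  by rewrite -(eqZ Q fQ QP) => e; have [] : vanishing (Proj S) P Q
    by rewrite e; split=> //; case: fQ.
have [XP _] := fP.
split; first exact: (vanishing_irreducible XP).
  by move=> Q [XQ /(fiber_up fP)]; apply.
move=> Z' irrZ' Zfib' sub; apply/seteqP; split=> // Q Z'Q.
have [ZX' _ _] := irrZ'; split; first exact: ZX'.
have PQ : P `<=` \bigcap_(Q in Z') Q.
  apply: minP; first exact: fiber_irreducible.
  by move=> x; apply; apply: sub; split.
by move=> x /PQ; apply.
Qed.

Lemma homloc_two_step_chain P : Proj S P ->
  krull_dim_ge (homloc S P) 2 <-> two_step_chain P.
Proof.
move=> [hP homP relP]; rewrite (homloc_dim_ge hP 2 homP relP).
split=> [[Q [hQ sQ]]|[Q0 [Q1 [Q2 [[h0 h1 h2] [o0 o1 o2] s0 s1 Q2P]]]]].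
  have [? ? _] := hQ 0%N isT; have [? ? _] := hQ 1%N isT.
  have [? ? ?] := hQ 2%N isT; exists (Q 0%N), (Q 1%N), (Q 2%N).
  by split=> //; apply: sQ.
have Q1P : Q1 `<=` P by case: s1 => s _ x /s /Q2P.
have Q0P : Q0 `<=` P by case: s0 => s _ x /s /Q1P.
exists (fun i => if i is i'.+1 then if i' is _.+1 then Q2 else Q1 else Q0).
by split=> [[|[|[|i]]]|[|[|i]]] //; split.
Qed.

End FiberPoints.

Section DeficientAnalyticSpread.
Variables (R : comNzRingType) (m : set R) (K : lmodType R).
Hypothesis hm : maximal_ideal m.
Local Notation S := (rees_grading K).

(** As m is maximal, containing m suffices for lying over m. *)
Lemma Proj_fiberE : @Proj_fiber R m K = fiber_points S (rees_C K) m.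
Proof.
apply/seteqP; split=> P [XP mP]; split=> //; first by move=> r; rewrite -mP.
have hP := Proj_prime XP.
have hI : ideal [set r | P (rees_C K r)].
  exact: (ideal_preim (rees_C K) (prime_ideal_ideal hP)).
by case: hm => _ _ max; apply/seteqP; split=> //; apply: max; rewrite //= rmorph1; exact: prime1.
Qed.

Theorem deficient_analytic_spreadP : deficient_analytic_spread m K <->
  forall P, minimal_fiber_point S (rees_C K) m P -> two_step_chain S P.
Proof.
rewrite /deficient_analytic_spread Proj_fiberE.
split=> [def P minP|def Z /fiber_componentP[P minP ->]].
  have [[XP _] _] := minP.
  have [|Q [XQ e] dimQ] := def (vanishing (Proj S) P).
    by apply/fiber_componentP; exists P.
  apply/(homloc_two_step_chain XP); suff -> : P = Q by [].
  rewrite zariski_closure1 // in e; apply/seteqP; split.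
    by have [] : vanishing (Proj S) P Q by rewrite e; split.
  by have [] : vanishing (Proj S) Q P by rewrite -e; split.
have [[XP _] _] := minP.
exists P; first by split=> //; rewrite zariski_closure1.
by apply/(homloc_two_step_chain XP)/def.
Qed.

End DeficientAnalyticSpread.

(** * Linear forms and coordinates in free modules *)

Section LinearForms.
Variable A : comPzRingType.

Definition linear_form (V : lmodType A) (h : V -> A) : Prop :=
  forall a u v, h (a *: u + v) = a * h u + h v.

Section Basics.
Variables (V : lmodType A) (h : V -> A).
Hypothesis lin : linear_form h.

Lemma linear_form0 : h 0 = 0.
Proof.
by have := lin (-1) 0 0; rewrite scaler0 addr0 mulN1r addNr.
Qed.

Lemma linear_formZ a v : h (a *: v) = a * h v.
Proof. by rewrite -[a *: v]addr0 lin linear_form0 addr0. Qed.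

Lemma linear_form_sum (T : Type) (r : seq T) (a : T -> A) (v : T -> V) :
  h (\sum_(i <- r) a i *: v i) = \sum_(i <- r) a i * h (v i).
Proof.
elim: r => [|i r IH]; first by rewrite !big_nil linear_form0.
by rewrite !big_cons lin IH.
Qed.

End Basics.

Lemma fin_genE (V : lmodType A) : fin_gen V ->
  exists (k : nat) (g : nat -> V),
    forall v, exists c : nat -> A, v = \sum_(i < k) c i *: g i.
Proof.
move=> [k [g hg]]; case: k g hg => [|k] g hg.
  exists 0%N, (fun=> 0) => v; have [c ->] := hg v; exists (fun=> 0).
  by rewrite !big_ord0.
exists k.+1, (fun i => g (inord i)) => v; have [c ->] := hg v.
by exists (fun i => c (inord i)); apply: eq_bigr => i _; rewrite inord_val.
Qed.

(** Coordinates with respect to a basis, for a basis given as a set.  The expansion is stated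
    over every large enough duplicate-free list, so that several vectors can be expanded
    over a common one. *)
Lemma free_module_coordinates (F : lmodType A) : free_module F ->
  exists c : F -> F -> A, (forall b, linear_form (c b)) /\
    forall v, exists s : seq F, forall s' : seq F, uniq s' -> {subset s <= s'} ->
      v = \sum_(b <- s') c b v *: b.
Proof.
move=> [B [spanB freeB]].
pose good v (z : seq F * (F -> A)) :=
  [/\ uniq z.1, forall b, b \in z.1 -> B b, forall b, b \notin z.1 -> z.2 b = 0 &
      v = \sum_(b <- z.1) z.2 b *: b].
have widen v z s : good v z -> uniq s -> {subset z.1 <= s} ->
    v = \sum_(b <- s) z.2 b *: b.
  move=> [uz Bz z0 ->] us sub; rewrite [RHS](bigID (mem z.1)) /=.
  rewrite [X in _ = _ + X]big1 ?addr0 => [|b /z0 ->]; last by rewrite scale0r.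
  rewrite -[RHS]big_filter; apply: perm_big; apply: uniq_perm => //.
    exact: filter_uniq.
  by move=> b; rewrite mem_filter; case: (boolP (b \in z.1)) => //= /sub ->.
have good_uniq v z z' : good v z -> good v z' -> z.2 = z'.2.
  move=> gz gz'; pose s := undup (z.1 ++ z'.1).
  have us : uniq s by apply: undup_uniq.
  have sub : {subset z.1 <= s} by move=> b bz; rewrite mem_undup mem_cat bz.
  have sub' : {subset z'.1 <= s} by move=> b bz; rewrite mem_undup mem_cat bz orbT.
  have e := widen _ _ _ gz us sub; have e' := widen _ _ _ gz' us sub'.
  case: gz gz' => [_ Bz z0 _] [_ Bz' z0' _].
  apply: funext => b; have [bs|] := boolP (b \in s); last first.
    by rewrite mem_undup mem_cat negb_or => /andP[/z0 -> /z0' ->].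
  apply/eqP; rewrite -subr_eq0; apply/eqP.
  apply: (freeB s (fun b => z.2 b - z'.2 b) us) => // [c|].
    by rewrite mem_undup mem_cat => /orP[/Bz|/Bz'].
  under eq_bigr do rewrite scalerBl.
  by rewrite sumrB -e -e' subrr.
have /choice[z hz] v : exists z, good v z.
  have [s [c [Bs ->]]] := spanB v.
  exists (undup s, fun b => (c b *+ count_mem b s)); split=> /=.
  - exact: undup_uniq.
  - by move=> b; rewrite mem_undup; exact: Bs.
  - by move=> b; rewrite mem_undup => /count_memPn ->; rewrite mulr0n.
  - rewrite -big_undup_iterop_count; apply: eq_bigr => b _.
    by rewrite -scalerMnl.
exists (fun b v => (z v).2 b); split; last first.
  by move=> v; exists (z v).1 => s us sub; apply: widen (hz v) us sub.
move=> b a u v.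
pose s := undup ((z u).1 ++ (z v).1).
have us : uniq s by apply: undup_uniq.
have sub : {subset (z u).1 <= s} by move=> d bz; rewrite mem_undup mem_cat bz.
have sub' : {subset (z v).1 <= s} by move=> d bz; rewrite mem_undup mem_cat bz orbT.
suff g : good (a *: u + v) (s, fun b => a * (z u).2 b + (z v).2 b).
  by rewrite (good_uniq _ _ _ (hz _) g).
have e := widen _ _ _ (hz u) us sub; have e' := widen _ _ _ (hz v) us sub'.
case: (hz u) (hz v) => [_ Bz z0 _] [_ Bz' z0' _]; split=> //=.
- by move=> d; rewrite mem_undup mem_cat => /orP[/Bz|/Bz'].
- move=> d; rewrite mem_undup mem_cat negb_or => /andP[/z0 -> /z0' ->].
  by rewrite mulr0 addr0.
- rewrite [X in a *: X]e [X in _ + X]e' scaler_sumr -big_split /=.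
  by apply: eq_bigr => d _; rewrite scalerDl scalerA.
Qed.

Variable eta : set A.
Hypothesis eta_prime : prime_ideal eta.
Let eta_ideal := prime_ideal_ideal eta_prime.

(** Over the fraction field of A / eta: a vector g orthogonal to every w that is orthogonal to
    U lies in the span of U.  Gaussian elimination on the last coordinate, with
    denominators cleared; the scalars are absorbed in U. *)
Lemma elimination k (U : set (nat -> A)) (g : nat -> A) :
  U (fun=> 0) ->
  (forall a a' u u', U u -> U u' -> U (fun i => a * u i + a' * u' i)) ->
  (forall w : nat -> A, (forall u, U u -> eta (\sum_(i < k) u i * w i)) ->
     eta (\sum_(i < k) g i * w i)) ->
  exists d u, [/\ ~ eta d, U u & forall i, (i < k)%N -> eta (d * g i - u i)].
Proof.
elim: k U g => [|k IH] U g U0 UD h.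
  by exists 1, (fun=> 0); split=> //; exact: prime1.
have [[u0 [Uu0 e0]]|all] := pselect (exists u, U u /\ ~ eta (u k)); last first.
  have {}all u : U u -> eta (u k).
    by move=> Uu; apply: contrapT => nu; apply: all; exists u.
  have gk : eta (g k).
    have := h (fun i => (i == k)%:R).
    have e (v : nat -> A) : \sum_(i < k.+1) v i * (nat_of_ord i == k)%:R = v k :> A.
      rewrite big_ord_recr /= eqxx mulr1 big1 ?add0r // => i _.
      by rewrite ltn_eqF ?mulr0.
    by rewrite e; apply=> u /all; rewrite e.
  have [||w hw|d [u [ed Uu du]]] := IH U g => //.
    have := h (fun i => if i == k then 0 else w i).
    have e (v : nat -> A) : \sum_(i < k.+1) v i * (if nat_of_ord i == k then 0 else w i) =
        \sum_(i < k) v i * w i :> A.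
      rewrite big_ord_recr /= eqxx mulr0 addr0; apply: eq_bigr => i _.
      by rewrite ltn_eqF.
    by rewrite e; apply=> u /hw; rewrite e.
  exists d, u; split=> // i; rewrite ltnS leq_eqVlt => /orP[/eqP ->|]; last exact: du.
  by apply: idealB => //; [exact: ideal_mull | exact: all].
(* Clear the last coordinate with the pivot u0. *)
pose red v i := u0 k * v i - v k * u0 i.
pose U' := [set u' | exists2 u, U u & u' = red u].
have [|a a' _ _ [u Uu ->] [u' Uu' ->]|w hw|d [_ [ed [u Uu ->] du]]] := IH U' (red g).
- exists (fun=> 0) => //; apply: funext => i; rewrite /red; ring.
- exists (fun i => a * u i + a' * u' i); first exact: UD.
  by apply: funext => i; rewrite /red; ring.
  (* w' pairs with any v as w pairs with the reduction of v. *)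
- pose w' i := if i == k then - \sum_(j < k) u0 j * w j else u0 k * w i.
  have e (v : nat -> A) : \sum_(i < k.+1) v i * w' i = \sum_(i < k) red v i * w i.
    rewrite big_ord_recr /= {2}/w' eqxx mulrN mulr_sumr -sumrB.
    apply: eq_bigr => i _; rewrite /w' /red ltn_eqF //; ring.
  by rewrite -e; apply: h => u Uu; rewrite e; apply: hw; exists u.
exists (d * u0 k), (fun i => u0 k * u i + (d * g k - u k) * u0 i); split.
- exact: primeMn.
- exact: UD.
move=> i; rewrite ltnS leq_eqVlt => /orP[/eqP ->|/du].
  by rewrite (_ : _ - _ = 0); [exact: ideal0 | ring].
by rewrite /red; congr (eta _); ring.
Qed.

End LinearForms.

(** * Extending linear forms modulo a minimal prime *)

Section Separation.
Variable R : comNzRingType.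
Hypothesis nR : noetherian R.
Variable eta : set R.
Hypothesis min_eta : minimal_prime eta.

Let eta_prime : prime_ideal eta. Proof. by case: min_eta. Qed.
Let eta_ideal := prime_ideal_ideal eta_prime.

(** The localization at a minimal prime is local with nilpotent maximal ideal, so it has a
    nonzero element annihilated by any finite set of non-units.  Starting from a, multiply
    by the largest power of c that does not kill it. *)
Lemma minimal_prime_annihilator (s : seq R) : (forall c, c \in s -> eta c) ->
  exists a, (forall c, c \in s -> a * c = 0) /\ forall t, ~ eta t -> t * a <> 0.
Proof.
elim: s => [|c s IH] hs.
  by exists 1; split=> // t et; rewrite mulr1 => t0; apply: et; rewrite t0; exact: ideal0.
have [|a [as0 ta]] := IH; first by move=> d ds; apply: hs; rewrite inE ds orbT.
have [t et [k tk]] := minimal_prime_nilpotent nR min_eta (hs c (mem_head _ _)).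
have ex : exists i, `[< exists2 u, ~ eta u & u * (a * c ^+ i) = 0 >].
  exists k; apply/asboolP; exists t => //.
  by rewrite mulrCA tk mulr0.
case: (ex_minnP ex) => -[|i] /asboolP[u eu e] mini.
  by move: e; rewrite expr0 mulr1 => /(ta u eu).
exists (u * (a * c ^+ i)); split.
  move=> d; rewrite inE => /orP[/eqP ->|/as0 ad].
    by rewrite -[RHS]e exprSr; ring.
  rewrite (_ : _ * d = u * c ^+ i * (a * d)); last by ring.
  by rewrite ad mulr0.
move=> t' et' e'; have /mini : `[< exists2 u, ~ eta u & u * (a * c ^+ i) = 0 >].
  by apply/asboolP; exists (t' * u); [exact: primeMn | rewrite -mulrA].
by rewrite ltnn.
Qed.

Variables (M N : lmodType R) (iota : {linear M -> N}).
Hypothesis iota_inj : injective iota.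

(** Up to a factor outside eta, a (iota x) = 0 descends to a x = 0 by injectivity, whence
    a (g x) = 0; if g x were outside eta, a would vanish in the localization. *)
Lemma annihilator_linear_form a u (x : M) (g : M -> R) :
  (forall t, ~ eta t -> t * a <> 0) -> ~ eta u -> u *: (a *: iota x) = 0 ->
  linear_form g -> eta (g x).
Proof.
move=> ta eu e lg; apply: contrapT => egx.
have e0 : u *: (a *: x) = 0 by apply: iota_inj; rewrite !linearZ /= e linear0.
apply: (ta (u * g x)); first exact: primeMn.
by rewrite mulrAC -mulrA -!(linear_formZ lg) e0 (linear_form0 lg).
Qed.

(** If all coordinates of iota x in F lay in eta, an element a nonzero at eta would kill them
    all, hence iota x. *)
Lemma separation_free (F : lmodType R) (j : {linear N -> F}) (g : M -> R) x :
  free_module F -> injective j -> linear_form g -> ~ eta (g x) ->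
  exists2 h : N -> R, linear_form h & ~ eta (h (iota x)).
Proof.
move=> /free_module_coordinates[c [lc hc]] j_inj lg gx; apply: contrapT => no.
have cx b : eta (c b (j (iota x))).
  apply: contrapT => cb; apply: no; exists (fun v => c b (j v)) => //.
  by move=> a u v; rewrite linearP lc.
have [s es] := hc (j (iota x)).
have [|a [ac ta]] := @minimal_prime_annihilator [seq c b (j (iota x)) | b <- s].
  by move=> _ /mapP[b _ ->].
apply/gx/(@annihilator_linear_form a 1 x g ta (prime1 eta_prime)) => //.
apply: j_inj; rewrite scale1r linearZ linear0 /=.
rewrite (es (undup s)) ?undup_uniq // => [|b]; last by rewrite mem_undup.
rewrite scaler_sumr big_seq big1 // => b; rewrite mem_undup => bs.
by rewrite scalerA ac ?scale0r //; apply: map_f.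
Qed.

Local Notation T := (~` eta).

Lemma mult_closure_prime t : mult_closure T t -> ~ eta t.
Proof.
case=> s sT ->; rewrite big_seq; apply: (big_ind (fun x => ~ eta x)) => //.
  exact: prime1.
by move=> x y; exact: primeMn.
Qed.

Lemma common_denominator k (z : nat -> loc T) : exists (e : denom T) (b : nat -> R),
  forall i, (i < k)%N -> z i = lfrac (b i) e.
Proof.
elim: k => [|k [e [b hb]]]; first by exists denom1, (fun=> 0).
have [a [d zk]] := lfracP (z k).
exists (denomM e d), (fun i => if i == k then dval e * a else dval d * b i) => i.
rewrite ltnS leq_eqVlt; case: eqP => [->|_ /= /hb ->] //=.
  by rewrite zk => _; apply: lfrac_eq; rewrite dvalM; ring.
by apply: lfrac_eq; rewrite dvalM; ring.
Qed.

Lemma lfrac_eq0 a (d : denom T) : lfrac a d = 0 -> exists2 u, ~ eta u & u * a = 0.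
Proof.
case/(@fraction_eqP R R^o T) => u /mult_closure_prime eu e; exists u => //.
have := e; rewrite dval1 scale1r !scaler0.
by [].
Qed.

Lemma lfrac_sum k (a : nat -> R) (d : denom T) :
  \sum_(i < k) lfrac (a i) d = lfrac (\sum_(i < k) a i) d.
Proof.
elim: k => [|k IH]; first by rewrite !big_ord0; apply: (@fraction_eq R R^o T); rewrite !scaler0.
by rewrite !big_ord_recr /= IH lfracD; apply: lfrac_eq; rewrite dvalM; ring.
Qed.

Lemma fraction_sum k (r : nat -> R) (n : nat -> N) :
  fraction (\sum_(i < k) r i *: n i) (@denom1 R T) =
  \sum_(i < k) lfrac (r i) denom1 *: fraction (n i) denom1 :> locmod N T.
Proof.
elim: k => [|k IH]; first by rewrite !big_ord0.
rewrite !big_ord_recr /= -IH [_ *: fraction _ _]lfracZ fractionDE.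
by apply: fraction_eq; rewrite !dvalM !dval1 !mulr1 !scale1r.
Qed.

(** N is finitely presented, so a form on its localization becomes, after clearing denominators,
    a form on N.  Instead of presenting N, note that the values taken by the numerators b
    on the relations between the generators form an ideal of R; its finitely many
    generators, which vanish in the localization, are killed by one u outside eta. *)
Lemma linear_form_descent (H : locmod N T -> loc T) x a (d : denom T) :
  fin_gen N -> @linear_form (loc T) (locmod N T) H ->
  H (fraction x denom1) = lfrac a d -> ~ eta a ->
  exists2 h : N -> R, linear_form h & ~ eta (h x).
Proof.
move=> /fin_genE[k [n gen]] lH Hx ea.
have [e [b hb]] := common_denominator k (fun i => H (fraction (n i) denom1)).
have Hsum (r : nat -> R) : H (fraction (\sum_(i < k) r i *: n i) denom1) =
    lfrac (\sum_(i < k) r i * b i) e.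
  rewrite (fraction_sum k r n) (linear_form_sum lH) -(lfrac_sum k (fun i => r i * b i)); apply: eq_bigr => i _.
  by rewrite hb // lfracME; apply: lfrac_eq; rewrite dvalM dval1; ring.
(* The obstruction to b being the values of a linear form at the generators n. *)
pose rel := [set z | exists2 r : nat -> R, \sum_(i < k) r i *: n i = 0 &
                       z = \sum_(i < k) r i * b i].
have rel_ideal : ideal rel.
  split.
  - exists (fun=> 0); first by rewrite big1 // => i _; rewrite scale0r.
    by rewrite big1 // => i _; rewrite mul0r.
  - move=> _ _ [r r0 ->] [r' r0' ->]; exists (fun i => r i + r' i).
      under eq_bigr do rewrite scalerDl.
      by rewrite big_split /= r0 r0' addr0.
    by rewrite -big_split; apply: eq_bigr => i _; rewrite mulrDl.
  - move=> c _ [r r0 ->]; exists (fun i => c * r i).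
      under eq_bigr do rewrite -scalerA.
      by rewrite -scaler_sumr r0 scaler0.
    by rewrite mulr_sumr; apply: eq_bigr => i _; rewrite mulrA.
have kill z : rel z -> exists2 u, ~ eta u & u * z = 0.
  move=> [r r0 ->]; apply: (@lfrac_eq0 _ e); rewrite -Hsum r0.
  suff -> : fraction 0 denom1 = 0 :> locmod N T by rewrite (linear_form0 lH).
  by [].
have [u eu ku] : exists2 u, ~ eta u & forall z, rel z -> u * z = 0.
  have [s es] := nR rel_ideal.
  have [u eu ku] : exists2 u, ~ eta u & forall z, z \in s -> u * z = 0.
    have : forall z, z \in s -> rel z by move=> z zs; rewrite es; apply: ideal_genP.
    elim: s {es} => [|z s IH] hs; first by exists 1 => //; exact: prime1.
    have [|u eu ku] := IH; first by move=> y ys; apply: hs; rewrite inE ys orbT.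
    have [v ev kv] := kill z (hs z (mem_head _ _)).
    exists (u * v) => [|y]; first exact: primeMn.
    rewrite inE => /orP[/eqP ->|/ku uy]; first by rewrite -mulrA kv mulr0.
    by rewrite mulrAC uy mul0r.
  exists u => // z; rewrite es => -[l hl ->]; rewrite mulr_sumr big_seq big1 // => y yl.
  by rewrite mulrCA ku ?mulr0 //; apply: hl.
have /choice[r hr] := gen.
pose h v := u * \sum_(i < k) r v i * b i.
have hE v (r' : nat -> R) : v = \sum_(i < k) r' i *: n i -> h v = u * \sum_(i < k) r' i * b i.
  move=> e'; apply/eqP; rewrite -subr_eq0 -mulrBr; apply/eqP/ku.
  exists (fun i => r v i - r' i).
    under eq_bigr do rewrite scalerBl.
    by rewrite sumrB -hr -e' subrr.
  by rewrite -sumrB; apply: eq_bigr => i _; rewrite mulrBl.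
exists h.
  move=> c v w; rewrite (@hE _ (fun i => c * r v i + r w i)).
    rewrite /h [c * _]mulrCA -mulrDr; congr (u * _).
    rewrite mulr_sumr -big_split; apply: eq_bigr => i _ /=.
    by rewrite mulrDl mulrA.
  rewrite [in LHS](hr v) [X in _ + X](hr w) scaler_sumr -big_split /=.
  by apply: eq_bigr => i _; rewrite scalerDl scalerA.
apply: primeMn => // eb; apply: ea.
move: Hx; rewrite [in LHS](hr x) Hsum => /(@fraction_eqP R R^o T)[t /mult_closure_prime et e'].
have : eta (t * (dval e * a)) by rewrite -[_ * _]e' -[_ *: _]/(_ * (_ * _)); do 2 apply: ideal_mull => //.
move/(primeM eta_prime) => [//|/(primeM eta_prime)[|//]].
by move/mult_closure_prime: (denomP e).
Qed.

(** The argument of [separation_free] takes place in the localization of N; the form found there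
    then descends to N. *)
Lemma separation_generically_free (g : M -> R) x : fin_gen N ->
  @free_module (loc T) (locmod N T) -> linear_form g -> ~ eta (g x) ->
  exists2 h : N -> R, linear_form h & ~ eta (h (iota x)).
Proof.
move=> fgN /free_module_coordinates[c [lc hc]] lg gx; apply: contrapT => no.
pose y : locmod N T := fraction (iota x) denom1.
have /choice[q hq] b : exists q : R * denom T, c b y = lfrac q.1 q.2.
  by have [a [d e]] := lfracP (c b y); exists (a, d).
have eq1 b : eta (q b).1.
  apply: contrapT => eb; apply: no.
  exact: (@linear_form_descent (c b) _ _ _ fgN (lc b) (hq b)).
have [s es] := hc y.
have [|a [ac ta]] := @minimal_prime_annihilator [seq (q b).1 | b <- s].
  by move=> _ /mapP[b _ ->].
have ay0 : lfrac a denom1 *: y = 0.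
  rewrite (es (undup s)) ?undup_uniq // => [|b]; last by rewrite mem_undup.
  rewrite scaler_sumr big_seq big1 // => b; rewrite mem_undup => bs.
  rewrite scalerA hq lfracME ac; last exact: map_f.
  suff -> : lfrac 0 (denomM denom1 (q b).2) = 0 :> loc T by rewrite scale0r.
  by apply: (@fraction_eq R R^o T); rewrite !scaler0.
move: ay0; rewrite [_ *: _]lfracZ => /fraction_eqP[u /mult_closure_prime eu].
rewrite dval1 scale1r !scaler0 => e.
exact/gx/(@annihilator_linear_form a u x g ta eu e lg).
Qed.

End Separation.

Lemma minimal_prime_component (R : comNzRingType) (eta : set R) : minimal_prime eta ->
  irreducible_component (Spec R) (Spec R) (vanishing (Spec R) eta) /\
  generic_point (Spec R) (vanishing (Spec R) eta) eta.
Proof.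
move=> [he _ emin]; have XP P : Spec R P -> prime_ideal P by [].
split; last by split=> //; rewrite zariski_closure1.
split; first exact: vanishing_irreducible.
  by move=> Q [].
move=> Z' irrZ' _ sub; apply/seteqP; split=> // Q Z'Q.
have hP := irreducible_prime XP irrZ'.
have [ZX _ _] := irrZ'; split; first exact: ZX.
have : eta `<=` \bigcap_(Q in Z') Q.
  apply: emin => //; first by apply: zero_sub; exact: prime_ideal_ideal.
  by move=> x; apply; apply: sub; split.
by move=> h x /h; apply.
Qed.

(** * Evaluation of monoid algebras *)

Lemma mulr_rearrange (A : comPzRingType) (a b c d : A) :
  b * (a * d * c) = a * b * c * d.
Proof. ring. Qed.

Lemma scaled_combinationB (A B : comPzRingType) (f : {rmorphism A -> B}) (T : Type)
  (r : seq T) (a b : T -> A) (s : T -> B) d :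
  f d * (\sum_(j <- r) f (a j) * s j) - \sum_(j <- r) f (b j) * s j =
  \sum_(j <- r) f (d * a j - b j) * s j.
Proof.
rewrite mulr_sumr -sumrB; apply: eq_bigr => j _.
by rewrite rmorphB rmorphM mulrBl mulrA.
Qed.

Section MonoidAlgebra.
Variables (R : comNzRingType) (I : choiceType).
Local Notation P := {malg R[{cmonom I}]}.

Lemma cmonom_ind (C : {cmonom I} -> Prop) : C mone ->
  (forall i k, C k -> C (mmul (ucm i) k)) -> forall k, C k.
Proof.
move=> C1 CU k; move: {2}(mdeg k) (erefl (mdeg k)) => n.
elim: n k => [|n IH] k dk; first by rewrite (mdeg_eq0I dk).
have [i ik] : exists i, k i != 0%N.
  have : k != mone by rewrite -mdeg_eq0 dk.
  move=> k1; apply: contrapT => h; case/negP: k1; apply/cmP => i; rewrite cm1.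
  by apply/eqP/negP => /negP ki; apply: h; exists i.
have e : k = mmul (ucm i) (divcm k (ucm i)).
  apply/eqP/cmP => j; rewrite cmM divcmE cmU.
  by case: eqP => [<-|_]; rewrite ?add0n ?subn0 // subnKC // lt0n.
rewrite e; apply/CU/IH.
by have := dk; rewrite {1}e mdegM mdegU add1n => -[].
Qed.

Lemma malgUE c k : << c *g k >> = c%:MP * << k >> :> P.
Proof. by rewrite malgM_def fgmulUU mul1m mulr1. Qed.

Lemma malg_ind (C : P -> Prop) : (forall c, C c%:MP) ->
  (forall i, C << ucm i >>) -> (forall p q, C p -> C q -> C (p + q)) ->
  (forall p q, C p -> C q -> C (p * q)) -> forall p, C p.
Proof.
move=> CC CX CD CM p; rewrite [p]monalgE; apply: big_ind => [|//|k _].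
  by rewrite -[0]malgC0E; exact: CC.
rewrite malgUE.
apply: (CM) => //; elim/cmonom_ind: k => [|i k Ck]; first exact: CC.
have -> : << mmul (ucm i) k >> = << ucm i >> * << k >> :> P.
  by rewrite malgM_def fgmulUU mulr1.
exact: (CM _ _ (CX i) Ck).
Qed.

Lemma malg_hom_ext (S : comNzRingType) (f g : {rmorphism P -> S}) :
  (forall c, f c%:MP = g c%:MP) -> (forall i, f << ucm i >> = g << ucm i >>) ->
  forall p, f p = g p.
Proof.
move=> eC eX; apply: malg_ind => // p q ep eq.
  by rewrite !rmorphD ep eq.
by rewrite !rmorphM ep eq.
Qed.

Definition coefs_in (J : set R) : set P := [set p | forall k, J p@_k].

Lemma coefs_in_ideal (J : set R) : ideal J -> ideal (coefs_in J).
Proof.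
move=> hJ; split=> [k|p q hp hq k|a p hp k]; first by rewrite mcoeff0; exact: ideal0.
  by rewrite mcoeffD; exact: idealD.
rewrite mcoeffMl; apply: ideal_sum => // i _; apply: ideal_sum => // j _.
rewrite -mulr_natr; apply: ideal_mulr => //; exact: ideal_mull.
Qed.

(** Expanding p once in each factor, every term carries a product of n coefficients of p. *)
Lemma nilpotent_coefs n (p : P) :
  (forall s : seq R, size s = n ->
     (forall x, x \in s -> forall eta, minimal_prime eta -> eta x) ->
     \prod_(x <- s) x = 0) ->
  (forall eta, minimal_prime eta -> coefs_in eta p) -> p ^+ n = 0.
Proof.
move=> hn hp.
(* Trade the factors p, one at a time, for coefficients of p. *)
suff h j (s : seq R) : (size s + j)%N = n ->
    (forall x, x \in s -> forall P, minimal_prime P -> P x) ->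
    (\prod_(x <- s) x)%:MP * p ^+ j = 0.
  by have := h n [::] erefl; rewrite big_nil (mpolyC1E {cmonom I} R) mul1r; apply.
elim: j s => [|j IH] s; rewrite ?addn0 => ss sP.
  by rewrite hn // malgC0E mul0r.
rewrite exprS [X in X * p ^+ j]monalgE mulr_suml mulr_sumr big1 // => k _.
rewrite malgUE.
have := IH (p@_k :: s); rewrite /= addSn -addnS => /(_ ss).
rewrite big_cons => h; transitivity ((p@_k * \prod_(x <- s) x)%:MP * p ^+ j * << k >>).
  have -> : (p@_k * \prod_(x <- s) x)%:MP = (p@_k)%:MP * (\prod_(x <- s) x)%:MP :> P.
    exact: mpolyCM.
  exact: mulr_rearrange.
rewrite h ?mul0r // => x; rewrite inE => /orP[/eqP ->|/sP//].
by move=> eta /hp.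
Qed.

Section Evaluation.
Variables (S : comNzRingType) (f : {rmorphism R -> S}) (v : I -> S).

Definition mon_eval (k : {cmonom I}) : S := \prod_(i <- finsupp k) v i ^+ k i.

Lemma mon_evalEw (k : {cmonom I}) (d : {fset I}) : (finsupp k `<=` d)%fset ->
  mon_eval k = \prod_(x <- d) v x ^+ k x.
Proof.
move=> le; rewrite /mon_eval [LHS](big_fset_incl _ le) //= => x _.
by rewrite -cmE_eq0 => /eqP ->.
Qed.

Lemma mon_eval_mmorphism : mmorphism mon_eval.
Proof.
split; last by rewrite /mon_eval mdom1 big_seq_fset0.
move=> k l.
rewrite (@mon_evalEw k (finsupp (mmul k l))) ?mdomD ?fsubsetUl //.
rewrite (@mon_evalEw l (finsupp (mmul k l))) ?mdomD ?fsubsetUr //.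
rewrite -mdomD -big_split /=.
by apply: eq_bigr => x _; rewrite cmM exprD.
Qed.

HB.instance Definition _ :=
  isMultiplicative.Build {cmonom I} S mon_eval mon_eval_mmorphism.

Definition eval : P -> S := mmap f mon_eval.
HB.instance Definition _ := GRing.RMorphism.on eval.

Lemma evalC c : eval c%:MP = f c.
Proof. exact: mmapC. Qed.

Lemma evalX i : eval << ucm i >> = v i.
Proof.
transitivity (f 1 * mon_eval (ucm i)); first exact: mmapU.
by rewrite rmorph1 mul1r /mon_eval mdomU big_seq_fset1 cmUU expr1.
Qed.

Lemma evalB p q : eval (p - q) = eval p - eval q.
Proof. exact: (rmorphB eval). Qed.

Lemma evalM p q : eval (p * q) = eval p * eval q.
Proof. exact: (rmorphM eval). Qed.

Lemma eval_kernel_ideal : ideal [set p | eval p = 0].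
Proof. exact: (ideal_preim eval (@zero_ideal S)). Qed.

End Evaluation.

Lemma eval_congr (S : comNzRingType) (f : {rmorphism R -> S}) (v w : I -> S) (J : set S) :
  ideal J -> (forall i, J (v i - w i)) -> forall p, J (eval f v p - eval f w p).
Proof.
move=> hJ vw; apply: malg_ind => [c|i|p q hp hq|p q hp hq].
- by rewrite !evalC subrr; exact: ideal0.
- by rewrite !evalX.
- by rewrite !rmorphD opprD addrACA; exact: idealD.
rewrite !rmorphM.
have -> : eval f v p * eval f v q - eval f w p * eval f w q =
    eval f v p * (eval f v q - eval f w q) + eval f w q * (eval f v p - eval f w p).
  by ring.
by apply: idealD => //; exact: ideal_mull.
Qed.

Lemma eval_scale (S : comNzRingType) (f : {rmorphism R -> S}) (v : I -> S) a n (p : P) :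
  (forall k, p@_k != 0 -> mdeg k = n) ->
  eval f (fun i => a * v i) p = a ^+ n * eval f v p.
Proof.
move=> hp; rewrite /eval !mmapE mulr_sumr big_seq [RHS]big_seq.
apply: eq_bigr => k kp; rewrite mulrCA; congr (_ * _).
have -> : n = mdeg k by rewrite (hp k) // mcoeff_neq0.
rewrite mdegE -prodrXr /mon_eval -big_split /=.
by apply: eq_bigr => i _; rewrite exprMn.
Qed.

End MonoidAlgebra.

(** * Rees algebras *)

Section ReesAlgebra.
Variables (R : comNzRingType) (M : lmodType R).

Lemma sym_pi_eq0 p : (sym_pi p == 0 :> Sym M) = (p \in sym_ideal M).
Proof. exact: pi_eq0. Qed.

Lemma sym_varD (x y : M) : sym_pi (var (x + y)) = sym_pi (var x) + sym_pi (var y).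
Proof.
apply/eqP; rewrite -subr_eq0 opprD addrA -!rmorphB sym_pi_eq0.
by apply/sym_idealP/ideal_genP; left; exists x, y.
Qed.

Lemma sym_varZ a (x : M) : sym_pi (var (a *: x)) = sym_pi a%:MP * sym_pi (var x).
Proof.
apply/eqP; rewrite -subr_eq0 -rmorphM -rmorphB sym_pi_eq0.
by apply/sym_idealP/ideal_genP; right; exists a, x.
Qed.

Lemma sym_var_sum (T : Type) (r : seq T) (a : T -> R) (x : T -> M) :
  sym_pi (var (\sum_(i <- r) a i *: x i)) =
  \sum_(i <- r) sym_pi (a i)%:MP * sym_pi (var (x i)).
Proof.
elim: r => [|i r IH]; last by rewrite !big_cons /= sym_varD sym_varZ IH.
rewrite !big_nil; have := sym_varZ 0 0.
by rewrite scaler0 malgC0E rmorph0 mul0r.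
Qed.

Lemma rees_C_gcomp r : rees_grading M 0%N (rees_C M r).
Proof.
exists (sym_pi r%:MP) => //; exists r%:MP => //.
by apply: malg_gcompU; exact: mdeg1.
Qed.

(** The algebra is generated over R by the classes of the generators of M. *)
Lemma noetherian_rees : noetherian R -> fin_gen M -> noetherian (Rees M).
Proof.
move=> nR /fin_genE[k [g hg]].
apply: (@noetherian_generated R _ (rees_C M)
  [seq rees_pi (sym_pi (var (g i))) | i <- iota 0 k] nR).
move=> C CC Cg CD CM y; have [z ->] := rees_piP y; have [p ->] := sym_piP z.
elim/malg_ind: p => [c|x|p q hp hq|p q hp hq].
- exact: CC.
- rewrite -varE; have [c ->] := hg x; rewrite sym_var_sum rmorph_sum.
  apply: (big_ind C) => // [|i _].
    by rewrite -[0](rmorph0 (rees_C M)); exact: CC.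
  rewrite rmorphM; apply: CM; first exact: CC.
  by apply/Cg/map_f; rewrite mem_iota add0n ltn_ord.
- by rewrite !rmorphD; exact: CD.
- by rewrite !rmorphM; exact: CM.
Qed.

Lemma rees_pi_eq0 (z : Sym M) : rees_pi z = 0 <->
  forall (F : lmodType R) (g : {linear M -> F}), free_module F -> sym_map g z = 0.
Proof.
have e : (rees_pi z == 0) = (z \in rees_ideal M) by exact: pi_eq0.
by split=> [/eqP|h]; [rewrite e => /asboolP | apply/eqP; rewrite e; apply/asboolP].
Qed.

End ReesAlgebra.

Section ReesMapMorphism.
Variables (R : comNzRingType) (M N : lmodType R) (g : {linear M -> N}).

Lemma rees_map_zmod_morphism : zmod_morphism (rees_map g).
Proof.
move=> x y; have [p ->] := rees_piP x; have [q ->] := rees_piP y.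
by rewrite -rmorphB !rees_map_pi !rmorphB.
Qed.

Lemma rees_map_monoid_morphism : monoid_morphism (rees_map g).
Proof.
split=> [|x y]; first by rewrite -(rmorph1 (@rees_pi R M)) rees_map_pi !rmorph1.
have [p ->] := rees_piP x; have [q ->] := rees_piP y.
by rewrite -rmorphM !rees_map_pi !rmorphM.
Qed.

HB.instance Definition _ := GRing.isZmodMorphism.Build (Rees M) (Rees N)
  (rees_map g) rees_map_zmod_morphism.
HB.instance Definition _ := GRing.isMonoidMorphism.Build (Rees M) (Rees N)
  (rees_map g) rees_map_monoid_morphism.

Lemma rees_map_gcomp n x : rees_grading M n x -> rees_grading N n (rees_map g x).
Proof.
case=> p Sp <-; exists (sym_map g p); first exact: sym_map_gcomp.
exact: (esym (rees_map_pi g p)).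
Qed.

Lemma rees_map_C r : rees_map g (rees_C M r) = rees_C N r.
Proof. by rewrite /rees_C /= rees_map_pi sym_map_pi malg_mapC. Qed.

End ReesMapMorphism.

(** * The kernel of the map of Rees algebras *)

Section KernelNilpotent.
Variables (R : comNzRingType) (M N : lmodType R) (iota : {linear M -> N}).
Local Notation phi := (rees_map iota).

Lemma rV_free (A : comNzRingType) q : free_module 'rV[A]_q.
Proof.
exists [set v | exists i, v = delta_mx 0 i]; split=> [v|s c us sB e b bs].
  exists [seq delta_mx 0 i | i <- enum 'I_q], (fun b => (b *m v^T) 0 0); split.
    by move=> b /mapP[i _ ->]; exists i.
  rewrite big_map big_enum [v in LHS]row_sum_delta; apply: eq_bigr => i _.
  by congr (_ *: _); rewrite -rowE !mxE.
have [i bi] := sB b bs.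
have := congr1 (fun w : 'rV_q => w 0 i) e; rewrite summxE (bigD1_seq b) //= mxE.
rewrite {2}bi !mxE !eqxx mulr1 big_seq_cond big1 ?addr0 // => b' /andP[/sB[j ->] nb].
rewrite !mxE eqxx /=; case: eqP => [ij|_]; last by rewrite mulr0.
by case/eqP: nb; rewrite bi ij.
Qed.

(** The forms h j define a map from N to a free module of rank q, under which p becomes zero in
    the symmetric algebra; then specialize the basis vectors to the s j. *)
Lemma rees_map_kernel_eval (S : comNzRingType) (f : {rmorphism R -> S}) q
  (h : 'I_q -> N -> R) (s : 'I_q -> S) p :
  phi (rees_pi (sym_pi p)) = 0 -> (forall j, linear_form (h j)) ->
  eval f (fun x => \sum_j f (h j (iota x)) * s j) p = 0.
Proof.
move=> p0 lh; pose H0 v : 'rV[R]_q := \row_j h j v.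
have linH : linear H0.
  by move=> a u v; apply/rowP => j; rewrite !mxE lh.
pose H : {linear N -> 'rV[R]_q} := HB.pack H0 (GRing.isLinear.Build _ _ _ _ H0 linH).
move: p0; rewrite rees_map_pi => /rees_pi_eq0/(_ _ H (@rV_free R q)).
rewrite !sym_map_pi malg_map_comp => /eqP; rewrite sym_pi_eq0 => /sym_idealP.
pose lam (w : 'rV[R]_q) : S := \sum_j f (w 0 j) * s j.
have evar w : eval f lam (var w) = lam w by rewrite [var w]varE evalX.
have kill z : ideal_gen (@sym_rel R 'rV[R]_q) z -> eval f lam z = 0.
  apply: (ideal_gen_sub (eval_kernel_ideal f lam)) => {}z [[x [y ->]]|[a [x ->]]] /=.
    rewrite (evalB f lam (var (x + y) - var x)) (evalB f lam (var (x + y))) !evar /lam -!sumrB big1 // => j _.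
    by rewrite mxE rmorphD; ring.
  rewrite (evalB f lam (var (a *: x))) (evalM f lam a%:MP) evalC !evar /lam mulr_sumr -sumrB big1 // => j _.
  by rewrite mxE rmorphM; ring.
move/kill => e; rewrite -[RHS]e.
have := malg_hom_ext (f := eval f (fun x => \sum_j f (h j (iota x)) * s j))
  (g := eval f lam \o malg_map (H \o iota)); apply=> [c|x] /=.
  by rewrite malg_mapC !evalC.
rewrite -varE malg_map_var !varE !evalX /lam.
by apply: eq_bigr => j _; rewrite mxE.
Qed.

(** Apply [elimination] to the values of forms at generators of M.  A vector w orthogonal
    modulo eta to all forms coming from N is an element of M at which, by the separation
    hypothesis, g vanishes modulo eta. *)
Lemma approximate_form eta (g : M -> R) : fin_gen M -> prime_ideal eta ->
  (forall g x, linear_form g -> ~ eta (g x) ->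
     exists2 h : N -> R, linear_form h & ~ eta (h (iota x))) ->
  linear_form g ->
  exists d (h : N -> R), [/\ ~ eta d, linear_form h &
    forall x, eta (d * g x - h (iota x))].
Proof.
move=> /fin_genE[k [m gen]] he sep lg; have hei := prime_ideal_ideal he.
pose U := [set u : nat -> R | exists2 h : N -> R, linear_form h &
   u = fun i => h (iota (m i))].
have [|a a' u u' [h lh ->] [h' lh' ->]|w hw|d [_ [ed [h lh ->] dh]]] :=
    @elimination R eta he k U (fun i => g (m i)).
- by exists (fun=> 0) => // a u v; rewrite mulr0 addr0.
- exists (fun v => a * h v + a' * h' v) => // c y z; rewrite lh lh'; ring.
- have e (l : M -> R) : linear_form l ->
      \sum_(i < k) l (m i) * w i = l (\sum_(i < k) w i *: m i).
    by move=> ll; rewrite (linear_form_sum ll); apply: eq_bigr => i _; rewrite mulrC.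
  rewrite e //; apply: contrapT => /sep[//|h lh]; apply.
  have lhi : linear_form (fun x => h (iota x)) by move=> a u v; rewrite linearP lh.
  by rewrite -(e _ lhi); apply: (hw (fun i => h (iota (m i)))); exists h.
exists d, h; split=> // x; have [c ->] := gen x.
have lhi : linear_form (fun x => h (iota x)) by move=> a u v; rewrite linearP lh.
rewrite (linear_form_sum lg) (linear_form_sum lhi) mulr_sumr -sumrB.
apply: ideal_sum => // i _; rewrite mulrCA -mulrBr; apply: ideal_mull => //.
exact: dh.
Qed.

Lemma approximate_forms eta q (g : 'I_q -> M -> R) : fin_gen M -> prime_ideal eta ->
  (forall g x, linear_form g -> ~ eta (g x) ->
     exists2 h : N -> R, linear_form h & ~ eta (h (iota x))) ->
  (forall j, linear_form (g j)) ->
  exists d (h : 'I_q -> N -> R), [/\ ~ eta d, forall j, linear_form (h j) &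
    forall j x, eta (d * g j x - h j (iota x))].
Proof.
move=> fgM he sep lg; have hei := prime_ideal_ideal he.
have /choice[z hz] j : exists z : R * (N -> R), [/\ ~ eta z.1, linear_form z.2 &
    forall x, eta (z.1 * g j x - z.2 (iota x))].
  by have [d [h hh]] := approximate_form fgM he sep (lg j); exists (d, h).
exists (\prod_j (z j).1), (fun j v => (\prod_(i | i != j) (z i).1) * (z j).2 v); split.
- by apply: prime_prod => // j; have [] := hz j.
- by move=> j a u v; have [_ -> _] := hz j; ring.
move=> j x; rewrite (bigD1 j) //= mulrAC mulrC -mulrBr; apply: ideal_mull => //.
by have [_ _] := hz j; apply.
Qed.

Hypothesis separation : forall eta, minimal_prime eta ->
  forall (g : M -> R) x, linear_form g -> ~ eta (g x) ->
     exists2 h : N -> R, linear_form h & ~ eta (h (iota x)).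

Lemma free_module_finite_coordinates (F : lmodType R) (g : {linear M -> F}) :
  fin_gen M -> free_module F ->
  exists q (e : 'I_q -> F) (c : 'I_q -> M -> R),
    (forall j, linear_form (c j)) /\ forall x, g x = \sum_j c j x *: e j.
Proof.
move=> /fin_genE[k [m gen]] /free_module_coordinates[c [lc hc]].
have /choice[s hs] := hc.
pose t := undup (flatten [seq s (g (m i)) | i <- seq.iota 0 k]).
have ut : uniq t by apply: undup_uniq.
exists (size t), (fun j => t`_j), (fun j x => c (t`_j) (g x)).
split=> [j a u v|x]; first by rewrite linearP lc.
have gm i : (i < k)%N -> g (m i) = \sum_(b <- t) c b (g (m i)) *: b.
  move=> ik; apply: hs => // b bs; rewrite mem_undup; apply/flattenP.
  by exists (s (g (m i))) => //; apply: map_f; rewrite mem_iota.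
transitivity (\sum_(b <- t) c b (g x) *: b); last by rewrite (big_nth 0) big_mkord.
have [r ->] := gen x; rewrite linear_sum /=.
transitivity (\sum_(i < k) \sum_(b <- t) (r i * c b (g (m i))) *: b).
  apply: eq_bigr => i _; rewrite linearZ /= {1}gm // scaler_sumr.
  by apply: eq_bigr => b _; rewrite scalerA.
rewrite exchange_big /=; apply: eq_bigr => b _; rewrite -scaler_suml; congr (_ *: _).
under [in RHS]eq_bigr do rewrite linearZ.
by rewrite (linear_form_sum (lc b)).
Qed.

(** For any g from M to a free module, the image of x under g is the value at basis vectors of
    a polynomial Y over R.  For eta minimal, d^n Y is, modulo eta,
    the evaluation of x at forms extending to N, which is zero; hence Y has all its
    coefficients in eta.  The exponent that kills the nilradical of R works for all g. *)
Theorem rees_map_kernel_nilpotent n x : noetherian R -> fin_gen M ->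
  rees_grading M n x -> phi x = 0 -> exists k, x ^+ k = 0.
Proof.
move=> nR fgM [_ [p Sp <-] <-] x0.
have {}x0 : phi (rees_pi (sym_pi p)) = 0 by [].
have [k nilk] := nil_nilpotent nR; exists k.
rewrite -!rmorphXn; apply/rees_pi_eq0 => F g fF.
have [q [e [c [lc gc]]]] := free_module_finite_coordinates g fgM fF.
pose T := {malg R[{cmonom 'I_q}]}; pose C : {rmorphism R -> T} := @malgC {cmonom 'I_q} R.
pose lam (v : M) : T := \sum_j C (c j v) * << ucm j >>.
pose sC : {rmorphism R -> Sym F} := @sym_pi R F \o @malgC {cmonom F} R.
pose ev : {rmorphism T -> Sym F} := eval sC (fun j => sym_pi (var (e j))).
have factor z : sym_pi (malg_map g z) = ev (eval C lam z).
  apply: (malg_hom_ext (f := @sym_pi R F \o malg_map g) (g := ev \o eval C lam)) => [a|y].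
    rewrite /= malg_mapC; transitivity (ev (C a)); last by congr (ev _); rewrite evalC.
    exact: (esym (evalC sC _ a)).
  rewrite /= -varE malg_map_var gc sym_var_sum varE evalX rmorph_sum.
  apply: eq_bigr => j _; rewrite rmorphM.
  by congr (_ * _); [exact: (esym (evalC sC _ _)) | symmetry; exact: evalX].
rewrite sym_map_pi factor rmorphXn /= (nilpotent_coefs (n := k)) ?rmorph0 //.
move=> eta min_eta; have he : prime_ideal eta by case: min_eta.
have [d [h [ed lh dh]]] := approximate_forms fgM he (separation min_eta) lc.
have E1 := rees_map_kernel_eval C (fun j => << ucm j >>) x0 lh.
have hJ := coefs_in_ideal 'I_q (prime_ideal_ideal he).
have dc v : coefs_in eta (C d * lam v - \sum_j C (h j (iota v)) * << ucm j >>).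
  rewrite /lam scaled_combinationB; apply: ideal_sum => // j _.
  apply: (ideal_mulr << ucm j >> hJ) => l; rewrite mcoeffC -mulr_natr.
  exact: (ideal_mulr _ (prime_ideal_ideal he) (dh j v)).
have E2 := eval_congr C hJ dc p.
rewrite E1 subr0 (eval_scale C lam (C d) Sp) in E2.
move=> l; have := E2 l; rewrite -rmorphXn mcoeffCM => /(primeM he)[/(primeX he)|//].
by [].
Qed.

End KernelNilpotent.

(** * Integrality and chains of primes in graded algebras *)

Section GradedMorphism.
Variables (A B : comPzRingType) (SA : grading A) (SB : grading B).
Variable f : {rmorphism A -> B}.
Hypothesis f_gcomp : forall n x, SA n x -> SB n (f x).

Lemma component_morph x n : f (component SA x n) = component SB (f x) n.
Proof.
have [l nl e] := component_sum SA x n.+1.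
rewrite [in RHS]e rmorph_sum (component_of_sum (S := SB) (f := fun j => f (component SA x j))) //.
by move=> j; apply/f_gcomp/component_gcomp.
Qed.

Lemma homogeneous_preim Q : ideal Q -> homogeneous SB Q -> homogeneous SA (f @^-1` Q).
Proof.
move=> hQ homQ; apply: homogeneous_of_components => x n Qx /=.
by rewrite component_morph; apply: homogeneousP.
Qed.

Lemma mult_set_image W : mult_set W -> mult_set (f @` W).
Proof.
move=> [W1 WM]; split; first by exists 1; rewrite ?rmorph1.
by move=> _ _ [x Wx <-] [y Wy <-]; exists (x * y); [exact: WM | rewrite rmorphM].
Qed.

End GradedMorphism.

Section LocalRing.
Variables (R : comPzRingType) (m : set R).
Hypotheses (nR : noetherian R) (Rm : is_local_with m).

Lemma local_unit r : ~ m r -> exists s, s * r = 1.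
Proof.
case: Rm => _ uniq mr; apply: contrapT => nu.
have p1 : ~ principal r 1 by move=> [s e]; apply: nu; exists s.
pose F := [set I | [/\ ideal I, principal r `<=` I & ~ I 1]].
have [||I [hI rI I1] maxI] := @noetherian_max R nR F.
- by exists (principal r); split=> //; exact: principal_ideal.
- by move=> J [].
apply: mr; rewrite -(uniq I); first by apply: rI; exists 1; rewrite mul1r.
split=> // J hJ J1 IJ; apply: maxI => //; split=> // x /rI; exact: IJ.
Qed.

Lemma local_prime : prime_ideal m.
Proof.
case: Rm => -[hm m1 _] _; split=> // x y mxy; apply: contrapT => /not_orP[mx my].
have [x' ex] := local_unit mx; have [y' ey] := local_unit my.
apply: m1; have -> : 1 = x' * y' * (x * y) by rewrite mulrACA ex ey mulr1.
exact: ideal_mull.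
Qed.

End LocalRing.

Section GradedAlgebras.
Variables (R A B : comPzRingType) (SA : grading A) (SB : grading B).
Variables (cA : {rmorphism R -> A}) (cB : {rmorphism R -> B}) (phi : {rmorphism A -> B}).
Hypotheses (cA_gcomp : forall r, SA 0%N (cA r)) (phi_C : forall r, phi (cA r) = cB r).
Hypothesis phi_gcomp : forall n x, SA n x -> SB n (phi x).
Variable m : set R.
Hypotheses (nR : noetherian R) (Rm : is_local_with m).

Let cB_gcomp r : SB 0%N (cB r).
Proof. by rewrite -phi_C; exact: phi_gcomp. Qed.

Definition graded_image n : set B := phi @` SA n.

(** The argument uses Rees algebras only as graded R-algebras, so the closure is phrased for
    any morphism of these. *)
Definition graded_integral_closure n : set B :=
  [set y | SB n y /\ exists (u : nat) (c : nat -> B),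
     [/\ (0 < u)%N, forall i, (1 <= i <= u)%N -> graded_image (n * i) (c i) &
         y ^+ u + \sum_(1 <= i < u.+1) c i * y ^+ (u - i) = 0]].

Lemma graded_imageZ n a x : graded_image n x -> graded_image n (cB a * x).
Proof.
move=> [y Sy <-]; exists (cA a * y).
  by have := gradingM (cA_gcomp a) Sy.
by rewrite rmorphM /= phi_C.
Qed.

Lemma graded_imageD n x y : graded_image n x -> graded_image n y ->
  graded_image n (x + y).
Proof.
move=> [x' Sx <-] [y' Sy <-]; exists (x' + y'); first exact: gradingD.
by rewrite rmorphD.
Qed.

Lemma graded_image0 n : graded_image n 0.
Proof. by exists 0; [exact: grading0 | rewrite rmorph0]. Qed.

Lemma graded_image_integral n x : graded_image n x -> graded_integral_closure n x.
Proof.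
move=> hx; split; first by case: hx => y Sy <-; exact: phi_gcomp.
exists 1%N, (fun=> - x); split=> // [i|].
  rewrite -eqn_leq => /eqP <-; rewrite muln1 -mulN1r -(rmorphN1 cB).
  exact: graded_imageZ.
by rewrite big_nat1 expr1 subnn expr0 mulr1 subrr.
Qed.

Lemma graded_integral_closureZ n a x : graded_integral_closure n x ->
  graded_integral_closure n (cB a * x).
Proof.
move=> [Sx [u [c [u0 hc e]]]]; split.
  by have := gradingM (cB_gcomp a) Sx.
exists u, (fun i => cB (a ^+ i) * c i); split=> // [i iu|].
  exact/graded_imageZ/hc.
rewrite -[RHS](mulr0 (cB a ^+ u)) -[in RHS]e mulrDr exprMn; congr (_ + _).
rewrite mulr_sumr; apply: eq_big_nat => i /andP[_]; rewrite ltnS => iu.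
by rewrite -{2}(subnKC iu) rmorphXn /= exprMn exprD; ring.
Qed.

(** Among the multiples y of x that are not integral, take one whose conductor L y into the
    image is maximal.  If some s in m sent y outside the closure, s y would have the same
    conductor, so a power of s in L y could be lowered to 1, putting y itself in the
    image.  So the annihilator of y modulo the closure is m, against the hypothesis. *)
Lemma torsion_integral n x : (0 < n)%N ->
  ~ (exists2 y, SB n y & m = [set r | graded_integral_closure n (cB r * y)]) -> SB n x ->
  (forall s, m s -> exists i, graded_image n (cB (s ^+ i) * x)) ->
  graded_integral_closure n x.
Proof.
move=> n0 hAss Sx hx; apply: contrapT => nx.
pose L y := [set s | graded_image n (cB s * y)].
pose F := [set I | exists2 c, ~ graded_integral_closure n (cB c * x) &
                     I = L (cB c * x)].
have L_ideal y : ideal (L y).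
  split=> [|a b La Lb|a b Lb]; rewrite /L /=.
  - by rewrite rmorph0 mul0r; exact: graded_image0.
  - by rewrite rmorphD mulrDl; exact: graded_imageD.
  - by rewrite rmorphM -mulrA; exact: graded_imageZ.
have [||_ [c nc ->] maxc] := @noetherian_max R nR F.
- by exists (L (cB 1 * x)), 1 => //; rewrite rmorph1 mul1r.
- by move=> _ [c _ ->].
set y := cB c * x in nc maxc.
have my s : m s -> graded_integral_closure n (cB s * y).
  move=> ms; apply: contrapT => nsy.
  (* s y is again a multiple of x, so the maximality of L y applies to it. *)
  have sub : L (cB s * y) `<=` L y.
    apply: maxc.
      by exists (s * c); rewrite rmorphM -mulrA.
    by move=> a La; rewrite /L /= mulrCA; exact: graded_imageZ.
  have [i hi] := hx s ms.
  have : L y (s ^+ i) by rewrite /L /= /y mulrCA; exact: graded_imageZ.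
  elim: (i) => [|j IH] hj.
    by apply/nc/graded_image_integral; have := hj; rewrite /L /= expr0 rmorph1 mul1r.
  by apply/IH/sub; have := hj; rewrite /L /= exprSr rmorphM -mulrA.
apply: hAss; exists y; first by have := gradingM (cB_gcomp c) Sx.
apply/seteqP; split=> [s /my//|s hs]; apply: contrapT => ms.
have [s' e] := local_unit nR Rm ms; apply: nc.
have := graded_integral_closureZ s' hs.
by rewrite mulrA -rmorphM e rmorph1 mul1r.
Qed.

Hypotheses (nA : noetherian A) (nB : noetherian B).
Hypothesis kernel_nilpotent : forall n x, SA n x -> phi x = 0 -> exists k, x ^+ k = 0.
Hypothesis B_chains : forall Q, minimal_fiber_point SB cB m Q -> two_step_chain SB Q.
Hypothesis hAss : forall n, (0 < n)%N ->
  ~ exists2 y, SB n y & m = [set r | graded_integral_closure n (cB r * y)].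

Let hm : maximal_ideal m. Proof. by case: Rm. Qed.

Variable P : set A.
Hypothesis P_min : minimal_fiber_point SA cA m P.
Hypothesis no_chain : forall P0 P1 : set A, prime_ideal P0 -> prime_ideal P1 ->
  homogeneous SA P0 -> homogeneous SA P1 -> P0 `<` P1 -> P1 `<=` P -> P `<=` P1.

Let XP : Proj SA P. Proof. by case: P_min => -[]. Qed.
Let hP : prime_ideal P. Proof. by case: XP. Qed.
Let homP : homogeneous SA P. Proof. by case: XP. Qed.
Let mP r : m r -> P (cA r).
Proof. by case: P_min => -[_ h] _; exact: h. Qed.

Local Notation T := (hom_denoms SA P).

Let T1 : T 1.
Proof. by split; [exists 0%N; exact: grading1 | exact: prime1]. Qed.

Let TM x y : T x -> T y -> T (x * y).
Proof.
move=> [[i Sx] Px] [[j Sy] Py]; split; last exact: primeMn.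
by exists (i + j)%N; exact: gradingM.
Qed.

(** Q defines a prime of the localization of B at the image of T. *)
Definition avoids (Q : set B) : Prop := forall t, T t -> ~ Q (phi t).

Let hBi (Q : set B) : prime_ideal Q -> ideal Q := @prime_ideal_ideal B Q.

Lemma avoids_relevant (Q : set B) : prime_ideal Q -> homogeneous SB Q -> avoids Q ->
  Proj SB Q.
Proof.
move=> hQ homQ avQ; split=> //; have [_ _ [n [x [n0 Sx Px]]]] := XP.
by exists n, (phi x); split=> //; [exact: phi_gcomp | apply: avQ; split=> //; exists n].
Qed.

Lemma minimal_prime_homog (Q : set B) : minimal_prime Q -> homogeneous SB Q.
Proof.
by apply: minimal_prime_homogeneous; [exact: zero_ideal | exact: homogeneous0].
Qed.

(** A minimal prime Q of B that avoids T and contains m is a point of the fiber, minimal in it,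
    and has no chain below it. *)
Lemma avoiding_element : exists2 r, m r & forall Q : set B, minimal_prime Q ->
  avoids Q -> ~ Q (cB r).
Proof.
have notin Q : minimal_prime Q -> avoids Q -> ~ m `<=` [set r | Q (cB r)].
  move=> minQ avQ mQ; have [hQ _ Qmin] := minQ.
  have XQ := avoids_relevant hQ (minimal_prime_homog minQ) avQ.
  have belowQ P' : prime_ideal P' -> P' `<=` Q -> Q `<=` P'.
    by move=> h; apply: Qmin => //; apply: zero_sub; exact: hBi.
  have [|Q0 [Q1 [Q2 [[h0 h1 _] _ [s01 n01] [s12 n12] Q2Q]]]] := B_chains (Q := Q).
    split; first by split.
    by move=> Q' [XQ' _]; apply: belowQ; case: XQ'.
  have Q1Q : Q1 `<=` Q by move=> x /s12 /Q2Q.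
  apply: n01 => x /Q1Q; apply: belowQ => // y /s01; exact: Q1Q.
have [n [q hq]] := minimal_primes_finite nB (@zero_ideal B).
have cover Q : minimal_prime Q -> exists i, Q = q i.
  move=> minQ; case: (minQ) => hQ Q0 Qmin.
  have [i [[hqi qi0 _] qiQ]] := hq Q hQ Q0; exists i; apply/seteqP; split=> //.
  exact: Qmin.
(* Only minimal primes avoiding T matter; the others are replaced by one of these. *)
pose good i := minimal_prime (q i) /\ avoids (q i).
have [[i0 gi0]|none] := pselect (exists i, good i); last first.
  exists 0; first by case: hm => /ideal0.
  by move=> Q minQ avQ _; apply: none; have [i e] := cover Q minQ; exists i; rewrite /good -e.
pose q' i := if `[< good i >] then q i else q i0.
have gq' i : minimal_prime (q' i) /\ avoids (q' i).
  by rewrite /q'; case: asboolP.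
have [|i|i|r mr hr] := @prime_avoidance R n (fun i => [set r | q' i (cB r)]) m.
- by case: hm.
- have [[hqi _ _] _] := gq' i; exact: (prime_preim cB hqi).
- by have [mi ai] := gq' i; exact: notin.
exists r => // Q minQ avQ; have [i e] := cover Q minQ.
by have := hr i; rewrite /q' asboolT ?e // /good -e.
Qed.

(** Compare H with the trace of Q0, which is strictly smaller because r is not in Q0. *)
Lemma avoids_chain (Q0 : set B) (H : set A) r : minimal_prime Q0 -> avoids Q0 ->
  ~ Q0 (cB r) -> prime_ideal H -> homogeneous SA H -> H (cA r) ->
  phi @^-1` Q0 `<=` H -> H `<=` P -> P `<=` H.
Proof.
move=> min0 av0 nr hH homH Hr sub HP; have [h0 _ _] := min0.
apply: (@no_chain (phi @^-1` Q0)) => //.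
- exact: prime_preim.
- by apply: (homogeneous_preim phi_gcomp); [exact: hBi | exact: minimal_prime_homog].
- by split=> // /(_ _ Hr); rewrite /= phi_C.
Qed.

Section AvoidingElement.
Variable r : R.
Hypothesis mr : m r.
Hypothesis r_avoid : forall Q : set B, minimal_prime Q -> avoids Q -> ~ Q (cB r).

Lemma no_avoiding_prime (Q' : set B) : prime_ideal Q' -> Q' (cB r) -> ~ avoids Q'.
Proof.
move=> hQ' Q'r avQ'.
have rQ' : principal (cB r) `<=` Q'.
  by move=> _ [a ->]; apply: ideal_mull => //; exact: hBi.
have [Q minQ QQ'] :=
  minimal_prime_over_exists nB (principal_ideal (cB r)) hQ' rQ'.
have [hQ rQ Qmin] := minQ.
have Qr : Q (cB r) by apply: rQ; exists 1; rewrite mul1r.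
have homQ : homogeneous SB Q.
  apply: minimal_prime_homogeneous minQ; first exact: principal_ideal.
  exact: homogeneous_principal (cB_gcomp r).
have avQ : avoids Q by move=> t Tt /QQ'; exact: avQ'.
have [Q0 min0 Q0Q] := minimal_prime_over_exists nB (@zero_ideal B) hQ (zero_sub (hBi hQ)).
have av0 : avoids Q0 by move=> t Tt /Q0Q; exact: avQ.
have hpre : prime_ideal (phi @^-1` Q) by exact: prime_preim.
have hompre : homogeneous SA (phi @^-1` Q).
  by apply: (homogeneous_preim phi_gcomp) => //; exact: hBi.
have preP : phi @^-1` Q `<=` P.
  apply: (homogeneous_sub _ _ hompre); try exact: prime_ideal_ideal.
  by move=> n x Sx Qx; apply: contrapT => Px; apply: (avQ x) => //; split=> //; exists n.
have Ppre : P `<=` phi @^-1` Q.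
  apply: (avoids_chain min0 av0 (r_avoid min0 av0)) => //; first by rewrite /= phi_C.
  by move=> x /Q0Q.
have fQ : fiber_points SB cB m Q.
  split; first exact: avoids_relevant.
  by move=> s /mP/Ppre; rewrite /= phi_C.
have [|P0 [P1 [P2 [[h0 h1 _] _ [s01 n01] [s12 n12] P2Q]]]] := B_chains (Q := Q).
  split=> // Q'' [[hQ'' _ _] mQ''] Q''Q.
  by apply: Qmin => // _ [a ->]; apply: ideal_mull; [exact: hBi | exact: mQ''].
apply: n01; apply: (krull_principal_ideal nB minQ) => //.
- by move=> x /s12 /P2Q.
- by move=> QP1; apply: n12 => x /P2Q /QP1.
Qed.

(** Otherwise a prime contains r A + ker phi and misses T and the powers of s.  Its homogeneous
    core H is strictly between P and the trace of a minimal prime of B, which exists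
    because ker phi lies in H. *)
Lemma local_radical s : m s -> exists i t a,
  T t /\ phi (cA s ^+ i * t) = cB r * phi a.
Proof.
move=> ms; apply: contrapT => h.
pose I := [set z : A | exists a, phi z = cB r * phi a].
have hI : ideal I.
  split=> [|x y [a ea] [b eb]|x y [b eb]].
  - by exists 0; rewrite !rmorph0 mulr0.
  - by exists (a + b); rewrite !rmorphD ea eb mulrDr.
  - by exists (x * b); rewrite !rmorphM eb mulrCA.
pose W := [set w : A | exists i t, T t /\ w = cA s ^+ i * t].
have hW : mult_set W.
  split; first by exists 0%N, 1; rewrite mul1r.
  move=> _ _ [i [t [Tt ->]]] [j [u [Tu ->]]]; exists (i + j)%N, (t * u).
  by split; [exact: TM | rewrite exprD mulrACA].
have IW z : I z -> ~ W z.
  by move=> [a e] [i [t [Tt ez]]]; apply: h; exists i, t, a; split=> //; rewrite -ez.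
have [P1 [hP1 IP1 P1W]] := prime_avoiding nA hI hW IW.
have [hH homH] := hcore_prime SA hP1; set H := hcore SA P1 in hH homH.
have HP1 : H `<=` P1 by apply: hcore_sub; exact: prime_ideal_ideal.
(* The powers of s include the zeroth, so W contains T. *)
have TH t : T t -> ~ H t.
  by move=> Tt /HP1/P1W; apply; exists 0%N, t; rewrite mul1r.
have HP : H `<=` P.
  apply: (homogeneous_sub _ _ homH); try exact: prime_ideal_ideal.
  by move=> n x Sx Hx; apply: contrapT => Px; apply: (TH x) => //; split=> //; exists n.
have Hr : H (cA r).
  apply: mem_hcore (cA_gcomp r) _; first exact: prime_ideal_ideal.
  by apply: IP1; exists 1; rewrite rmorph1 mulr1 phi_C.
have kerH x : phi x = 0 -> H x.
  move=> x0 n; apply: IP1; exists 0.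
  by rewrite (component_morph phi_gcomp) x0 component0 rmorph0 mulr0.
have [||Q' [hQ' _ Q'H]] := prime_avoiding nB (@zero_ideal B) (W := phi @` (~` H)).
- exact/mult_set_image/prime_mult_set.
- by move=> _ -> [x Hx /kerH].
(* The trace of Q' on A lies in H, and so does that of a minimal prime below Q'. *)
have [Q0 min0 Q0Q'] := minimal_prime_over_exists nB (@zero_ideal B) hQ' (zero_sub (hBi hQ')).
have av0 : avoids Q0.
  by move=> t Tt /Q0Q'/Q'H; apply; exists t => //; exact: TH.
suff : P `<=` H.
  move/(_ _ (mP ms))/HP1/P1W; apply; exists 1%N, 1; split=> //.
  by rewrite expr1 mulr1.
apply: (avoids_chain min0 av0 (r_avoid min0 av0)) => //.
by move=> x /Q0Q'/Q'H Hx; apply: contrapT => nHx; apply: Hx; exists x.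
Qed.

(** The elements s of R for which some multiplier exists form a finitely generated ideal, so the
    product of the multipliers of its generators serves them all. *)
Lemma uniform_multiplier : exists n t, [/\ SA n t, ~ P t &
  forall s, m s -> exists i a, SA n a /\
    cB (s ^+ i) * phi t = cB r * phi a].
Proof.
pose J := [set s | exists t a, T t /\ phi (cA s * t) = cB r * phi a].
have hJ : ideal J.
  split=> [|x y [t [a [Tt ea]]] [u [b [Tu eb]]]|x y [u [b [Tu eb]]]].
  - by exists 1, 0; split=> //; rewrite !rmorph0 mul0r rmorph0 mulr0.
  - exists (t * u), (u * a + t * b); split; first exact: TM.
    transitivity (phi u * phi (cA x * t) + phi t * phi (cA y * u)).
      by rewrite rmorphD mulrDl rmorphD !rmorphM; ring.
    by rewrite ea eb rmorphD !rmorphM; ring.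
  - exists u, (cA x * b); split=> //.
    by rewrite (rmorphM cA) -mulrA [LHS](rmorphM phi) eb (rmorphM phi) mulrCA.
have [t Tt Jt] : exists2 t, T t & forall s, J s ->
    exists a, phi (cA s * t) = cB r * phi a.
  have [l el] := nR hJ.
  have [t Tt lt] : exists2 t, T t & forall s, s \in l ->
      exists a, phi (cA s * t) = cB r * phi a.
    have : forall s, s \in l -> J s by move=> s sl; rewrite el; exact: ideal_genP.
    elim: (l) => [|s l' IH] hl; first by exists 1.
    have [|t Tt ht] := IH; first by move=> y yl; apply: hl; rewrite inE yl orbT.
    have [u [a [Tu eu]]] := hl s (mem_head _ _).
    exists (t * u) => [|y]; first exact: TM.
    rewrite inE => /orP[/eqP ->|/ht[b eb]].
      by exists (t * a); rewrite mulrCA [LHS](rmorphM phi) eu (rmorphM phi) mulrCA.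
    by exists (b * u); rewrite mulrA [LHS](rmorphM phi) eb (rmorphM phi) mulrA.
  have hK : ideal [set s | exists a, phi (cA s * t) = cB r * phi a].
    split=> [|x y [a ea] [b eb]|x y [b eb]].
    - by exists 0; rewrite !rmorph0 mul0r rmorph0 mulr0.
    - by exists (a + b); rewrite (rmorphD cA) mulrDl !(rmorphD phi) ea eb mulrDr.
    - exists (cA x * b).
      by rewrite (rmorphM cA) -mulrA [LHS](rmorphM phi) eb (rmorphM phi) mulrCA.
  by exists t => // s; rewrite el => /(ideal_gen_sub hK lt).
have [[n St] Pt] := Tt; exists n, t; split=> // s ms.
have [i [u [a [Tu ea]]]] := local_radical ms.
have [|b eb] := Jt (s ^+ i); first by exists u, a; split=> //; rewrite rmorphXn.
exists i, (component SA b n); split; first exact: component_gcomp.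
have := congr1 (fun z => component SB z n) eb.
rewrite /= (component_mull _ _ (cB_gcomp r)) /= subn0 (component_morph phi_gcomp).
move=> <-; rewrite rmorphM phi_C component_id //.
by have := gradingM (cB_gcomp (s ^+ i)) (phi_gcomp St).
Qed.

Lemma avoiding_element_contradiction : False.
Proof.
have [t0 [T0 [e0 et0]]] : exists t, T t /\ exists e, phi t = cB r * e.
  apply: contrapT => h.
  have [||Q [hQ rQ QT]] := prime_avoiding nB (principal_ideal (cB r)) (W := phi @` T).
  - by apply: mult_set_image; split.
  - by move=> _ [e ->] [t Tt et]; apply: h; exists t; split=> //; exists e; rewrite mulrC.
  apply: (no_avoiding_prime hQ); first by apply: rQ; exists 1; rewrite mul1r.
  by move=> t Tt /QT; apply; exists t.
have [n [t [e [n0 St Pt Se et]]]] : exists n t e,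
    [/\ (0 < n)%N, SA n t, ~ P t, SB n e & phi t = cB r * e].
  have [_ _ [d [f [d0 Sf Pf]]]] := XP; have [[k S0] P0] := T0.
  have Stf : SA (k + d)%N (t0 * f) by apply: gradingM.
  (* The hypothesis on associated primes concerns positive degrees: multiply by f. *)
  exists (k + d)%N, (t0 * f), (component SB (e0 * phi f) (k + d)); split=> //.
  - by rewrite addn_gt0 d0 orbT.
  - exact: primeMn.
  - exact: component_gcomp.
  have := component_mull (e0 * phi f) (k + d) (cB_gcomp r).
  rewrite /= subn0 => <-; rewrite mulrA -et0 -rmorphM component_id //.
  exact: phi_gcomp.
have [n' [t' [St' Pt' ht']]] := uniform_multiplier.
pose d := (n' + n)%N; pose g := phi t' * e.
have d0 : (0 < d)%N by rewrite addn_gt0 n0 orbT.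
have Sg : SB d g by apply: gradingM => //; exact: phi_gcomp.
have rg : cB r * g = phi (t' * t) by rewrite /g mulrCA -et rmorphM.
have [_ [u [c [u0 hc eq]]]] : graded_integral_closure d g.
  apply: (torsion_integral d0 (hAss d0) Sg) => s ms.
  have [i [a [Sa ea]]] := ht' s ms; exists i, (a * t); first exact: gradingM.
  by rewrite (rmorphM phi) et /g [RHS]mulrA ea; ring.
have /choice[a ha] i : exists a, (1 <= i <= u)%N -> SA (d * i)%N a /\ phi a = c i.
  have [iu|iu] := boolP (1 <= i <= u)%N; last by exists 0.
  by have [a Sa ea] := hc i iu; exists a.
have St2 : SA d (t' * t) by apply: gradingM.
pose term i := cA r ^+ i * (a i * (t' * t) ^+ (u - i)).
pose z := (t' * t) ^+ u + \sum_(1 <= i < u.+1) term i.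
have Sterm i : (1 <= i < u.+1)%N -> SA (d * u)%N (term i).
  move=> iu; have [Sa _] := ha i iu; have iu' : (i <= u)%N by case/andP: iu.
  have := gradingM (gradingX i (cA_gcomp r)) (gradingM Sa (gradingX (u - i) St2)).
  by rewrite mul0n add0n -mulnDr subnKC.
have sum_in (C : set A) : C 0 -> (forall x y, C x -> C y -> C (x + y)) ->
    (forall i, (1 <= i < u.+1)%N -> C (term i)) -> C (\sum_(1 <= i < u.+1) term i).
  move=> C0 CD hC; rewrite big_nat_cond; apply: big_ind => // i.
  by rewrite andbT; exact: hC.
have Sz : SA (d * u)%N z.
  apply: gradingD; first exact: gradingX.
  by apply: sum_in => //; [exact: grading0 | move=> x y; exact: gradingD].
have z0 : phi z = 0.
  transitivity (cB r ^+ u * (g ^+ u + \sum_(1 <= i < u.+1) c i * g ^+ (u - i))).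
    rewrite rmorphD rmorphXn rmorph_sum mulrDr.
    rewrite -rg exprMn mulr_sumr; congr (_ + _); apply: eq_big_nat => i iu.
    have [_ <-] := ha i iu; have iu' : (i <= u)%N by case/andP: iu.
    rewrite /term rmorphM rmorphXn phi_C rmorphM rmorphXn -rg -{2}(subnKC iu').
    by rewrite exprMn exprD; ring.
  by rewrite eq mulr0.
have [k zk] := kernel_nilpotent Sz z0.
have Pz : P z.
  by apply: (primeX (n := k) hP); rewrite zk; apply: ideal0; exact: prime_ideal_ideal.
have hPi := prime_ideal_ideal hP.
have Psum : P (\sum_(1 <= i < u.+1) term i).
  apply: sum_in; [exact: ideal0 | by move=> x y; exact: idealD |].
  move=> [//|i] _; rewrite /term exprS -mulrA.
  by apply: ideal_mulr => //; exact: mP.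
apply: (primeMn hP Pt' Pt); apply: (primeX (n := u) hP).
rewrite -[_ ^+ u](addrK (\sum_(1 <= i < u.+1) term i)).
exact: idealB.
Qed.

End AvoidingElement.

Lemma chain_contradiction : False.
Proof.
by have [r mr hr] := avoiding_element; exact: (@avoiding_element_contradiction r).
Qed.

End GradedAlgebras.

(** * Descent of deficient analytic spread *)

Theorem corollary8p4 (R : comNzRingType) (x0 : set R)
    (M N : lmodType R) (iota : {linear M -> N})
    (R_noetherian : noetherian R)
    (R_local : is_local_with x0)
    (M_fg : fin_gen M) (N_fg : fin_gen N)
    (iota_inj : injective iota)
    (hMN :
      (forall (Z : set (set R)) (eta : set R),
          irreducible_component (Spec R) (Spec R) Z ->
          generic_point (Spec R) Z eta ->
          @free_module (loc (~` eta)) (locmod M (~` eta)) /\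
          @free_module (loc (~` eta)) (locmod N (~` eta)))
      \/
      (exists F : lmodType R, free_module F /\
         exists j : {linear N -> F}, injective j))
    (N_deficient : deficient_analytic_spread x0 N)
    (hAss : forall n, (0 < n)%N ->
        ~ Ass_quot (rees_grading N n) (integral_closure iota n) x0) :
  deficient_analytic_spread x0 M.
Proof.
have hm : maximal_ideal x0 by case: R_local.
have separation eta : minimal_prime eta -> forall (g : M -> R) x, linear_form g ->
    ~ eta (g x) -> exists2 h : N -> R, linear_form h & ~ eta (h (iota x)).
  move=> min_eta g x lg gx; case: hMN => [gfree|[F [fF [j j_inj]]]].
    have [comp gen] := minimal_prime_component min_eta.
    have [_ fN] := gfree _ _ comp gen.
    exact: (separation_generically_free R_noetherian min_eta iota_inj N_fg fN lg gx).
  exact: (separation_free R_noetherian min_eta iota_inj fF j_inj lg gx).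
apply/(deficient_analytic_spreadP M hm) => P minP; apply: contrapT => no.
have [[XP _] _] := minP; have [hP homP _] := XP.
apply: (@chain_contradiction R (Rees M) (Rees N) (rees_grading M) (rees_grading N)
  (rees_C M) (rees_C N) (rees_map iota) _ _ _ x0 R_noetherian R_local _ _ _ _ _ P minP).
- exact: rees_C_gcomp.
- exact: rees_map_C.
- by move=> n x; exact: rees_map_gcomp.
- exact: noetherian_rees.
- exact: noetherian_rees.
- by move=> n x; exact: (rees_map_kernel_nilpotent separation R_noetherian M_fg).
- exact/(deficient_analytic_spreadP N hm).
- move=> n n0 [y Sy e]; apply: (hAss n n0); split; first exact: (local_prime R_noetherian R_local).
  by exists y.
- move=> P0 P1 h0 h1 o0 o1 s01 P1P; apply: contrapT => PP1; apply: no.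
  by exists P0, P1, P; split.
Qed.
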